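(* Let $k\ge 1$ and $i\ge 1$ be integers. The $k$-th $i$-colored Temperley-Lieb algebra $TL_{(k,i)}$ is a cellular algebra over $\mathbb{Q}(A)$ with cell datum $(\Lambda_{k,i},T,C)$, where $C$ is the map $(s,t)\mapsto G_{s,t}$.
   Context: Let $A$ be an indeterminate, work over the field $\mathbb{Q}(A)$, and put $\delta=-A^{2}-A^{-2}$. For $m,n\ge 0$ let $TL(m,n)$ be the vector space with basis the isotopy classes of crossingless diagrams (without closed loops) in a rectangle with $m$ marked points on the bottom and $n$ on the top. Diagrams are composed by stacking, $XY$ meaning $X$ on top of $Y$, each closed loop being removed at the cost of a factor $\delta$; $\otimes$ denotes horizontal juxtaposition; $\mathrm{id}_n$ is the identity diagram. $TL_n=TL(n,n)$ is the Temperley-Lieb algebra, generated by $1,e_1,\dots,e_{n-1}$ with $e_j^2=\delta e_j$, $e_je_{j\pm1}e_j=e_j$, $e_je_l=e_le_j$ for $|j-l|>1$. The map $X\mapsto X^*$, $TL(m,n)\to TL(n,m)$, is the $\mathbb{Q}(A)$-linear extension of reflecting diagrams in a horizontal line. The trace $\mathrm{tr}:TL_n\to\mathbb{Q}(A)$ sends a diagram to $\delta^{c}$, with $c$ the number of loops obtained by joining the $j$-th top point to the $j$-th bottom point for all $j$ by planar arcs outside the rectangle. The Jones-Wenzl idempotent $f_n\in TL_n$ is the unique nonzero idempotent with $e_jf_n=f_ne_j=0$ for all $1\le j\le n-1$ ($f_0$ is the empty diagram). $\Delta_n=\mathrm{tr}(f_n)=(-1)^n\frac{A^{2n+2}-A^{-2n-2}}{A^2-A^{-2}}$.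 Colored Temperley-Lieb algebra: let $F=f_i^{\otimes k}\in TL_{ki}$. Then $TL_{(k,i)}=\{FXF: X\in TL_{ki}\}$, an algebra with identity $F$. Admissibility: a triple $(x,y,z)$ of non-negative integers is admissible if $x+y+z$ is even and $x\le y+z$, $y\le x+z$, $z\le x+y$. For $(x,y,z)$ admissible put $p=\frac{x+y-z}{2}$, $r=\frac{x+z-y}{2}$, $q=\frac{y+z-x}{2}$; the trivalent vertex is $V_{x,y}^{z}=f_z\,E\,(f_x\otimes f_y)\in TL(x+y,z)$, where $E\in TL(x+y,z)$ joins the last $p$ of the first $x$ bottom points to the first $p$ of the last $y$ bottom points by nested arcs, and the remaining $r+q=z$ bottom points to the top points without crossings. The theta value is $\theta(x,y,z)=\mathrm{tr}\big(V_{x,y}^{z}(V_{x,y}^{z})^{*}\big)$ (symmetric in $x,y,z$). An $i$-admissible sequence of length $k$ is a sequence $s=(s_1,\dots,s_k)$ of non-negative integers with $s_1=i$ and $(s_{j-1},s_j,i)$ admissible for $1<j\le k$; its weight is $\omega(s)=s_k$. Define $v_s\in TL(ki,s_k)$ recursively by $v_{(i)}=f_i$, $v_{(s_1,\dots,s_m)}=V_{s_{m-1},i}^{s_m}(v_{(s_1,\dots,s_{m-1})}\otimes\mathrm{id}_i)$, and put $\eta(s)=\prod_{j=1}^{k-1}\frac{\theta(s_{j+1},s_j,i)}{\Delta_{s_{j+1}}}$ (which is nonzero). $\Lambda_{k,i}=\{ki-2j: j=0,\dots,\lfloor ki/2\rfloor\}$ with its natural order; for $\lambda\in\Lambda_{k,i}$,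 $T(\lambda)$ is the set of $i$-admissible sequences of length $k$ and weight $\lambda$. For $s,t\in T(\lambda)$, $G_{s,t}=C(s,t)=\frac{1}{\eta(s)}\,v_s^{*}v_t\in TL_{(k,i)}$. Cell datum: a cell datum for a unital algebra $B$ over a commutative ring $R$ is a triple $(\Lambda,T,C)$ where $\Lambda=(\Lambda,>)$ is a finite poset, $T(\lambda)$ is a finite set for each $\lambda\in\Lambda$, and $C:\coprod_{\lambda\in\Lambda}T(\lambda)\times T(\lambda)\to B$, $(s,t)\mapsto a^\lambda_{st}$, is an injective map such that: (1) $\{a^\lambda_{st}:\lambda\in\Lambda,\ s,t\in T(\lambda)\}$ is an $R$-free basis of $B$; (2) for any $x\in B$ and $t\in T(\lambda)$ there are scalars $r_{tvx}\in R$ such that for every $s\in T(\lambda)$, $a^\lambda_{st}x\equiv\sum_{v\in T(\lambda)}r_{tvx}a^\lambda_{sv}\pmod{B^\lambda}$, where $B^\lambda$ is the $R$-submodule with basis $\{a^\mu_{yz}:\mu>\lambda,\ y,z\in T(\mu)\}$; (3) the $R$-linear map determined by $a^\lambda_{st}\mapsto a^\lambda_{ts}$ is an anti-isomorphism of $B$. An algebra with a cell datum is called cellular. *)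

(* Defs.v *)
From HB Require Import structures.
From mathcomp Require Import all_boot all_order all_algebra fraction.
From mathcomp Require Import boolp classical_sets functions.

Set Implicit Arguments.
Unset Strict Implicit.
Unset Printing Implicit Defensive.

Import Order.TTheory GRing.Theory.

Local Open Scope ring_scope.
Local Open Scope classical_set_scope.

(* The algebra is carried by a subset B of an R-module V and its unit is given
   explicitly: the algebras of interest are corners F TL F of a larger algebra,
   whose unit F is not the unit of the larger algebra. *)
Record unital_algebra (R : comPzRingType) (V : lmodType R)
    (B : set V) (mul : V -> V -> V) (one : V) : Prop := UnitalAlgebra {
  ualg_zero : B 0;
  ualg_lin  : forall (a : R) x y, B x -> B y -> B (a *: x + y);
  ualg_mul  : forall x y, B x -> B y -> B (mul x y);
  ualg_one  : B one;
  ualg_linl : forall (a : R) x y z, B x -> B y -> B z ->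
                mul (a *: x + y) z = a *: mul x z + mul y z;
  ualg_linr : forall (a : R) x y z, B x -> B y -> B z ->
                mul z (a *: x + y) = a *: mul z x + mul z y;
  ualg_mulA : forall x y z, B x -> B y -> B z ->
                mul x (mul y z) = mul (mul x y) z;
  ualg_mul1l : forall x, B x -> mul one x = x;
  ualg_mul1r : forall x, B x -> mul x one = x }.

Section CellDatum.

Variables (R : comPzRingType) (V : lmodType R).
Variables (B : set V) (mul : V -> V -> V) (one : V).
Variables (disp : Order.disp_t) (L : finPOrderType disp) (T : L -> finType).
Variable C : forall l : L, T l -> T l -> V.

(* The disjoint union of the T(l) x T(l). *)
Definition cell_index : finType := {l : L & (T l * T l)%type}.

Definition cell_elt (p : cell_index) : V :=
  C (tagged p).1 (tagged p).2.

(* The submodule written B^l in the usual axioms. *)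
Definition cell_ideal (l : L) : set V :=
  [set y | exists c : cell_index -> R,
     y = \sum_(p : cell_index | (l < tag p)%O) c p *: cell_elt p].

Record cell_datum : Prop := CellDatum {
  cell_in   : forall (l : L) (s t : T l), B (C s t);
  cell_inj  : injective cell_elt;
  cell_free : forall c : cell_index -> R,
    \sum_p c p *: cell_elt p = 0 -> forall p, c p = 0;
  cell_span : forall x, B x ->
    exists c : cell_index -> R, x = \sum_p c p *: cell_elt p;
  cell_mul  : forall x, B x -> forall (l : L) (t : T l),
    exists r : T l -> R, forall s : T l,
      cell_ideal l (mul (C s t) x - \sum_v r v *: C s v);
  (* phi is only meaningful on B, where cell_span and the first two conditions
     determine it. *)
  cell_anti : exists phi : V -> V,
    [/\ forall (a : R) x y, B x -> B y -> phi (a *: x + y) = a *: phi x + phi y,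
        forall (l : L) (s t : T l), phi (C s t) = C t s,
        set_bij B B phi,
        phi one = one
      & forall x y, B x -> B y -> phi (mul x y) = mul (phi y) (phi x)] }.

Definition cellular_with_datum : Prop :=
  unital_algebra B mul one /\ cell_datum.

End CellDatum.

Arguments cellular_with_datum R V B mul one {disp} L T C.

Definition QA : fieldType := {fraction {poly rat}}.

Definition A : QA := tofrac 'X.

Definition delta : QA := - A ^+ 2 - A ^- 2.

(* Marked points of the rectangle, numbered from the left: inl for the m bottom
   points and inr for the n top points. *)
Definition pt (m n : nat) : finType := ('I_m + 'I_n)%type.

(* Position along the boundary of the rectangle, read counterclockwise from the
   bottom left corner. *)
Definition bpos m n (u : pt m n) : nat :=
  match u with
  | inl a => a
  | inr b => (m + (n - b.+1))%N
  end.

(* A crossingless diagram without closed loops is determined up to isotopy by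
   how it pairs the marked points; the pairings that occur are the perfect
   matchings without two interleaved pairs on the boundary. *)
Definition crossingless m n (d : {ffun pt m n -> pt m n}) : bool :=
  [&& [forall u, d u != u],
      [forall u, d (d u) == u]
    & [forall u, forall v,
        ~~ [&& (bpos u < bpos v)%N, (bpos v < bpos (d u))%N
             & (bpos (d u) < bpos (d v))%N]]].

Definition diag (m n : nat) : finType :=
  {d : {ffun pt m n -> pt m n} | crossingless d}.

Definition partner m n (d : diag m n) : pt m n -> pt m n := val d.

(* The space TL(m,n) with m points on the bottom and n on the top: a vector is
   the family of its coefficients on the diagrams. *)
Definition TL (m n : nat) : lmodType QA := {ffun diag m n -> QA^o}.

Definition coef m n (X : TL m n) (d : diag m n) : QA :=
  (X : {ffun diag m n -> QA^o}) d.

(* The basis vector of the diagram whose arcs are the pairs related by r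
   (and 0 when there is no such diagram). *)
Definition diagvec m n (r : rel (pt m n)) : TL m n :=
  [ffun d => ([forall u, forall v, (partner d u == v) == r u v])%:R : QA^o].

Lemma diagvecE m n (d d' : diag m n) :
  coef (diagvec (frel (partner d))) d' = (d' == d)%:R.
Proof.
rewrite /coef /diagvec ffunE; congr (_%:R); congr nat_of_bool.
apply/idP/eqP => [/forallP h|->]; last by apply/forallP => u; apply/forallP.
apply/val_inj/ffunP => u; apply/eqP.
by move/forallP: (h u) => /(_ (partner d u)) /eqP ->; apply/eqP.
Qed.

Definition id_arcs n : rel (pt n n) := fun u v =>
  match u, v with
  | inl a, inr b | inr b, inl a => a == b
  | _, _ => false
  end.

Definition tlid n : TL n n := diagvec (@id_arcs n).

Section Stacking.

Variables (m n p : nat).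

(* Points of x stacked on y: the bottom and the top of y, the latter glued to
   the bottom of x, and the top of x. *)
Definition spt : finType := ('I_m + 'I_n + 'I_p)%type.

Definition lower (u : pt m n) : spt := inl u.

Definition upper (u : pt n p) : spt :=
  match u with inl b => inl (inr b) | inr c => inr c end.

Definition outer (u : pt m p) : spt :=
  match u with inl a => inl (inl a) | inr c => inr c end.

Definition stack (x : diag n p) (y : diag m n) : rel spt := fun u v =>
  [exists w, (lower w == u) && (lower (partner y w) == v)] ||
  [exists w, (upper w == u) && (upper (partner x w) == v)].

Definition comp_arcs (x : diag n p) (y : diag m n) : rel (pt m p) :=
  fun u v => (u != v) && connect (stack x y) (outer u) (outer v).

(* The closed loops are the connected components without outer points. *)
Definition comp_loops (x : diag n p) (y : diag m n) : nat :=
  n_comp (stack x y)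
    [pred w | ~~ [exists u, connect (stack x y) (outer u) w]].

(* The product XY, with X on top of Y. *)
Definition tlcomp (X : TL n p) (Y : TL m n) : TL m p :=
  \sum_(x : diag n p) \sum_(y : diag m n)
    (coef X x * coef Y y * delta ^+ comp_loops x y) *: diagvec (comp_arcs x y).

End Stacking.

Section Juxtaposition.

Variables (m n m' n' : nat).

Definition side (u : pt (m + m') (n + n')) : (pt m n + pt m' n')%type :=
  match u with
  | inl a => match fintype.split a with inl b => inl (inl b) | inr b => inr (inl b) end
  | inr a => match fintype.split a with inl b => inl (inr b) | inr b => inr (inr b) end
  end.

Definition tens_arcs (x : diag m n) (y : diag m' n') :
    rel (pt (m + m') (n + n')) := fun u v =>
  match side u, side v with
  | inl a, inl b => partner x a == b
  | inr a, inr b => partner y a == b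
  | _, _ => false
  end.

(* X on the left of Y. *)
Definition tltens (X : TL m n) (Y : TL m' n') : TL (m + m') (n + n') :=
  \sum_(x : diag m n) \sum_(y : diag m' n')
    (coef X x * coef Y y) *: diagvec (tens_arcs x y).

End Juxtaposition.

Definition ptswap m n (u : pt m n) : pt n m :=
  match u with inl a => inr a | inr b => inl b end.

Definition star_arcs m n (x : diag m n) : rel (pt n m) :=
  fun u v => partner x (ptswap u) == ptswap v.

Definition tlstar m n (X : TL m n) : TL n m :=
  \sum_(x : diag m n) coef X x *: diagvec (star_arcs x).

Definition closure_loops n (x : diag n n) : nat :=
  n_comp [rel u v | (partner x u == v) || @id_arcs n u v] predT.

Definition tltr n (X : TL n n) : QA :=
  \sum_(x : diag n n) coef X x * delta ^+ closure_loops x.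

(* e_j for 1 <= j <= n - 1 joins the j-th and (j+1)-st points, whose numbers as
   ordinals are j - 1 and j. *)
Definition e_arcs n (j : nat) : rel (pt n n) := fun u v =>
  match u, v with
  | inl a, inl b | inr a, inr b =>
      ((a.+1 == j) && (b == j :> nat)) || ((a == j :> nat) && (b.+1 == j))
  | inl a, inr b | inr b, inl a => [&& a == b, a.+1 != j & a != j :> nat]
  end.

Definition tle n (j : nat) : TL n n := diagvec (@e_arcs n j).

Definition is_jones_wenzl n (f : TL n n) : Prop :=
  [/\ f <> 0,
      tlcomp f f = f
    & forall j, (1 <= j < n)%N -> tlcomp (tle n j) f = 0 /\ tlcomp f (tle n j) = 0].

(* f_n; xget selects an element satisfying is_jones_wenzl, which is unique, and
   would return 0 if there were none. *)
Definition jw n : TL n n := xget 0 [set f | is_jones_wenzl f].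

Definition Delta n : QA := tltr (jw n).

(* k * i, computed so that adding i strands on the right is definitional. *)
Fixpoint width (i k : nat) : nat :=
  if k is k'.+1 then (width i k' + i)%N else 0%N.

Lemma widthE i k : width i k = (k * i)%N.
Proof. by elim: k => //= k ->; rewrite mulSn addnC. Qed.

(* F = f_i tensored k times with itself. *)
Fixpoint jwpow (i k : nat) : TL (width i k) (width i k) :=
  if k is k'.+1 then tltens (jwpow i k') (jw i) else tlid 0.

Definition TLcol (k i : nat) : set (TL (width i k) (width i k)) :=
  [set Y | exists X : TL (width i k) (width i k),
     Y = tlcomp (jwpow i k) (tlcomp X (jwpow i k))].

Arguments TLcol : clear implicits.

Definition admissible (x y z : nat) : bool :=
  [&& ~~ odd (x + y + z), (x <= y + z)%N, (y <= x + z)%N & (z <= x + y)%N].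

Section Vertex.

Variables (x y z : nat).

Let p := ((x + y - z) %/ 2)%N.
Let r := ((x + z - y) %/ 2)%N.

(* The nested arcs: bottom points a < x <= b at the same distance from the
   middle, a being one of the last p of the first x points (x = r + p). *)
Definition vertex_cap (a b : 'I_(x + y)) : bool :=
  [&& (r <= a)%N, (a < x)%N, (x <= b)%N & (a + b + 1 == x + x)%N].

(* The through strands: the first r points of the x points go to the first r
   top points; the last q of the y points go to the last q top points. *)
Definition vertex_through (a : 'I_(x + y)) (c : 'I_z) : bool :=
  ((a < r)%N && (a == c :> nat)) ||
  ((x + p <= a)%N && (a + r == x + p + c)%N).

Definition vertex_arcs : rel (pt (x + y) z) := fun u v =>
  match u, v with
  | inl a, inl b => vertex_cap a b || vertex_cap b a
  | inl a, inr c | inr c, inl a => vertex_through a c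
  | inr _, inr _ => false
  end.

Definition vertex : TL (x + y) z :=
  tlcomp (jw z) (tlcomp (diagvec vertex_arcs) (tltens (jw x) (jw y))).

End Vertex.

Definition theta (x y z : nat) : QA :=
  tltr (tlcomp (vertex x y z) (tlstar (vertex x y z))).

Definition iadmissible (i : nat) (s : seq nat) : bool :=
  if s is s1 :: s' then (s1 == i) && path (fun a b => admissible a b i) s1 s'
  else false.

Lemma iadmissible_bound i s :
  iadmissible i s -> all (fun a => a <= width i (size s))%N s.
Proof.
have H : forall s' a N, (a <= N)%N ->
    path (fun a b => admissible a b i) a s' ->
    all (fun b => b <= N + size s' * i)%N (a :: s').
  elim=> [|b s' IH] a N leaN /=; first by rewrite mul0n addn0 leaN.
  case/andP=> /and4P[_ _ leb _] ps.
  have := IH b (N + i)%N (leq_trans leb (leq_add leaN (leqnn i))) ps.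
  by rewrite mulSn addnA => /= ->; rewrite andbT -addnA (leq_trans leaN) // leq_addr.
case: s => //= a s /andP[/eqP -> ps].
by rewrite widthE addnC; apply: H.
Qed.

(* Lambda_{k,i} = {ki - 2j : 0 <= j <= ki/2}, with the order of nat. *)
Definition in_weights (k i : nat) (x : 'I_(width i k).+1) : bool :=
  [exists j : 'I_((width i k) %/ 2).+1, x == (width i k - 2 * j)%N :> nat].

Definition weights (k i : nat) := {x : 'I_(width i k).+1 | in_weights x}.

HB.instance Definition _ k i := Finite.on (weights k i).
HB.instance Definition _ k i := SubType.on (weights k i).
HB.instance Definition _ k i :=
  [SubChoice_isSubOrder of weights k i by <: with Order.OrdinalOrder.ord_display].

Definition weight_val k i (l : weights k i) : nat := val l.

(* T(l). Restricting to entries at most ki loses no sequence, by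
   iadmissible_bound. *)
Definition cellT (k i : nat) (l : weights k i) : finType :=
  {s : k.-tuple 'I_(width i k).+1
     | iadmissible i (map val s) && (last 0%N (map val s) == weight_val l)}.

(* The entries s_1, ..., s_k, numbered from 1. *)
Definition entry k i (l : weights k i) (s : cellT l) (j : nat) : nat :=
  nth 0%N (map val (val s)) j.-1.

(* X seen in TL(m,n') when n = n'; a type cast, only used when n = n'. *)
Definition recast m n n' (X : TL m n) : TL m n' :=
  if n =P n' is ReflectT e then ecast z (TL m z) e X else 0.

(* v_(s_1, ..., s_k); the base case is f_i, for sequences with s_1 = i. The
   value 0 at k = 0 is arbitrary. *)
Fixpoint vvec (i : nat) (s : nat -> nat) (k : nat) : TL (width i k) (s k) :=
  match k return TL (width i k) (s k) with
  | 0 => 0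
  | m.+1 =>
    match m return TL (width i m) (s m) -> TL (width i m.+1) (s m.+1) with
    | 0 => fun _ => recast (s 1%N) (jw i : TL (width i 1) i)
    | m'.+1 => fun v =>
        tlcomp (vertex (s m'.+1) i (s m'.+2)) (tltens v (tlid i))
    end (vvec i s m)
  end.

Definition eta (i : nat) (s : nat -> nat) (k : nat) : QA :=
  \prod_(1 <= j < k) (theta (s j.+1) (s j) i / Delta (s j.+1)).

Definition cellv k i (l : weights k i) (s : cellT l) :
    TL (width i k) (weight_val l) :=
  recast (weight_val l) (vvec i (entry s) k).

Definition cellG k i (l : weights k i) (s t : cellT l) :
    TL (width i k) (width i k) :=
  (eta i (entry s) k)^-1 *: tlcomp (tlstar (cellv s)) (cellv t).

(* Main.v *)
Require Import Defs.
From mathcomp Require Import all_boot all_order all_algebra.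
From mathcomp Require Import fraction generic_quotient zify.
From mathcomp Require Import boolp classical_sets.

(* Capping v_t by x in TL_(k,i) gives an element of f_l TL F, and Schur's lemma for
   the Jones-Wenzl idempotents (f_m TL f_n is 0 if m <> n and the line of f_n if
   m = n, since f kills every diagram that turns back) makes the G_{s,t} matrix
   units up to nonzero scalars: G_{s,t} G_{u,v} = [t = u] (n_t / eta_t) G_{s,v}, where
   v_t v_t^* = n_t f_l. For such a basis the cell axioms hold for any order.

   That the diagrams form a category is proved with two-colorings. The number of
   ways to color the arcs of a stack given the colors of its outer points is
   2 ^ loops if the outer colors agree along the composite and 0 otherwise, and
   the colorings compatible with a diagram determine it; so each identity between
   diagrams, with its loops, is an identity between sums over colorings.

   The trace form is nondegenerate, because gluing x^* to y makes strictly fewer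
   loops when y <> x and delta is transcendental. The functional dual to the identity
   diagram gives f_n, together with Delta_n <> 0.

   Every diagram from x + y to z points that turns back neither on top nor inside
   the x points nor inside the y points is the one of the trivalent vertex V. As
   the identity factors through the f_z, the idempotent f_x (x) f_y is in the span of
   the V^* V. If V V^* were 0 then V = V (f_x (x) f_y) would vanish, but the coefficient
   in V of its own diagram is 1; hence theta <> 0. *)

Set Implicit Arguments.
Unset Strict Implicit.
Unset Printing Implicit Defensive.

Import GRing.Theory.

Local Open Scope nat_scope.

(** * Crossingless matchings and their composition *)

(** Stacking is defined by connectivity in the glued graph, and [diagvec] returns 0 on a relation
    that is not a crossingless matching. So it must be shown before any algebra that two stacked
    matchings give a matching: the ends of a path are paired because a component is an orbit of two
    involutions, and planarity holds because crossing numbers modulo 2 survive gluing. Counting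
    colorings at loop value 2 loses no loop: 2 ^ l determines l, and delta ^ l is restored
    afterwards. All that enters about Delta_n, theta and n_t is that they do not vanish. Inverting
    the Gram matrix of the trace form yields f_n and Delta_n <> 0 at once. Swapping the indices of
    G_{s,t} is not the restriction of the reflection, which sends G_{s,t} to (eta_t / eta_s)
    G_{t,s}. The anti-isomorphism is therefore built from coordinates; it reverses products because
    the scalar n_t / eta_t depends on the inner index alone. *)

Section Dihedral.

Variables (T : finType) (s t : T -> T).
Hypotheses (sK : involutive s) (tK : involutive t) (sN : forall x, s x != x).

Let r x := s (t x).
Let e : rel T := fun x y => (s x == y) || (t x == y).

Lemma dihedral_inj : injective r.
Proof. by move=> x y /(inv_inj sK) /(inv_inj tK). Qed.

(** The dihedral relation [r (t (r x)) = t x] cancels one [r] on each side of [t]. *)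
Lemma dihedral_flip u k : t u = u -> iter k r (t (iter k r u)) = u.
Proof.
move=> tu; elim: k => [//|k IH]; rewrite iterSr.
by rewrite (_ : r (t _) = t (iter k r u)) // /r iterS tK sK.
Qed.

(* On the orbit of u under r, t acts as k |-> - k and s as k |-> 1 - k. As s has
   no fixed point, the length 2j of the orbit is even, and the fixed points of t
   are at 0 and j. *)
Lemma fixed_mate u : t u = u ->
  exists v, [/\ v != u, t v = v, connect e u v
    & forall w, t w = w -> connect e u w -> (w == u) || (w == v)].
Proof.
move=> tu; pose L := order r u.
have L0 : 0 < L by apply: order_gt0.
have rL : iter L r u = u by apply: (iter_order dihedral_inj).
have iterI k : injective (iter k r) by elim: k => //= k IH x y /dihedral_inj /IH.
have small j : 0 < j < L -> iter j r u != u.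
  case/andP=> j0 jL; apply/eqP => ju.
  have := findex_iter jL; rewrite ju findex0 => /eqP; lia.
have oddL : ~~ odd L.
  apply/negP => o; pose j := L./2; have Lj : L = j.+1 + j by rewrite /j; lia.
  have h : t (iter j r u) = iter j.+1 r u.
    by apply: (iterI j); rewrite dihedral_flip // -iterD addnC -Lj rL.
  by have /eqP := sN (iter j.+1 r u); rewrite -{1}h.
pose j := L./2; have Lj : L = j + j by rewrite /j; lia.
have j0 : 0 < j < L by lia.
have con k : connect e u (iter k r u).
  elim: k => [|k IH]; first exact: connect0.
  apply: (connect_trans IH) => /=.
  by apply: (@connect_trans _ _ (t (iter k r u))); apply: connect1;
    rewrite /e eqxx ?orbT.
exists (iter j r u); split.
- exact: small.
- by apply: (iterI j); rewrite dihedral_flip // -iterD -Lj rL.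
- exact: con.
have tin w : fconnect r u w -> fconnect r u (t w).
  move/iter_findex=> <-; set k := findex _ _ _.
  rewrite (fconnect_sym dihedral_inj) -{2}(dihedral_flip k tu).
  exact: fconnect_iter.
have cl w : connect e u w -> fconnect r u w.
  case/connectP=> p pp ->.
  have : fconnect r u u by [].
  elim: p {-2 4}u pp => //= x p IH y /andP[/orP[]/eqP <- px] uy; apply: IH => //.
    have := tin y uy => h; rewrite -[y]tK.
    by apply: connect_trans h (fconnect1 _ _).
  exact: tin.
move=> w tw /cl uw; have := iter_findex uw.
have kL := findex_max uw; move: kL; set k := findex _ _ _ => kL wk.
(* Reflecting the fixed point w = r^k u gives r^(2k) u = u, so L divides 2k; as k < L, either k = 0
   or 2k = L. *)
have h : iter (k + k) r u = u.
  by rewrite iterD; rewrite -{2}(dihedral_flip k tu) wk tw -wk.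
case: (ltnP (k + k) L) => kkL.
  case: (posnP k) => [k0|kp]; first by rewrite -wk k0 eqxx.
  have kk : 0 < k + k < L by lia.
  by have := small _ kk; rewrite h eqxx.
have h2 : iter (k + k - L) r u = u.
  by move: h; rewrite -{1}(subnK kkL) iterD rL.
case: (posnP (k + k - L)) => [z|zp].
  by rewrite -wk (_ : k = j) ?eqxx ?orbT //; lia.
have kk : 0 < k + k - L < L by lia.
by have := small _ kk; rewrite h2 eqxx.
Qed.

End Dihedral.

Section Diagrams.

Variables m n : nat.
Implicit Types (d : diag m n) (u v : pt m n).

Lemma partnerN d u : partner d u != u.
Proof. by have /and3P[/forallP/(_ u)] := valP d. Qed.

Lemma partnerK d : involutive (partner d).
Proof. by move=> u; have /and3P[_ /forallP/(_ u)/eqP] := valP d. Qed.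

Lemma partner_planar d u v :
  ~~ [&& bpos u < bpos v, bpos v < bpos (partner d u)
       & bpos (partner d u) < bpos (partner d v)].
Proof. by have /and3P[_ _ /forallP/(_ u)/forallP/(_ v)] := valP d. Qed.

Lemma diag_ext d d' : partner d =1 partner d' -> d = d'.
Proof. by move=> h; apply/val_inj/ffunP. Qed.

Lemma diag_exists (g : pt m n -> pt m n) :
    (forall u, g u != u) -> involutive g ->
    (forall u v, ~~ [&& bpos u < bpos v, bpos v < bpos (g u)
                      & bpos (g u) < bpos (g v)]) ->
  exists d, partner d =1 g.
Proof.
move=> gN gK gp; have c : crossingless (finfun g).
  apply/and3P; split; apply/forallP => u; rewrite ?ffunE //.
    by rewrite gK.
  by apply/forallP => v; rewrite !ffunE.
by exists (exist _ (finfun g) c) => u; rewrite /partner /= ffunE.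
Qed.

Lemma bpos_inj : injective (@bpos m n).
Proof.
move=> [a|b] [a'|b'] /= h.
- by congr inl; apply: val_inj.
- by have := ltn_ord a; lia.
- by have := ltn_ord a'; lia.
- congr inr; apply: val_inj => /=.
  by have := ltn_ord b; have := ltn_ord b'; lia.
Qed.

(** Each arc is charged to its endpoint that comes first on the boundary. *)
Lemma sum_arcs d (P : pred (pt m n)) (F : pt m n -> nat) :
    (forall u, P (partner d u) = P u) ->
  \sum_(u | P u) F u =
  \sum_(u | P u && (bpos u < bpos (partner d u))) (F u + F (partner d u)).
Proof.
move=> Pd; rewrite (bigID (fun u => bpos u < bpos (partner d u))) /= big_split /=.
congr (_ + _).
rewrite (reindex_inj (inv_inj (partnerK d))) /=; apply: eq_bigl => u.
rewrite Pd partnerK; congr (_ && _).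
by case: ltngtP => // /bpos_inj e; have := partnerN d u; rewrite e eqxx.
Qed.

Lemma even_closed d (P : pred (pt m n)) :
  (forall u, P (partner d u) = P u) -> ~~ odd (\sum_(u | P u) 1).
Proof.
move=> Pd; rewrite (sum_arcs _ Pd).
by elim/big_ind: _ => // a b; rewrite oddD => /negPf-> /negPf->.
Qed.

(* Two arcs {s, ds} and {t, dt} cross exactly when an odd number of the four
   comparisons of an endpoint of the first with one of the second is true. *)
Lemma even_intersection d (P Q : pred (pt m n)) :
    (forall u, P (partner d u) = P u) -> (forall u, Q (partner d u) = Q u) ->
    (forall u, P u -> ~~ Q u) ->
  ~~ odd (\sum_(s | P s) \sum_(t | Q t) (bpos s < bpos t)).
Proof.
move=> Pd Qd PQ; rewrite (sum_arcs _ Pd).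
elim/big_ind: _ => [//|a b|s /andP[Ps lts]]; first by rewrite oddD => /negPf-> /negPf->.
rewrite -big_split /= (sum_arcs _ Qd).
elim/big_ind: _ => [//|a b|t /andP[Qt ltt]]; first by rewrite oddD => /negPf-> /negPf->.
have st w w' : P w -> Q w' -> bpos w != bpos w'.
  by move=> Pw Qw'; apply/eqP => /bpos_inj e; move: (PQ w Pw); rewrite e Qw'.
have Ps' : P (partner d s) by rewrite Pd.
have Qt' : Q (partner d t) by rewrite Qd.
have := partner_planar d s t; have := partner_planar d t s.
have := st _ _ Ps Qt; have := st _ _ Ps Qt'; have := st _ _ Ps' Qt.
have := st _ _ Ps' Qt'; move: lts ltt.
move: (bpos s) (bpos t) (bpos (partner d s)) (bpos (partner d t)).
lia.
Qed.

End Diagrams.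

(** * Counting pairs of points, for the crossing parity *)

Section SumsOverPairs.

Definition pairs_sum (I J : finType) (P : pred I) (Q : pred J)
    (F : I -> J -> bool) : nat :=
  \sum_(a | P a) \sum_(b | Q b) F a b.

Lemma pairs_sum_true (I J : finType) (P : pred I) (Q : pred J)
    (F : I -> J -> bool) :
    (forall a b, P a -> Q b -> F a b) ->
  pairs_sum P Q F = (\sum_(a | P a) 1) * (\sum_(b | Q b) 1).
Proof.
move=> FT; rewrite /pairs_sum big_distrl /=; apply: eq_bigr => a Pa.
by rewrite mul1n; apply: eq_bigr => b Qb; rewrite FT.
Qed.

Lemma pairs_sum_false (I J : finType) (P : pred I) (Q : pred J)
    (F : I -> J -> bool) :
  (forall a b, F a b = false) -> pairs_sum P Q F = 0.
Proof. by move=> FF; rewrite /pairs_sum big1 // => a _; rewrite big1 // => b _;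
  rewrite FF. Qed.

Lemma pairs_sumU (I1 I2 J1 J2 : finType) (P : pred (I1 + I2)%type)
    (Q : pred (J1 + J2)%type) F :
  pairs_sum P Q F =
    pairs_sum (fun a => P (inl a)) (fun b => Q (inl b)) (fun a b => F (inl a) (inl b))
  + pairs_sum (fun a => P (inl a)) (fun b => Q (inr b)) (fun a b => F (inl a) (inr b))
  + pairs_sum (fun a => P (inr a)) (fun b => Q (inl b)) (fun a b => F (inr a) (inl b))
  + pairs_sum (fun a => P (inr a)) (fun b => Q (inr b)) (fun a b => F (inr a) (inr b)).
Proof.
rewrite /pairs_sum big_sumType /= -addnA; congr (_ + _).
  by rewrite -big_split; apply: eq_bigr => a _; rewrite big_sumType.
by rewrite -big_split; apply: eq_bigr => a _; rewrite big_sumType.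
Qed.

Lemma pairs_sum_compl (I : finType) (P Q : pred I) (F : I -> nat) :
    injective F -> (forall a, P a -> ~~ Q a) ->
  pairs_sum P Q (fun a b => F a < F b) + pairs_sum P Q (fun a b => F b < F a) =
  (\sum_(a | P a) 1) * (\sum_(b | Q b) 1).
Proof.
move=> Finj PQ; rewrite -(@pairs_sum_true _ _ P Q (fun _ _ => true)) //.
rewrite /pairs_sum -big_split; apply: eq_bigr => a Pa.
rewrite -big_split; apply: eq_bigr => b Qb /=.
by case: ltngtP => // /Finj e; move: (PQ a Pa); rewrite e Qb.
Qed.

Lemma pairs_sum_pred2 (I : finType) (u u' v v' : I) (F : I -> I -> bool) :
    u' != u -> v' != v ->
  pairs_sum (pred2 u u') (pred2 v v') F = F u v + F u v' + F u' v + F u' v'.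
Proof.
move=> hu hv; rewrite /pairs_sum.
have two (w w' : I) (G : I -> nat) : w' != w -> \sum_(a | pred2 w w' a) G a = G w + G w'.
  move=> ww; rewrite (bigD1 w) /= ?eqxx //; congr (_ + _).
  rewrite (eq_bigl (pred1 w')) ?big_pred1_eq // => a /=.
  by case: (eqVneq a w) => [->|] /=; rewrite ?andbF ?andbT // eq_sym (negPf ww).
by rewrite two // !two // addnA.
Qed.

End SumsOverPairs.

Section Composition.

Variables m n p : nat.
Variables (x : diag n p) (y : diag m n).

(** The points of y and x before gluing. [sig] follows an arc and [tau] jumps across the glued line,
    fixing exactly the outer points; so the components of the stack are orbits of two involutions,
    and [fixed_mate] pairs the outer points. *)
Let T : finType := (pt m n + pt n p)%type.

Let sig (w : T) : T :=
  match w with inl w => inl (partner y w) | inr w => inr (partner x w) end.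

Let tau (w : T) : T :=
  match w with
  | inl (inr b) => inr (inl b)
  | inr (inl b) => inl (inr b)
  | w => w
  end.

Let glue (w : T) : spt m n p :=
  match w with inl w => lower p w | inr w => upper m w end.

Let out (u : pt m p) : T :=
  match u with inl a => inl (inl a) | inr c => inr (inr c) end.

Let sigK : involutive sig.
Proof. by move=> [w|w] /=; rewrite partnerK. Qed.

Let tauK : involutive tau.
Proof. by move=> [[a|a]|[a|a]]. Qed.

Let sigN w : sig w != w.
Proof.
case: w => w; apply/eqP => /= -[/eqP]; by rewrite (negPf (partnerN _ _)).
Qed.

Let glue_tau w : glue (tau w) = glue w.
Proof. by case: w => [[a|a]|[a|a]]. Qed.

Let glue_inj w w' : glue w = glue w' -> w = w' \/ w = tau w'.
Proof.
by case: w => [[a|a]|[a|a]]; case: w' => [[b|b]|[b|b]] //= [->]; auto.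
Qed.

Let glue_out u : glue (out u) = outer n u.
Proof. by case: u. Qed.

Let tau_out u : tau (out u) = out u.
Proof. by case: u. Qed.

Let tau_fixed w : tau w = w -> exists u, w = out u.
Proof. by case: w => [[a|a]|[a|a]] //= _; [exists (inl a)|exists (inr a)]. Qed.

Let out_inj : injective out.
Proof. by move=> [a|a] [b|b] //= [->]. Qed.

Let stackE u v : stack x y u v = [exists w, (glue w == u) && (glue (sig w) == v)].
Proof.
apply/orP/existsP => [[]/existsP[w h]|[[w|w] h]].
- by exists (inl w).
- by exists (inr w).
- by left; apply/existsP; exists w.
- by right; apply/existsP; exists w.
Qed.

Lemma stack_sym : symmetric (stack x y).
Proof.
suff h u v : stack x y u v -> stack x y v u by move=> u v; apply/idP/idP; exact: h.
rewrite !stackE => /existsP[w /andP[h1 h2]]; apply/existsP; exists (sig w).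
by rewrite sigK h1 h2.
Qed.

Lemma stack_csym : connect_sym (stack x y).
Proof. exact: sym_connect_sym stack_sym. Qed.

Let e : rel T := fun w w' => (sig w == w') || (tau w == w').

Let connect_glue w w' : connect e w w' = connect (stack x y) (glue w) (glue w').
Proof.
have csym : connect_sym e.
  apply: sym_connect_sym => a b; rewrite /e.
  by congr (_ || _); [rewrite (can2_eq sigK sigK)|rewrite (can2_eq tauK tauK)];
    rewrite eq_sym.
apply/idP/idP.
  case/connectP=> q; elim: q w => [|a q IH] w /=; first by move=> _ ->; exact: connect0.
  case/andP=> /orP[]/eqP <- pq e1; last by rewrite -(glue_tau w); exact: IH.
  apply: connect_trans (IH _ pq e1); apply: connect1; rewrite stackE.
  by apply/existsP; exists w; rewrite !eqxx.
have same a b : glue a = glue b -> connect e a b.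
  case/glue_inj => [->|->]; first exact: connect0.
  by apply: connect1; rewrite /e tauK eqxx orbT.
case/connectP=> q; elim: q w => [|a q IH] w /=; first by move=> _ /esym/same.
case/andP; rewrite stackE => /existsP[b /andP[/eqP h1 /eqP h2]] pq e1.
apply: (connect_trans (same _ _ (esym h1))).
apply: (@connect_trans _ _ (sig b)); first by apply: connect1; rewrite /e eqxx.
by apply: IH; rewrite h2.
Qed.

Lemma outer_mate u : exists v,
  [/\ v != u & forall w, connect (stack x y) (outer n u) (outer n w) = (w == u) || (w ==
    v)].
Proof.
have [v [vu tv cv vP]] := fixed_mate sigK tauK sigN (tau_out u).
have [v' ev] := tau_fixed tv; subst v.
exists v'; split; first by apply: contraNneq vu => ->.
move=> w; rewrite -!glue_out -connect_glue; apply/idP/orP => [h|[/eqP->|/eqP->] //].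
  have /orP := vP _ (tau_out w) h.
  by rewrite !(inj_eq out_inj).
Qed.

End Composition.

(** On the boundary every bottom point precedes every top point, and the top is read from right to
    left. *)
Lemma crossings_sumE m n (P Q : pred (pt m n)) :
  pairs_sum P Q (fun s t => bpos s < bpos t) =
    pairs_sum (fun a => P (inl a)) (fun b => Q (inl b)) (fun a b : 'I_m => a < b)
  + (\sum_(a | P (inl a)) 1) * (\sum_(b | Q (inr b)) 1)
  + pairs_sum (fun a => P (inr a)) (fun b => Q (inr b)) (fun a b : 'I_n => b < a).
Proof.
rewrite pairs_sumU /=.
rewrite (@pairs_sum_true 'I_m 'I_n); last by move=> a b _ _; have := ltn_ord a; lia.
rewrite (@pairs_sum_false 'I_n 'I_m); last by move=> a b; have := ltn_ord b; lia.
rewrite addn0; congr (_ + _).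
apply: eq_bigr => a _; apply: eq_bigr => b _; congr nat_of_bool.
by have := ltn_ord a; have := ltn_ord b; lia.
Qed.

Section Composition.

Variables m n p : nat.
Variables (x : diag n p) (y : diag m n).

Lemma connect_lower o w :
  connect (stack x y) o (lower p (partner y w)) = connect (stack x y) o (lower p w).
Proof.
rewrite ![connect _ o _](stack_csym x y); apply: same_connect; first exact: stack_csym.
apply: connect1; apply/orP; left; apply/existsP; exists (partner y w).
by rewrite partnerK !eqxx.
Qed.

Lemma connect_upper o w :
  connect (stack x y) o (upper m (partner x w)) = connect (stack x y) o (upper m w).
Proof.
rewrite ![connect _ o _](stack_csym x y); apply: same_connect; first exact: stack_csym.
apply: connect1; apply/orP; right; apply/existsP; exists (partner x w).
by rewrite partnerK !eqxx.
Qed.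

(* The arcs of the composite are paths P and Q of the stack. Their endpoints
   cross as often, modulo 2, as the arcs of x and of y making up P and Q do. *)
Lemma composite_planar (u v u' v' : pt m p) :
    u' != u -> v' != v ->
    (forall w, connect (stack x y) (outer n u) (outer n w) = (w == u) || (w == u')) ->
    (forall w, connect (stack x y) (outer n v) (outer n w) = (w == v) || (w == v')) ->
  ~~ [&& bpos u < bpos v, bpos v < bpos u' & bpos u' < bpos v'].
Proof.
move=> uu vv hu hv; apply/negP => /and3P[l1 l2 l3].
pose P := connect (stack x y) (outer n u); pose Q := connect (stack x y) (outer n v).
have PQ w : P w -> ~~ Q w.
  move=> Pw; apply/negP => Qw.
  have : P (outer n v) by apply: connect_trans Pw _; rewrite stack_csym.
  by rewrite /P hu => /orP[]/eqP e; move: l1 l2; rewrite e ltnn.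
have Py w : P (lower p (partner y w)) = P (lower p w) by apply: connect_lower.
have Qy w : Q (lower p (partner y w)) = Q (lower p w) by apply: connect_lower.
have Px w : P (upper m (partner x w)) = P (upper m w) by apply: connect_upper.
have Qx w : Q (upper m (partner x w)) = Q (upper m w) by apply: connect_upper.
pose cnt (I : finType) (R : pred I) : nat := \sum_(a | R a) 1.
pose bP := cnt _ (fun a => P (inl (inl a))); pose mP := cnt _ (fun a => P (inl (inr a))).
pose bQ := cnt _ (fun a => Q (inl (inl a))); pose mQ := cnt _ (fun a => Q (inl (inr a))).
pose tP := cnt _ (fun a => P (inr a)); pose tQ := cnt _ (fun a => Q (inr a)).
pose BB := pairs_sum (fun a => P (inl (inl a))) (fun a => Q (inl (inl a)))
  (fun a b : 'I_m => a < b).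
pose TT := pairs_sum (fun a => P (inr a)) (fun a => Q (inr a)) (fun a b : 'I_p => b < a).
pose MM := pairs_sum (fun a => P (inl (inr a))) (fun a => Q (inl (inr a)))
  (fun a b : 'I_n => a < b).
pose MM' := pairs_sum (fun a => P (inl (inr a))) (fun a => Q (inl (inr a)))
  (fun a b : 'I_n => b < a).
have Ny : ~~ odd (BB + bP * mQ + MM').
  have := even_intersection Py Qy (fun w => PQ (lower p w)).
  by rewrite -/(pairs_sum _ _ (fun s t => bpos s < bpos t)) crossings_sumE.
have Nx : ~~ odd (MM + mP * tQ + TT).
  have := even_intersection Px Qx (fun w => PQ (upper m w)).
  by rewrite -/(pairs_sum _ _ (fun s t => bpos s < bpos t)) crossings_sumE.
have Ey : ~~ odd (bP + mP) by have := even_closed Py; rewrite big_sumType.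
(* The glued line is read from left to right as the bottom of x and from right to left as the top of
   y, so each pair of its points counts in exactly one of the two sums. *)
have mid : MM + MM' = mP * mQ by apply: pairs_sum_compl (fun b => PQ _); apply: val_inj.
(* For interleaved ends u < v < u' < v', three of the four comparisons are true. *)
have N : pairs_sum (fun w => P (outer n w)) (fun w => Q (outer n w))
    (fun s t => bpos s < bpos t) = 3.
  transitivity (pairs_sum (pred2 u u') (pred2 v v') (fun s t => bpos s < bpos t)).
    rewrite /pairs_sum; under eq_bigl => a do rewrite /P hu.
    by apply: eq_bigr => a _; apply: eq_bigl => b; rewrite /Q hv.
  rewrite pairs_sum_pred2 //; have l4 := ltn_trans l1 l2.
  by rewrite l1 (ltn_trans l4 l3) l3 ltnNge (ltnW l2).
have {}N : BB + bP * tQ + TT = 3 by move: N; rewrite crossings_sumE.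
(* Modulo 2 the left side vanishes, while the right side is 3 plus a multiple of the even number
   [bP + mP]. *)
have : BB + bP * mQ + MM' + (MM + mP * tQ + TT) + 2 * (bP * tQ) =
    3 + (bP + mP) * (mQ + tQ) by rewrite -N mulnDl !mulnDr -mid; lia.
move: Nx Ny Ey; move: (MM + _ + _) (BB + _ + MM') (bP + mP) => X Y Z hX hY hZ.
by move/(congr1 odd); rewrite !oddD !oddM (negPf hX) (negPf hY) (negPf hZ) /= addbF addbb.
Qed.

Lemma composite_exists : exists d : diag m p, comp_arcs x y =2 frel (partner d).
Proof.
have [g gP] := fin_all_exists (outer_mate x y).
have gN u : g u != u by case: (gP u).
have gc u w : connect (stack x y) (outer n u) (outer n w) = (w == u) || (w == g u).
  by case: (gP u) => _ /(_ w).
have gK : involutive g.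
  move=> u; have := gc (g u) u; rewrite stack_csym gc eqxx orbT.
  by rewrite eq_sym (negPf (gN u)) => /esym/eqP.
have [d dP] := @diag_exists _ _ g gN gK (fun u v =>
  composite_planar (gN u) (gN v) (gc u) (gc v)).
exists d => u v; rewrite /comp_arcs /= dP gc eq_sym [g u == v]eq_sym.
by case: (eqVneq v u) => // ->; rewrite eq_sym (negPf (gN u)).
Qed.

Definition dcomp : diag m p := projT1 (cid composite_exists).

Lemma dcompP : comp_arcs x y =2 frel (partner dcomp).
Proof. exact: projT2 (cid composite_exists). Qed.

Lemma dcomp_connect u w :
  connect (stack x y) (outer n u) (outer n w) = (w == u) || (w == partner dcomp u).
Proof.
case: (eqVneq w u) => [->|wu]; first exact: connect0.
by have := dcompP u w; rewrite /comp_arcs eq_sym wu /= => ->; rewrite eq_sym.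
Qed.

End Composition.

(** * Two-colorings of diagrams *)

Lemma connect_const (W : finType) (e : rel W) (C : eqType) (g : W -> C) :
  (forall u v, e u v -> g u = g v) -> forall u v, connect e u v -> g u = g v.
Proof.
move=> ge u v /connectP[q pq ->]; elim: q u pq => //= a q IH u /andP[/ge -> /IH].
by [].
Qed.

Section CountColorings.

Variables (W P : finType) (e : rel W) (o : P -> W) (h : P -> bool).
Hypothesis esym : connect_sym e.

Let touched w := [exists u, connect e (o u) w].

Let ext : {set {ffun W -> bool}} :=
  [set g : {ffun W -> bool} | [forall u, forall v, e u v ==> (g u == g v)]
           && [forall p, g (o p) == h p]].

Let consistent := [forall p, forall q, connect e (o p) (o q) ==> (h p == h q)].

Let free : {set W} := [set w | roots e w && ~~ touched w].

Let mk (S : {set W}) : {ffun W -> bool} :=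
  [ffun w => if [pick u | connect e (o u) w] is Some u then h u
             else fingraph.root e w \in S].

Let touched_connect w w' : connect e w w' -> touched w = touched w'.
Proof.
move=> c; apply/existsP/existsP => -[u cu]; exists u; apply: connect_trans cu _ => //.
by rewrite esym.
Qed.

Let mk_touched S w u : consistent -> connect e (o u) w -> mk S w = h u.
Proof.
move=> /forallP hc cu; rewrite ffunE; case: pickP => [v cv|/(_ u)]; last by rewrite cu.
by apply/eqP; move: (hc v) => /forallP/(_ u)/implyP; apply;
  rewrite (connect_trans cv) // esym.
Qed.

Let mk_free S w : ~~ touched w -> mk S w = (fingraph.root e w \in S).
Proof.
move=> nt; rewrite ffunE; case: pickP => // u cu.
by case/negP: nt; apply/existsP; exists u.
Qed.

(** A coloring constant along [e] is prescribed by h on the components that meet the image of o, and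
    free on the others. [mk] realizes this: a set of roots of untouched components becomes the
    coloring that is true on them. *)
Lemma card_extensions :
  #|ext| = (consistent * 2 ^ n_comp e [pred w | ~~ [exists u, connect e (o u) w]])%N.
Proof.
case hc: consistent; last first.
  rewrite mul0n; apply/eqP; rewrite cards_eq0 -finset.subset0; apply/fintype.subsetP => g.
  rewrite inE => /andP[/forallP ge /forallP go]; move/negP: hc; case.
  apply/forallP => p; apply/forallP => q; apply/implyP => c.
  rewrite -(eqP (go p)) -(eqP (go q)); apply/eqP; apply: connect_const c => u v uv.
  by apply/eqP; move/forallP: (ge u) => /(_ v)/implyP/(_ uv).
have -> : ext = mk @: powerset free.
  apply/setP => g; apply/idP/imsetP => [|[S Sf ->]].
    rewrite inE => /andP[/forallP ge /forallP go].
    have gc u v : connect e u v -> g u = g v.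
      apply: connect_const => {}u {}v uv; apply/eqP.
      by move/forallP: (ge u) => /(_ v)/implyP/(_ uv).
    exists [set w in free | g w]; first by rewrite inE; apply/fintype.subsetP => w;
      rewrite inE => /andP[].
    apply/ffunP => w; case: (boolP (touched w)) => [/existsP[u cu]|nt].
      by rewrite (mk_touched _ hc cu) -(gc _ _ cu) (eqP (go u)).
    rewrite (mk_free _ nt) !inE (gc _ _ (connect_root e w)) roots_root //=.
    by rewrite -(touched_connect (connect_root e w)) nt.
  rewrite inE; apply/andP; split.
    apply/forallP => u; apply/forallP => v; apply/implyP => /connect1 uv; apply/eqP.
    case: (boolP (touched u)) => [/existsP[q cu]|nt].
      by rewrite !(@mk_touched _ _ q) // (connect_trans cu uv).
    rewrite (mk_free _ nt) mk_free -?(touched_connect uv) //.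
    by have /(fingraph.rootP esym) -> := uv.
  by apply/forallP => q; rewrite (@mk_touched _ _ q).
rewrite card_in_imset ?card_powerset ?mul1n.
  congr (2 ^ _)%N; apply: eq_card => w; rewrite !inE; congr (_ && _).
move=> S S'; rewrite !inE => /fintype.subsetP sS /fintype.subsetP sS' /ffunP eqm.
apply/setP => w; case: (boolP (w \in free)) => [|wf].
  rewrite inE => /andP[/eqP rw nt].
  by have := eqm w; rewrite !mk_free // rw.
by rewrite (contraNF (sS w)) ?(contraNF (sS' w)).
Qed.

End CountColorings.

Definition coloring n := {ffun 'I_n -> bool}.

Definition bdcolor m n (a : 'I_m -> bool) (b : 'I_n -> bool) (u : pt m n) : bool :=
  match u with inl i => a i | inr j => b j end.

(* The entry at (b, a) of the matrix of d in the representation of the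
   Temperley-Lieb category on tensor powers of a plane with an orthonormal
   basis. It is only a functor at loop value 2, but keeping track of the loops
   it is faithful on diagrams. *)
Definition chi m n (d : diag m n) (a : 'I_m -> bool) (b : 'I_n -> bool) : bool :=
  [forall u, bdcolor a b (partner d u) == bdcolor a b u].

(** Both sides count the colorings of the stack with outer colors a and c: on the left by the colors
    of the middle line, on the right by components. *)
Lemma chi_comp m n p (x : diag n p) (y : diag m n) a c :
  (\sum_(b : coloring n) chi y a b * chi x b c)%N
  = (2 ^ comp_loops x y * chi (dcomp x y) a c)%N.
Proof.
pose h := bdcolor a c.
have := card_extensions (@outer m n p) h (stack_csym x y).
rewrite -/(comp_loops x y).
have -> : [forall s, forall q, connect (stack x y) (outer n s) (outer n q) ==> (h s == h
  q)]
   = chi (dcomp x y) a c.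
  apply/forallP/forallP => [hc u|hc u].
    move/forallP: (hc (partner (dcomp x y) u)) => /(_ u); rewrite dcomp_connect.
    by rewrite partnerK eqxx orbT.
  apply/forallP => v; rewrite dcomp_connect; apply/implyP => /orP[]/eqP -> //.
  by rewrite eq_sym; apply: hc.
rewrite mulnC => <-.
pose F (b : coloring n) : {ffun spt m n p -> bool} := [ffun w : spt m n p =>
  match w with inl (inl i) => a i | inl (inr j) => b j | inr k => c k end].
have Finj : injective F.
  by move=> b b' /ffunP e; apply/ffunP => j; have := e (inl (inr j)); rewrite !ffunE.
transitivity #|[pred b : coloring n | chi y a b && chi x b c]|.
  rewrite -sum1_card [RHS]big_mkcond; apply: eq_bigr => b _.
  by rewrite mulnb inE; case: (_ && _).
rewrite -(card_imset _ Finj); apply: eq_card => g.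
apply/imsetP/idP => [[b /andP[/forallP cy /forallP cx] ->]|].
  rewrite inE; apply/andP; split.
    apply/forallP => u; apply/forallP => v; apply/implyP.
    case/orP=> /existsP[w /andP[/eqP <- /eqP <-]]; rewrite !ffunE.
      by have := cy w; rewrite eq_sym; case: w (partner y w) => [?|?] [?|?].
    by have := cx w; rewrite eq_sym; case: w (partner x w) => [?|?] [?|?].
  by apply/forallP => -[i|i]; rewrite ffunE.
rewrite inE => /andP[/forallP ge /forallP go].
exists [ffun j => g (inl (inr j))].
  apply/andP; split; apply/forallP => w.
    have : g (lower p (partner y w)) == g (lower p w).
      have /forallP/(_ (lower p (partner y w)))/implyP := ge (lower p w).
      rewrite eq_sym; apply; apply/orP; left; apply/existsP; exists w; by rewrite !eqxx.
    have ga i : g (inl (inl i)) = a i by apply/eqP; exact: go (inl i).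
    by case: w (partner y w) => [?|?] [?|?] /=; rewrite ?ffunE ?ga.
  have : g (upper m (partner x w)) == g (upper m w).
    have /forallP/(_ (upper m (partner x w)))/implyP := ge (upper m w).
    rewrite eq_sym; apply; apply/orP; right; apply/existsP; exists w; by rewrite !eqxx.
  have gc i : g (inr i) = c i by apply/eqP; exact: go (inr i).
  by case: w (partner x w) => [?|?] [?|?] /=; rewrite ?ffunE ?gc.
apply/ffunP => -[[i|j]|k]; rewrite !ffunE //.
  by apply/eqP; exact: go (inl i).
by apply/eqP; exact: go (inr k).
Qed.

Lemma chi_true m n (d : diag m n) : chi d (fun _ => true) (fun _ => true).
Proof. by apply/forallP => u; case: u (partner d u) => [?|?] [?|?]. Qed.

Lemma eq_chi m n (d : diag m n) a a' b b' : a =1 a' -> b =1 b' -> chi d a b = chi d a' b'.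
Proof.
move=> ha hb; apply: eq_forallb => u.
by case: u (partner d u) => [?|?] [?|?] /=; rewrite ?ha ?hb.
Qed.

(** The coloring that is true exactly on one arc of d is compatible with d' only if d' has that arc
    as well. *)
Lemma chi_inj m n (d d' : diag m n) :
  (forall (a : coloring m) (b : coloring n), chi d a b = chi d' a b) -> d = d'.
Proof.
move=> e; apply: diag_ext => u.
pose f w := (w == u) || (w == partner d u).
pose a : coloring m := [ffun i => f (inl i)];
  pose b : coloring n := [ffun i => f (inr i)].
have fE w : bdcolor a b w = f w by case: w => i /=; rewrite ffunE.
have : chi d' a b.
  rewrite -e; apply/forallP => w; rewrite !fE /f (inj_eq (inv_inj (partnerK d))).
  by rewrite (can2_eq (partnerK d) (partnerK d)) orbC.
move/forallP/(_ u); rewrite !fE /f eqxx (negPf (partnerN d' u)) /= => /eqP.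
by move/eqP.
Qed.

(** The constant coloring is compatible with every diagram, so it isolates the power of 2 and
    thereby the number of loops; once this factor is cancelled, [chi_inj] identifies the diagram. *)
Lemma dcomp_unique m n p (x : diag n p) (y : diag m n) z l :
    (forall (a : coloring m) (c : coloring p),
      (\sum_(b : coloring n) chi y a b * chi x b c)%N = (2 ^ l * chi z a c)%N) ->
  dcomp x y = z /\ comp_loops x y = l.
Proof.
move=> e; have ll : comp_loops x y = l.
  pose ct n : coloring n := [ffun=> true].
  have ct1 k (d : diag m k) : chi d (ct m) (ct k).
    by rewrite (@eq_chi _ _ _ _ (fun _ => true) _ (fun _ => true)) ?chi_true // => i;
      rewrite ffunE.
  have := e (ct m) (ct p); rewrite chi_comp !ct1 !muln1 => /eqP.
  by rewrite eqn_exp2l // => /eqP.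
split=> //; apply: chi_inj => a c; have := e a c.
rewrite chi_comp ll => /eqP; rewrite eqn_pmul2l ?expn_gt0 //.
by case: (chi _ _ _) (chi _ _ _) => [] [].
Qed.

(** * Identity, reflection and juxtaposition of diagrams *)

Lemma diagvec_ext m n (r r' : rel (pt m n)) : r =2 r' -> diagvec r = diagvec r'.
Proof.
move=> e; apply/ffunP => d; rewrite !ffunE; congr (_%:R)%R; congr nat_of_bool.
by apply: eq_forallb => u; apply: eq_forallb => v; rewrite e.
Qed.

Lemma did_exists n : exists d : diag n n, frel (partner d) =2 @id_arcs n.
Proof.
have [||u v|d dP] := @diag_exists n n (@ptswap n n); try by case.
  by case: u v => [u|u] [v|v] /=; have := ltn_ord u; have := ltn_ord v; lia.
by exists d => u v; rewrite /= dP; case: u v => u [] v; rewrite //= eq_sym.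
Qed.

Definition did n : diag n n := projT1 (cid (did_exists n)).

Lemma did_partner n (u : pt n n) : partner (did n) u = ptswap u.
Proof.
apply/eqP; have := projT2 (cid (did_exists n)) u (ptswap u) => /= ->.
by case: u => u /=.
Qed.

Lemma dstar_exists m n (x : diag m n) :
  exists d : diag n m, frel (partner d) =2 star_arcs x.
Proof.
have sK k l : cancel (@ptswap k l) (@ptswap l k) by case.
have pos (w : pt m n) : bpos w = m + n - (bpos (ptswap w)).+1.
  by case: w => a /=; have := ltn_ord a; lia.
have lt (u : pt n m) : bpos u < m + n by case: u => a /=; have := ltn_ord a; lia.
have [u|u|u v|d dP] := @diag_exists n m (fun u => ptswap (partner x (ptswap u))).
- by rewrite -(inj_eq (can_inj (sK n m))) sK partnerN.
- by rewrite !sK partnerK sK.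
(* Reflection reverses the boundary order, so a crossing u < v < u' < v' becomes one that starts at
   the partner of v. *)
- have := partner_planar x (partner x (ptswap v)) (partner x (ptswap u)).
  rewrite !partnerK !pos !sK.
  have := lt u; have := lt v.
  have := lt (ptswap (partner x (ptswap u))); have := lt (ptswap (partner x (ptswap v))).
  lia.
exists d => u v; rewrite /= dP /star_arcs.
by rewrite -(inj_eq (can_inj (sK n m))) sK.
Qed.

Definition dstar m n (x : diag m n) : diag n m := projT1 (cid (dstar_exists x)).

Lemma dstar_partner m n (x : diag m n) u :
  partner (dstar x) u = ptswap (partner x (ptswap u)).
Proof.
apply/eqP; have := projT2 (cid (dstar_exists x)) u (ptswap (partner x (ptswap u))).
by move=> /= ->; rewrite /star_arcs; case: (partner x _).
Qed.

Section Tensor.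

Variables m n m' n' : nat.

Definition unside (w : pt m n + pt m' n') : pt (m + m') (n + n') :=
  match w with
  | inl (inl a) => inl (lshift m' a)
  | inl (inr a) => inr (lshift n' a)
  | inr (inl a) => inl (rshift m a)
  | inr (inr a) => inr (rshift n a)
  end.

Lemma unsideK : cancel unside (@side m n m' n').
Proof.
by case=> [] [] a /=; rewrite ?(unsplitK (inl a)) ?(unsplitK (inr a)).
Qed.

Lemma sideK : cancel (@side m n m' n') unside.
Proof. by case=> a /=; case: split_ordP => b ->. Qed.

Lemma dtens_exists (x : diag m n) (y : diag m' n') :
  exists d, frel (partner d) =2 tens_arcs x y.
Proof.
pose f (w : pt m n + pt m' n') :=
  match w with inl w => inl (partner x w) | inr w => inr (partner y w) end.
have fl w : f (inl w) = inl (partner x w) by [].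
have fr w : f (inr w) = inr (partner y w) by [].
have fK : involutive f by case=> w /=; rewrite partnerK.
(* The points of y form an interval of the boundary, inserted between the bottom and the top of
   x. *)
have posl (w : pt m n) : bpos (unside (inl w)) =
    if bpos w < m then bpos w else bpos w + m' + n'.
  by case: w => a /=; have h := ltn_ord a; case: ifP; lia.
have posr (w : pt m' n') : bpos (unside (inr w)) = m + bpos w.
  by case: w => a /=; have := ltn_ord a; lia.
have lt k l (w : pt k l) : bpos w < k + l by case: w => a /=; have := ltn_ord a; lia.
have [u|u|u v|d dP] := @diag_exists _ _ (fun u => unside (f (side u))).
- rewrite -(inj_eq (can_inj sideK)) unsideK; case: (side u) => w; apply/eqP => /= -[/eqP].
    by rewrite (negPf (partnerN _ _)).
  by rewrite (negPf (partnerN _ _)).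
- by rewrite unsideK fK sideK.
- rewrite -[in bpos u](sideK u) -[in bpos v](sideK v).
  case: (side u) (side v) => [{}u|{}u] [{}v|{}v]; rewrite ?fl ?fr ?posl ?posr.
  + have := partner_planar x u v; do ! (case: ifP => ?); lia.
  + have := lt _ _ v; have := lt _ _ (partner y v); do ! (case: ifP => ?); lia.
  + have := lt _ _ u; have := lt _ _ (partner y u); do ! (case: ifP => ?); lia.
  + by have := partner_planar y u v; lia.
exists d => u v; rewrite /= dP -(inj_eq (can_inj sideK)) unsideK /tens_arcs.
by case: (side u) (side v) => [?|?] [?|?].
Qed.

Definition dtens x y := projT1 (cid (dtens_exists x y)).

Lemma dtens_arcs x y : frel (partner (dtens x y)) =2 tens_arcs x y.
Proof. exact: projT2 (cid (dtens_exists x y)). Qed.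

Lemma dtens_partnerl x y w :
  partner (dtens x y) (unside (inl w)) = unside (inl (partner x w)).
Proof.
apply/eqP; have := dtens_arcs x y (unside (inl w)) (unside (inl (partner x w))).
by rewrite /tens_arcs !unsideK eqxx.
Qed.

Lemma dtens_partnerr x y w :
  partner (dtens x y) (unside (inr w)) = unside (inr (partner y w)).
Proof.
apply/eqP; have := dtens_arcs x y (unside (inr w)) (unside (inr (partner y w))).
by rewrite /tens_arcs !unsideK eqxx.
Qed.

End Tensor.

Lemma chi_did n a b : chi (did n) a b = [forall i, a i == b i].
Proof.
apply/forallP/forallP => [h i|h u].
  by have := h (inr i); rewrite did_partner.
by rewrite did_partner; case: u => i /=; [rewrite eq_sym|]; apply: h.
Qed.

Lemma chi_dstar m n (x : diag m n) a b : chi (dstar x) b a = chi x a b.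
Proof.
apply/forallP/forallP => [h u|h u].
  have := h (ptswap u); rewrite dstar_partner.
  by case: u => u /=; case: (partner x _).
have := h (ptswap u); rewrite dstar_partner.
by case: u => u /=; case: (partner x _).
Qed.

Lemma chi_dtens m n m' n' (x : diag m n) (y : diag m' n') a b :
  chi (dtens x y) a b =
  chi x (fun i => a (lshift m' i)) (fun i => b (lshift n' i)) &&
  chi y (fun i => a (rshift m i)) (fun i => b (rshift n i)).
Proof.
have cl w : bdcolor a b (unside (inl w)) =
  bdcolor (fun i => a (lshift m' i)) (fun i => b (lshift n' i)) w by case: w.
have cr w : bdcolor a b (unside (inr w)) =
  bdcolor (fun i => a (rshift m i)) (fun i => b (rshift n i)) w by case: w.
apply/forallP/andP => [h|[/forallP hx /forallP hy] u].
  split; apply/forallP => w.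
    by have := h (unside (inl w)); rewrite dtens_partnerl !cl.
  by have := h (unside (inr w)); rewrite dtens_partnerr !cr.
rewrite -(sideK u); case: (side u) => w.
  by rewrite dtens_partnerl !cl.
by rewrite dtens_partnerr !cr.
Qed.

Lemma sum_coloring_add n n' (F : ('I_n -> bool) -> ('I_n' -> bool) -> nat) :
    (forall a a' b b', a =1 a' -> b =1 b' -> F a b = F a' b') ->
  \sum_(b : coloring (n + n')) F (fun i => b (lshift n' i)) (fun i => b (rshift n i))
  = \sum_(a : coloring n) \sum_(b : coloring n') F a b.
Proof.
move=> eF; rewrite pair_big /=.
pose f (p : coloring n * coloring n') : coloring (n + n') :=
  [ffun i => match fintype.split i with inl j => p.1 j | inr j => p.2 j end].
have fl p i : f p (lshift n' i) = p.1 i by rewrite ffunE (unsplitK (inl i)).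
have fr p i : f p (rshift n i) = p.2 i by rewrite ffunE (unsplitK (inr i)).
rewrite (reindex f); last first.
  exists (fun b : coloring (n + n') =>
    ([ffun i => b (lshift n' i)], [ffun i => b (rshift n i)])) => [[a b] _|b _].
    by congr (_, _); apply/ffunP => i; rewrite ffunE (fl, fr).
  apply/ffunP => i; rewrite ffunE; case: split_ordP => j ->; by rewrite ffunE.
by apply: eq_bigr => p _; apply: eF => i; rewrite (fl, fr).
Qed.

Lemma sum_coloring_eq n (a : 'I_n -> bool) (F : ('I_n -> bool) -> nat) :
    (forall a a', a =1 a' -> F a = F a') ->
  \sum_(b : coloring n) [forall i, a i == b i] * F b = F a.
Proof.
move=> eF; rewrite (bigD1 [ffun i => a i]) //= big1 ?addn0 => [|b bN].
  by rewrite (introT forallP) ?mul1n => [|i]; [apply: eF => i;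
    rewrite ffunE|rewrite ffunE].
case: forallP => // h; case/eqP: bN; apply/ffunP => i; rewrite ffunE.
by apply/esym/eqP.
Qed.

(** * The laws of the diagram category, with loops *)

Lemma dcomp_id_l m n (y : diag m n) : dcomp (did n) y = y /\ comp_loops (did n) y = 0.
Proof.
apply: dcomp_unique => a c; rewrite mul1n.
under eq_bigr => b _ do rewrite chi_did mulnC.
under eq_bigr => b _ do rewrite (eq_forallb (fun i => eq_sym _ _)).
by apply: (@sum_coloring_eq _ _ (fun b => chi y a b)) => b b' e;
  rewrite (eq_chi _ (frefl a) e).
Qed.

Lemma dcomp_id_r m n (x : diag m n) : dcomp x (did m) = x /\ comp_loops x (did m) = 0.
Proof.
apply: dcomp_unique => a c; rewrite mul1n.
under eq_bigr => b _ do rewrite chi_did.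
by apply: (@sum_coloring_eq _ _ (fun b => chi x b c)) => b b' e;
  rewrite (eq_chi _ e (frefl c)).
Qed.

Lemma dcompA m n p q (x : diag p q) (y : diag n p) (z : diag m n) :
  dcomp x (dcomp y z) = dcomp (dcomp x y) z /\
  comp_loops y z + comp_loops x (dcomp y z) = comp_loops x y + comp_loops (dcomp x y) z.
Proof.
pose ones k : coloring k := [ffun=> true].
(* Both bracketings count the colorings of the three stacked diagrams with outer colors a and c. *)
have key (a : coloring m) (c : coloring q) :
  2 ^ (comp_loops y z + comp_loops x (dcomp y z)) * chi (dcomp x (dcomp y z)) a c =
  2 ^ (comp_loops x y + comp_loops (dcomp x y) z) * chi (dcomp (dcomp x y) z) a c.
  rewrite !expnD -!mulnA -!chi_comp !big_distrr /=.
  under eq_bigr => b _ do rewrite mulnA -chi_comp big_distrl /=.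
  under [RHS]eq_bigr => b _ do rewrite mulnCA -chi_comp big_distrr /=.
  by rewrite exchange_big; apply: eq_bigr => b _; apply: eq_bigr => b' _; rewrite mulnA.
have ll : comp_loops y z + comp_loops x (dcomp y z) = comp_loops x y + comp_loops (dcomp
  x y) z.
  have ct1 k l (d : diag k l) : chi d (ones k) (ones l).
    by rewrite (@eq_chi _ _ _ _ (fun _ => true) _ (fun _ => true)) ?chi_true // => i;
      rewrite ffunE.
  have := key (ones m) (ones q); rewrite !ct1 !muln1 => /eqP.
  by rewrite eqn_exp2l // => /eqP.
split=> //; apply: chi_inj => a c; have := key a c; rewrite ll => /eqP.
rewrite eqn_pmul2l ?expn_gt0 //.
by case: (chi _ _ _) (chi _ _ _) => [] [].
Qed.

Lemma dcomp_dstar m n p (x : diag n p) (y : diag m n) :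
  dcomp (dstar y) (dstar x) = dstar (dcomp x y) /\
  comp_loops (dstar y) (dstar x) = comp_loops x y.
Proof.
apply: dcomp_unique => a c; rewrite chi_dstar -chi_comp.
by apply: eq_bigr => b _; rewrite !chi_dstar mulnC.
Qed.

Lemma dcomp_dtens m n p m' n' p' (x : diag n p) (y : diag m n)
    (x' : diag n' p') (y' : diag m' n') :
  dcomp (dtens x x') (dtens y y') = dtens (dcomp x y) (dcomp x' y') /\
  comp_loops (dtens x x') (dtens y y') = comp_loops x y + comp_loops x' y'.
Proof.
apply: dcomp_unique => a c; rewrite chi_dtens -mulnb expnD mulnACA -!chi_comp.
under eq_bigr => b _ do rewrite !chi_dtens -!mulnb mulnACA.
rewrite (@sum_coloring_add _ _ (fun b b' =>
  chi y (fun i => a (lshift m' i)) b * chi x b (fun i => c (lshift p' i)) *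
  (chi y' (fun i => a (rshift m i)) b' * chi x' b' (fun i => c (rshift p i))))).
  by rewrite big_distrlr.
move=> b b' d d' e e'.
by rewrite (eq_chi y (frefl _) e) (eq_chi x e (frefl _)) (eq_chi y' (frefl _) e')
  (eq_chi x' e' (frefl _)).
Qed.

Lemma dtens_did m n : dtens (did m) (did n) = did (m + n).
Proof.
apply: chi_inj => a b; rewrite chi_dtens !chi_did.
apply/andP/forallP => [[/forallP h /forallP h'] i|h].
  by case: (split_ordP i) => j ->; rewrite ?h ?h'.
by split; apply/forallP => i; apply: h.
Qed.

Lemma dstar_dtens m n m' n' (x : diag m n) (y : diag m' n') :
  dstar (dtens x y) = dtens (dstar x) (dstar y).
Proof. by apply: chi_inj => a b; rewrite chi_dstar !chi_dtens !chi_dstar. Qed.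

Lemma dstarK m n (x : diag m n) : dstar (dstar x) = x.
Proof. by apply: chi_inj => a b; rewrite !chi_dstar. Qed.

Lemma dstar_did n : dstar (did n) = did n.
Proof.
by apply: chi_inj => a b; rewrite chi_dstar !chi_did; apply: eq_forallb => i;
  rewrite eq_sym.
Qed.

(** * Linear extension of the operations *)

Local Open Scope ring_scope.

Definition bv m n (d : diag m n) : TL m n := diagvec (frel (partner d)).

Lemma coef_bv m n (d d' : diag m n) : coef (bv d) d' = (d' == d)%:R.
Proof. exact: diagvecE. Qed.

Lemma coef_lin m n a (X Y : TL m n) d : coef (a *: X + Y) d = a * coef X d + coef Y d.
Proof. by rewrite /coef !ffunE. Qed.

Lemma coef_zero m n (d : diag m n) : coef (0 : TL m n) d = 0.
Proof. by rewrite /coef ffunE. Qed.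

Lemma coef_scale m n a (X : TL m n) d : coef (a *: X) d = a * coef X d.
Proof. by rewrite /coef !ffunE. Qed.

Lemma coef_bigsum m n (I : Type) (r : seq I) (P : pred I) (F : I -> TL m n) d :
  coef (\sum_(i <- r | P i) F i) d = \sum_(i <- r | P i) coef (F i) d.
Proof.
apply: (big_morph (fun X : TL m n => coef X d)); last exact: coef_zero.
by move=> X Y; rewrite -{1}[X]scale1r coef_lin mul1r.
Qed.

Lemma TL_eq m n (X Y : TL m n) : coef X =1 coef Y -> X = Y.
Proof. by move=> e; apply/ffunP => d; exact: e. Qed.

Lemma TL_expand m n (X : TL m n) : X = \sum_d coef X d *: bv d.
Proof.
apply: TL_eq => d; rewrite coef_bigsum (bigD1 d) //= big1 ?addr0 => [|d' nd].
  by rewrite coef_scale coef_bv eqxx mulr1.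
by rewrite coef_scale coef_bv eq_sym (negPf nd) mulr0.
Qed.

Section SpanInduction.

Variables (R : pzRingType) (V : lmodType R).

(** A submodule given as a predicate: statements that are linear in a vector are then checked on a
    spanning set only. *)
Definition linear_closed_pred (P : V -> Prop) : Prop :=
  P 0 /\ forall a x y, P x -> P y -> P (a *: x + y).

Lemma closed_pred_sum P (I : Type) (r : seq I) (Q : pred I) (c : I -> R) (F : I -> V) :
  linear_closed_pred P -> (forall i, Q i -> c i <> 0 -> P (F i)) ->
  P (\sum_(i <- r | Q i) c i *: F i).
Proof.
case=> P0 PD PF; elim: r => [|i r IH]; first by rewrite big_nil.
rewrite big_cons; case: ifP => // Qi; have [->|/eqP ci] := eqVneq (c i) 0.
  by rewrite scale0r add0r.
by apply: PD => //; apply: PF.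
Qed.

End SpanInduction.

Lemma TL_ind m n (P : TL m n -> Prop) :
  linear_closed_pred P -> (forall d, P (bv d)) -> forall X, P X.
Proof. by move=> PL Pb X; rewrite (TL_expand X); apply: closed_pred_sum. Qed.

Section Linearity.

Variables (V W : lmodType QA).

Lemma lin0 (f : V -> W) : (forall a x y, f (a *: x + y) = a *: f x + f y) -> f 0 = 0.
Proof.
move=> fl; have := fl (-1) 0 0; rewrite scaler0 add0r => h.
by rewrite h scaleN1r addNr.
Qed.

End Linearity.

Lemma linear_pred_eq (V W : lmodType QA) (f g : V -> W) :
    (forall a x y, f (a *: x + y) = a *: f x + f y) ->
    (forall a x y, g (a *: x + y) = a *: g x + g y) ->
  linear_closed_pred (fun x => f x = g x).
Proof.
by move=> fl gl; split=> [|a x y ex ey]; rewrite ?(lin0 fl) ?(lin0 gl) // fl gl ex ey.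
Qed.

Section Operations.

Variables m n p : nat.
Implicit Types (X : TL n p) (Y : TL m n).

Lemma tlcomp_linl a X X' Y :
  tlcomp (a *: X + X') Y = a *: tlcomp X Y + tlcomp X' Y.
Proof.
rewrite /tlcomp scaler_sumr -big_split; apply: eq_bigr => x _ /=.
rewrite scaler_sumr -big_split; apply: eq_bigr => y _ /=.
by rewrite coef_lin scalerA -scalerDl !mulrDl !mulrA.
Qed.

Lemma tlcomp_linr a X Y Y' :
  tlcomp X (a *: Y + Y') = a *: tlcomp X Y + tlcomp X Y'.
Proof.
rewrite /tlcomp scaler_sumr -big_split; apply: eq_bigr => x _ /=.
rewrite scaler_sumr -big_split; apply: eq_bigr => y _ /=.
by rewrite coef_lin scalerA -scalerDl mulrDr mulrDl !mulrA [coef X x * a]mulrC.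
Qed.

Lemma tlcomp0l Y : tlcomp (0 : TL n p) Y = 0.
Proof. exact: (@lin0 (TL n p) (TL m p) _ (fun a X X' => tlcomp_linl a X X' Y)). Qed.

Lemma tlcomp0r X : tlcomp X (0 : TL m n) = 0.
Proof. exact: (@lin0 (TL m n) (TL m p) _ (fun a Y Y' => tlcomp_linr a X Y Y')). Qed.

Lemma tlcompZl a X Y : tlcomp (a *: X) Y = a *: tlcomp X Y.
Proof. by rewrite -[a *: X]addr0 tlcomp_linl tlcomp0l addr0. Qed.

Lemma tlcompZr a X Y : tlcomp X (a *: Y) = a *: tlcomp X Y.
Proof. by rewrite -[a *: Y]addr0 tlcomp_linr tlcomp0r addr0. Qed.

Lemma tlcompDl X X' Y : tlcomp (X + X') Y = tlcomp X Y + tlcomp X' Y.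
Proof. by rewrite -{1}[X]scale1r tlcomp_linl scale1r. Qed.

Lemma tlcompDr X Y Y' : tlcomp X (Y + Y') = tlcomp X Y + tlcomp X Y'.
Proof. by rewrite -{1}[Y]scale1r tlcomp_linr scale1r. Qed.

Lemma tlcomp_suml (I : Type) (r : seq I) (P : pred I) (F : I -> TL n p) Y :
  tlcomp (\sum_(i <- r | P i) F i) Y = \sum_(i <- r | P i) tlcomp (F i) Y.
Proof.
by apply: (big_morph (fun X => tlcomp X Y)); [move=> X X';
  exact: tlcompDl|exact: tlcomp0l].
Qed.

Lemma tlcomp_sumr (I : Type) (r : seq I) (P : pred I) (F : I -> TL m n) X :
  tlcomp X (\sum_(i <- r | P i) F i) = \sum_(i <- r | P i) tlcomp X (F i).
Proof.
by apply: (big_morph (tlcomp X)); [move=> Y Y'; exact: tlcompDr|exact: tlcomp0r].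
Qed.

Lemma tlcomp_bv (x : diag n p) (y : diag m n) :
  tlcomp (bv x) (bv y) = delta ^+ comp_loops x y *: bv (dcomp x y).
Proof.
rewrite /tlcomp (bigD1 x) //= [X in _ + X]big1 ?addr0 => [|x' nx]; last first.
  by rewrite big1 // => y' _; rewrite coef_bv (negPf nx) !mul0r scale0r.
rewrite (bigD1 y) //= [X in _ + X]big1 ?addr0 => [|y' ny]; last first.
  by rewrite !coef_bv (negPf ny) mulr0 mul0r scale0r.
by rewrite !coef_bv !eqxx !mul1r; congr (_ *: _); apply: diagvec_ext; exact: dcompP.
Qed.

End Operations.

Section TensorOperation.

Variables m n m' n' : nat.
Implicit Types (X : TL m n) (Y : TL m' n').

Lemma tltens_linl a X X' Y :
  tltens (a *: X + X') Y = a *: tltens X Y + tltens X' Y.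
Proof.
rewrite /tltens scaler_sumr -big_split; apply: eq_bigr => x _ /=.
rewrite scaler_sumr -big_split; apply: eq_bigr => y _ /=.
by rewrite coef_lin scalerA -scalerDl !mulrDl !mulrA.
Qed.

Lemma tltens_linr a X Y Y' :
  tltens X (a *: Y + Y') = a *: tltens X Y + tltens X Y'.
Proof.
rewrite /tltens scaler_sumr -big_split; apply: eq_bigr => x _ /=.
rewrite scaler_sumr -big_split; apply: eq_bigr => y _ /=.
by rewrite coef_lin scalerA -scalerDl mulrDr !mulrA [coef X x * a]mulrC.
Qed.

Lemma tltens0l Y : tltens (0 : TL m n) Y = 0.
Proof. exact: (@lin0 (TL m n) (TL (m + m') (n + n')) _ (fun a X X' => tltens_linl a X X'
  Y)). Qed.

Lemma tltens0r X : tltens X (0 : TL m' n') = 0.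
Proof. exact: (@lin0 (TL m' n') (TL (m + m') (n + n')) _ (fun a Y Y' => tltens_linr a X
  Y Y')). Qed.

Lemma tltensZl a X Y : tltens (a *: X) Y = a *: tltens X Y.
Proof. by rewrite -[a *: X]addr0 tltens_linl tltens0l addr0. Qed.

Lemma tltens_bv (x : diag m n) (y : diag m' n') :
  tltens (bv x) (bv y) = bv (dtens x y).
Proof.
rewrite /tltens (bigD1 x) //= [X in _ + X]big1 ?addr0 => [|x' nx]; last first.
  by rewrite big1 // => y' _; rewrite coef_bv (negPf nx) !mul0r scale0r.
rewrite (bigD1 y) //= [X in _ + X]big1 ?addr0 => [|y' ny]; last first.
  by rewrite !coef_bv (negPf ny) mulr0 scale0r.
rewrite !coef_bv !eqxx !mul1r scale1r; apply: diagvec_ext => u v.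
by rewrite -dtens_arcs.
Qed.

Lemma tlstar_lin a X X' : tlstar (a *: X + X') = a *: tlstar X + tlstar X'.
Proof.
rewrite /tlstar scaler_sumr -big_split; apply: eq_bigr => x _ /=.
by rewrite coef_lin scalerA -scalerDl.
Qed.

Lemma tlstar0 : tlstar (0 : TL m n) = 0.
Proof. exact: (@lin0 (TL m n) (TL n m) _ tlstar_lin). Qed.

Lemma tlstar_bv (x : diag m n) : tlstar (bv x) = bv (dstar x).
Proof.
rewrite /tlstar (bigD1 x) //= [X in _ + X]big1 ?addr0 => [|x' nx]; last first.
  by rewrite coef_bv (negPf nx) scale0r.
rewrite coef_bv eqxx scale1r; apply: diagvec_ext => u v.
by rewrite -(projT2 (cid (dstar_exists x))).
Qed.

End TensorOperation.

Lemma tlidE n : tlid n = bv (did n).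
Proof.
by apply: diagvec_ext => u v; rewrite /= did_partner; case: u v => u [] v;
  rewrite //= eq_sym.
Qed.

Lemma tlcomp_id_l m n (X : TL m n) : tlcomp (tlid n) X = X.
Proof.
move: X; apply: TL_ind => [|d]; first by apply: linear_pred_eq => // *;
  rewrite tlcomp_linr.
by rewrite tlidE tlcomp_bv; have [-> ->] := dcomp_id_l d; rewrite expr0 scale1r.
Qed.

Lemma tlcomp_id_r m n (X : TL m n) : tlcomp X (tlid m) = X.
Proof.
move: X; apply: TL_ind => [|d]; first by apply: linear_pred_eq => // *;
  rewrite tlcomp_linl.
by rewrite tlidE tlcomp_bv; have [-> ->] := dcomp_id_r d; rewrite expr0 scale1r.
Qed.

Lemma tlcompA m n p q (X : TL p q) (Y : TL n p) (Z : TL m n) :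
  tlcomp X (tlcomp Y Z) = tlcomp (tlcomp X Y) Z.
Proof.
move: X; apply: TL_ind => [|x]; first by apply: linear_pred_eq => *; rewrite !tlcomp_linl.
move: Y; apply: TL_ind => [|y].
  by apply: linear_pred_eq => *; rewrite !(tlcomp_linl, tlcomp_linr).
move: Z; apply: TL_ind => [|z]; first by apply: linear_pred_eq => *; rewrite !tlcomp_linr.
rewrite !tlcomp_bv tlcompZl tlcompZr !tlcomp_bv !scalerA -!exprD.
by have [-> ->] := dcompA x y z.
Qed.

Lemma tlstar_comp m n p (X : TL n p) (Y : TL m n) :
  tlstar (tlcomp X Y) = tlcomp (tlstar Y) (tlstar X).
Proof.
move: X; apply: TL_ind => [|x].
  by apply: linear_pred_eq => *; rewrite ?tlcomp_linl tlstar_lin ?tlcomp_linr.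
move: Y; apply: TL_ind => [|y].
  by apply: linear_pred_eq => *; rewrite ?tlcomp_linr tlstar_lin ?tlcomp_linl.
rewrite tlcomp_bv -[_ *: _]addr0 tlstar_lin tlstar0 addr0 !tlstar_bv tlcomp_bv.
by have [-> ->] := dcomp_dstar x y.
Qed.

Lemma tlstarK m n (X : TL m n) : tlstar (tlstar X) = X.
Proof.
move: X; apply: TL_ind => [|x]; first by apply: linear_pred_eq => // *;
  rewrite !tlstar_lin.
by rewrite !tlstar_bv dstarK.
Qed.

Lemma tlstar_tens m n m' n' (X : TL m n) (Y : TL m' n') :
  tlstar (tltens X Y) = tltens (tlstar X) (tlstar Y).
Proof.
move: X; apply: TL_ind => [|x].
  by apply: linear_pred_eq => *; rewrite ?tltens_linl tlstar_lin ?tltens_linl.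
move: Y; apply: TL_ind => [|y].
  by apply: linear_pred_eq => *; rewrite ?tltens_linr tlstar_lin ?tltens_linr.
by rewrite tltens_bv !tlstar_bv tltens_bv dstar_dtens.
Qed.

Lemma tlstar_id n : tlstar (tlid n) = tlid n.
Proof. by rewrite tlidE tlstar_bv dstar_did. Qed.

Lemma tlcomp_tens m n p m' n' p' (X : TL n p) (Y : TL m n) (X' : TL n' p') (Y' : TL m'
  n') :
  tlcomp (tltens X X') (tltens Y Y') = tltens (tlcomp X Y) (tlcomp X' Y').
Proof.
move: X; apply: TL_ind => [|x].
  by apply: linear_pred_eq => *; rewrite !(tlcomp_linl, tltens_linl).
move: X'; apply: TL_ind => [|x'].
  by apply: linear_pred_eq => *; rewrite ?(tltens_linr, tlcomp_linl, tltens_linr).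
move: Y; apply: TL_ind => [|y].
  by apply: linear_pred_eq => *; rewrite !(tlcomp_linr, tltens_linl).
move: Y'; apply: TL_ind => [|y'].
  by apply: linear_pred_eq => *; rewrite !(tltens_linr, tlcomp_linr).
rewrite !tltens_bv !tlcomp_bv tltensZl.
have tZr (a : QA) (U : TL m p) (V : TL m' p') : tltens U (a *: V) = a *: tltens U V.
  by rewrite -[a *: V]addr0 tltens_linr tltens0r addr0.
rewrite tZr scalerA -exprD tltens_bv.
by have [-> ->] := dcomp_dtens x y x' y'.
Qed.

(** Well typed because [0 + n] converts to [n]; it identifies [jwpow i 1] with f_i. *)
Lemma tltens_0id n (X : TL n n) : tltens (tlid 0) X = X :> TL n n.
Proof.
move: X; apply: TL_ind => [|x].
  by apply: linear_pred_eq => // *; rewrite tltens_linr.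
rewrite tlidE tltens_bv; congr bv; apply: chi_inj => a b.
apply: etrans (chi_dtens (did 0) x a b) _.
rewrite chi_did (introT forallP) => [/=|[]//].
by apply: eq_chi => i; congr (_ _); apply: val_inj.
Qed.

Lemma tltr_lin n a (X Y : TL n n) : tltr (a *: X + Y) = a * tltr X + tltr Y.
Proof.
rewrite /tltr mulr_sumr -big_split; apply: eq_bigr => x _ /=.
by rewrite coef_lin mulrDl mulrA.
Qed.

Lemma tltrZ n a (X : TL n n) : tltr (a *: X) = a * tltr X.
Proof. by rewrite /tltr mulr_sumr; apply: eq_bigr => x _; rewrite coef_scale mulrA. Qed.

Lemma tltr0 n : tltr (0 : TL n n) = 0.
Proof. by rewrite /tltr big1 // => x _; rewrite coef_zero mul0r. Qed.

Lemma tltr_bv n (x : diag n n) : tltr (bv x) = delta ^+ closure_loops x.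
Proof.
rewrite /tltr (bigD1 x) //= [X in _ + X]big1 ?addr0 => [|x' nx]; last first.
  by rewrite coef_bv (negPf nx) mul0r.
by rewrite coef_bv eqxx mul1r.
Qed.

Lemma tltr_sum n (I : Type) (r : seq I) (P : pred I) (F : I -> TL n n) :
  tltr (\sum_(i <- r | P i) F i) = \sum_(i <- r | P i) tltr (F i).
Proof.
apply: (big_morph (@tltr n)); last exact: tltr0.
by move=> X Y; rewrite -{1}[X]scale1r tltr_lin mul1r.
Qed.

(** * The trace form and the Jones-Wenzl idempotents *)

Section Fractions.

Variable R : idomainType.

Lemma fraction_clear (x : {fraction R}) :
  exists a b, b != 0 /\ x * tofrac b = tofrac a.
Proof.
elim/quotW: x => r; exists (frac r).1, (frac r).2.
split; first exact: denom_ratioP.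
unlock tofrac; rewrite -[LHS]FracField.pi_mul; apply/eqmodP.
rewrite /= FracField.equivfE /FracField.mulf.
rewrite !numden_Ratio ?(oner_neq0, mul1r, mulr1, denom_ratioP) //.
by rewrite mulrC.
Qed.

Lemma fraction_clear_all (I : finType) (c : I -> {fraction R}) :
  exists (b : R) (a : I -> R), b != 0 /\ forall i, c i * tofrac b = tofrac (a i).
Proof.
have h i : exists ab : R * R, ab.2 != 0 /\ c i * tofrac ab.2 = tofrac ab.1.
  by have [a [b ?]] := fraction_clear (c i); exists (a, b).
have [ab abP] := fin_all_exists h.
exists (\prod_i (ab i).2), (fun i => (ab i).1 * \prod_(j | j != i) (ab j).2).
split=> [|i]; first by apply/prodf_neq0 => i _; case: (abP i).
by rewrite (bigD1 i) //= !tofracM mulrA; case: (abP i) => _ ->.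
Qed.

End Fractions.

Lemma poly_sum_neq0 (R : idomainType) (I : finType) (p : I -> {poly R}) i0 :
  (forall j, j != i0 -> (size (p j) < size (p i0))%N) -> p i0 != 0 -> \sum_j p j != 0.
Proof.
move=> lt p0; rewrite (bigD1 i0) //= -size_poly_eq0 size_polyDl ?size_poly_eq0 //.
apply: leq_ltn_trans (size_sum _ _ _) _.
elim/big_ind: _ => [|a b ha hb|j /lt //]; first by rewrite size_poly_gt0.
by rewrite gtn_max ha hb.
Qed.

(* A matrix of powers of delta whose exponents are largest on the diagonal is
   dominated by it, the degree of delta in A being positive. *)
Lemma delta_dominant (I : finType) (N : I -> I -> nat) (c : I -> QA) :
    (forall i j, j != i -> (N i j < N i i)%N) ->
    (forall i, c i <> 0 -> \sum_j delta ^+ N i j * c j = 0) ->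
  forall i, c i = 0.
Proof.
move=> Nlt ker; have [b [a [b0 ab]]] := fraction_clear_all c.
have c0 i : (c i == 0) = (a i == 0).
  by rewrite -tofrac_eq0 -ab mulf_eq0 [tofrac b == 0]tofrac_eq0 (negPf b0) orbF.
pose M := (\max_i N i i)%N.
have NM i j : (N i j <= M)%N.
  apply: (@leq_trans (N i i)); last exact: leq_bigmax.
  by case: (eqVneq j i) => [->|/Nlt/ltnW].
(* As delta = - (A^4 + 1) / A^2, the factor A ^ (2M) turns each entry delta ^ k with k <= M into a
   polynomial, of degree 2M + 2k. *)
pose q (k : nat) : {poly rat} := (- ('X^4 + 1)) ^+ k * 'X^(2 * (M - k)).
have X0 : A != 0 by rewrite tofrac_eq0 polyX_eq0.
have qE k : (k <= M)%N -> tofrac (q k) = delta ^+ k * A ^+ (2 * M).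
  move=> kM; rewrite /q tofracM !tofracXn.
  rewrite (_ : tofrac (- ('X^4 + 1)) = delta * A ^+ 2); last first.
    rewrite tofracN tofracD tofracXn tofrac1 /delta mulrBl mulVf ?expf_neq0 //.
    by rewrite opprD mulNr -exprD.
  rewrite exprMn -mulrA -exprM -exprD; congr (_ * _ ^+ _); lia.
have szb : size (- ('X^4 + 1) : {poly rat}) = 5%N by rewrite size_polyN -[1]/1%:P
  size_XnaddC.
have b4 : - ('X^4 + 1) != 0 :> {poly rat} by rewrite -size_poly_eq0 szb.
have q0 k : q k != 0 by rewrite mulf_neq0 // expf_neq0 // polyX_eq0.
have aux (s m k : nat) : (0 < s -> s.-1 = 4 * k -> k <= m ->
    (s + (2 * (m - k)).+1).-1 = (2 * m + 2 * k).+1)%N by lia.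
have szq k : (k <= M)%N -> size (q k) = (2 * M + 2 * k).+1%N.
  move=> kM; rewrite size_mul ?expf_neq0 ?polyX_eq0 // size_polyXn.
  have := size_exp (- ('X^4 + 1) : {poly rat}) k; rewrite szb /=.
  have : (0 < size ((- ('X^4 + 1) : {poly rat}) ^+ k))%N by rewrite size_poly_gt0
    expf_neq0.
  by move=> h1 h2; apply: aux.
have kerp i : a i != 0 -> \sum_j q (N i j) * a j = 0.
  move=> ai; apply/eqP; rewrite -tofrac_eq0 rmorph_sum /=.
  under eq_bigr => j _ do rewrite tofracM qE // -ab mulrACA.
  by rewrite -mulr_suml ker ?mul0r //; apply/eqP; rewrite c0.
case: (pickP (fun i => a i != 0)) => [i1 ai1|az]; last first.
  by move=> i; apply/eqP; rewrite c0; move: (az i) => /negbFE.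
(* In the row of a coefficient of largest degree, the diagonal term has larger degree than every
   other term. That coefficient is nonzero, so the equation of this row is among those assumed. *)
case: (arg_maxnP (P := fun i => a i != 0) (fun i => size (a i)) ai1) => i ai imax.
have := kerp i ai; move/eqP; rewrite (negPf (poly_sum_neq0 (i0 := i) _ _)) //; last first.
  by rewrite mulf_neq0.
move=> j ji; have [->|aj] := eqVneq (a j) 0.
  by rewrite mulr0 size_poly0 size_poly_gt0 mulf_neq0.
rewrite (size_mul (q0 (N i j)) aj) (size_mul (q0 (N i i)) ai).
rewrite !szq; [|exact: NM|exact: NM]; have := imax j aj; have := Nlt i j ji.
have : (0 < size (a j))%N by rewrite size_poly_gt0.
lia.
Qed.

Local Open Scope nat_scope.

Lemma chi_closure n (x : diag n n) :
  \sum_(a : coloring n) chi x a a = 2 ^ closure_loops x.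
Proof.
pose e : rel (pt n n) := fun u v => (partner x u == v) || id_arcs u v.
have csym : connect_sym e.
  apply: sym_connect_sym => u v; rewrite /e (can2_eq (partnerK x) (partnerK x)) eq_sym.
  by congr (_ || _); case: u v => u [] v //=; rewrite eq_sym.
(* A closed diagram has no outer points: the family of prescribed colors is empty. *)
pose o (i : 'I_0) : pt n n := inl (widen_ord (leq0n n) i).
have := card_extensions o (fun _ => true) csym; set E := (X in #|X| = _).
rewrite (introT forallP) ?mul1n => [|[]//].
rewrite (@eq_n_comp_r _ e _ predT) => [cE|u]; last by rewrite !inE;
  apply/existsP => -[[]].
rewrite -[RHS]cE.
pose F (a : coloring n) : {ffun pt n n -> bool} := [ffun u => bdcolor a a u].
have Finj : injective F.
  by move=> a b /ffunP ab; apply/ffunP => i; have := ab (inl i); rewrite !ffunE.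
transitivity #|[pred a : coloring n | chi x a a]|.
  by rewrite -sum1_card [RHS]big_mkcond; apply: eq_bigr => a _; rewrite inE; case: chi.
rewrite -(card_imset _ Finj); apply: eq_card => g; apply/imsetP/idP.
  case=> a /forallP xa ->; rewrite inE; apply/andP; split; last by apply/forallP => -[].
  apply/forallP => u; apply/forallP => v; apply/implyP; rewrite !ffunE.
  case/orP => [/eqP <-|]; first by rewrite eq_sym; apply: xa.
  by case: u v => u [] v //= /eqP ->.
rewrite inE => /andP[/forallP ge _].
have {}ge u v : e u v -> g u = g v.
  by move=> uv; apply/eqP; move/forallP: (ge u) => /(_ v)/implyP/(_ uv).
have gF : g = F [ffun i => g (inl i)].
  apply/ffunP => -[i|i]; rewrite !ffunE //= ffunE //.
  by apply: ge; rewrite /e /= eqxx orbT.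
exists [ffun i => g (inl i)] => //; apply/forallP => u; apply/eqP.
have FE w : bdcolor [ffun i => g (inl i)] [ffun i => g (inl i)] w = g w by rewrite [in
  RHS]gF ffunE.
by rewrite !FE; apply/esym/ge; rewrite /e eqxx.
Qed.

(** The exponent of delta in the trace of xy. *)
Definition pair_loops n (x y : diag n n) : nat := comp_loops x y + closure_loops (dcomp
  x y).

Lemma chi_pair_loops n (x y : diag n n) :
  2 ^ pair_loops x y = \sum_(a : coloring n) \sum_(b : coloring n) chi y a b * chi x b a.
Proof.
rewrite expnD -chi_closure big_distrr; apply: eq_bigr => a _ /=.
by rewrite -chi_comp.
Qed.

Lemma pair_loopsC n (x y : diag n n) : pair_loops x y = pair_loops y x.
Proof.
apply: (@expnI 2 isT).
apply: etrans (chi_pair_loops x y) (etrans _ (esym (chi_pair_loops y x))).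
rewrite exchange_big; apply: eq_bigr => a _; apply: eq_bigr => b _.
by rewrite mulnC.
Qed.

(** 2 to the number of loops counts the colorings compatible with both x and y, which for y = x are
    all those compatible with x. If y <> x, the coloring that marks a single arc of x absent from y
    makes the comparison strict. *)
Lemma pair_loops_max n (x y : diag n n) :
  y != x -> pair_loops (dstar x) y < pair_loops (dstar x) x.
Proof.
move=> yx.
have pE z : 2 ^ pair_loops (dstar x) z =
    \sum_(p : coloring n * coloring n) chi z p.1 p.2 * chi x p.1 p.2.
  by rewrite chi_pair_loops pair_big; apply: eq_bigr => p _; rewrite chi_dstar.
have aux a b p q : 2 ^ p = a -> 2 ^ q = b -> a < b -> p < q.
  by move=> <- <-; rewrite ltn_exp2l.
apply: aux (pE y) (pE x) _.
have le (p : coloring n * coloring n) : chi y p.1 p.2 * chi x p.1 p.2 <= chi x p.1 p.2 *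
  chi x p.1 p.2.
  by case: (chi y _ _) (chi x _ _) => [] [].
case: (pickP (fun p : coloring n * coloring n => chi x p.1 p.2 && ~~ chi y p.1 p.2)) =>
  [p|no].
  case/andP=> px py; rewrite (bigD1 p) // [X in _ < X](bigD1 p) //= px (negPf py) mul0n.
  by rewrite add0n add1n ltnS; apply: leq_sum.
case/eqP: yx; apply: diag_ext => u.
pose f w := (w == u) || (w == partner x u).
pose a : coloring n := [ffun i => f (inl i)];
  pose b : coloring n := [ffun i => f (inr i)].
have fE w : bdcolor a b w = f w by case: w => i /=; rewrite ffunE.
have cx : chi x a b.
  apply/forallP => w; rewrite !fE /f (inj_eq (inv_inj (partnerK x))).
  by rewrite (can2_eq (partnerK x) (partnerK x)) orbC.
have := no (a, b); rewrite /= cx /= => /negbFE /forallP/(_ u).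
by rewrite !fE /f eqxx (negPf (partnerN y u)) /= => /eqP; move/eqP.
Qed.

Local Open Scope ring_scope.

Lemma tltr_comp_bv n (x y : diag n n) : tltr (tlcomp (bv x) (bv y)) = delta ^+
  pair_loops x y.
Proof. by rewrite tlcomp_bv tltrZ tltr_bv -exprD. Qed.

Lemma tltrC n (X Y : TL n n) : tltr (tlcomp X Y) = tltr (tlcomp Y X).
Proof.
have tl a (U V : TL n n) : tltr (a *: U + V) = a *: (tltr U : QA^o) + tltr V by apply:
  tltr_lin.
move: X; apply: TL_ind => [|x].
  by apply: (@linear_pred_eq _ QA^o) => *; rewrite ?(tlcomp_linl, tlcomp_linr) tl.
move: Y; apply: TL_ind => [|y].
  by apply: (@linear_pred_eq _ QA^o) => *; rewrite ?(tlcomp_linl, tlcomp_linr) tl.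
apply: etrans (tltr_comp_bv x y) (etrans _ (esym (tltr_comp_bv y x))).
exact: (congr1 (fun e => delta ^+ e) (pair_loopsC x y)).
Qed.

Lemma tltr_compE n (X : TL n n) x :
  tltr (tlcomp (bv (dstar x)) X) = \sum_y delta ^+ pair_loops (dstar x) y * coef X y.
Proof.
rewrite {1}(TL_expand X) tlcomp_sumr tltr_sum; apply: eq_bigr => y _.
by rewrite tlcompZr tltrZ tltr_comp_bv mulrC.
Qed.

(** The trace form is tested only against diagrams in the support of X. [jw_exists] relies on this
    to see that the vector dual to the identity has the identity in its support. *)
Lemma trace_nondegenerate n (X : TL n n) :
  (forall x, coef X x <> 0 -> tltr (tlcomp (bv (dstar x)) X) = 0) -> X = 0.
Proof.
move=> h; apply: TL_eq => x; rewrite coef_zero.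
apply: (@delta_dominant _ (fun x y => pair_loops (dstar x) y) (coef X)) => [i j|i ci].
  exact: pair_loops_max.
by rewrite -tltr_compE h.
Qed.

Lemma trace_dual n (b : diag n n -> QA) :
  exists X : TL n n, forall x, tltr (tlcomp (bv (dstar x)) X) = b x.
Proof.
pose I : finType := diag n n.
pose M : 'M[QA]_#|I| := \matrix_(i, j) delta ^+ pair_loops (dstar (enum_val j))
  (enum_val i).
have Mu : M \in unitmx.
  rewrite -row_free_unit; apply: inj_row_free => v vM.
  pose X : TL n n := [ffun x => v 0 (enum_rank x) : QA^o].
  have X0 : X = 0.
    apply: trace_nondegenerate => x _; rewrite tltr_compE.
    have /rowP/(_ (enum_rank x)) := vM; rewrite !mxE => e; rewrite -[RHS]e.
    rewrite (reindex (enum_val : 'I_#|I| -> I)) /=; last exact/onW_bij/enum_val_bij.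
    apply: eq_bigr => i _; rewrite !mxE enum_rankK mulrC; congr (_ * _).
    by rewrite /coef ffunE enum_valK.
  apply/rowP => i; rewrite mxE -[i]enum_valK.
  by have := congr1 (fun X => coef X (enum_val i)) X0; rewrite coef_zero /coef ffunE.
pose w : 'rV[QA]_#|I| := \row_i b (enum_val i).
have [v vM] : exists v, v *m M = w by exists (w *m invmx M); rewrite mulmxKV.
exists [ffun x => v 0 (enum_rank x) : QA^o] => x; rewrite tltr_compE.
have /rowP/(_ (enum_rank x)) := vM; rewrite !mxE enum_rankK => <-.
rewrite (reindex (enum_val : 'I_#|I| -> I)) /=; last exact/onW_bij/enum_val_bij.
apply: eq_bigr => i _; rewrite !mxE enum_rankK mulrC; congr (_ * _).
by rewrite /coef ffunE enum_valK.
Qed.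

Local Open Scope nat_scope.

(** * Through strands and arcs that turn back *)

Section ArcCounting.

Variables m n : nat.
Implicit Types d : diag m n.

(** Pigeonhole along arcs: a block of points whose arcs all end in another block is no larger than
    it. *)
Lemma leq_partner d k l (s : 'I_k -> pt m n) (t : 'I_l -> pt m n) :
  injective s -> (forall i, exists j, partner d (s i) = t j) -> k <= l.
Proof.
move=> sI /fin_all_exists[f fP]; rewrite -(card_ord k) -(card_ord l).
apply: (leq_card f) => i i' e; apply: sI; apply: (inv_inj (partnerK d)).
by rewrite !fP e.
Qed.

(** By planarity the arc at [a.+1] is trapped under the arc from a to a', hence shorter: induction
    on the span. *)
Lemma innermost_bot d (a a' : 'I_m) : partner d (inl a) = inl a' -> a < a' ->
  exists c c' : 'I_m, [/\ a <= c, c' <= a', c' = c.+1 :> nat & partner d (inl c) = inl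
    c'].
Proof.
have [k] := ubnP (a' - a); elim: k a a' => // k IH a a' le e lt.
have [e1|ne] := eqVneq (a.+1 : nat) a'; first by exists a, a'; split=> //; lia.
have c_lt : a.+1 < m by have := ltn_ord a'; lia.
pose c := Ordinal c_lt.
have := partner_planar d (inl a) (inl c); rewrite e /= ltnSn.
have -> : a.+1 < a' by lia.
case ec: (partner d (inl c)) => [c'|b] /=; last by have := ltn_ord a'; lia.
rewrite -leqNgt => le2; have ec' : partner d (inl c') = inl c by rewrite -ec partnerK.
have := partner_planar d (inl c') (inl a); rewrite e ec' /= ltnSn.
have -> : a.+1 < a' by lia.
have n1 : (c' : nat) <> c by move=> /val_inj h; have := partnerN d (inl c);
  rewrite ec h eqxx.
have n2 : (c' : nat) <> a.
  move=> /val_inj h; move: ec'; rewrite h e => -[h2].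
  by move: ne; rewrite h2 /= eqxx.
have n3 : (c' : nat) <> a'.
  move=> /val_inj h; move: ec'; rewrite h -e partnerK => -[h2].
  by have := congr1 val h2 => /=; lia.
rewrite !andbT -leqNgt => le3; move: n1 => /= n1.
have [||u [v [h1 h2 h3 h4]]] := IH c c' _ ec; rewrite /=; try lia.
by exists u, v; split=> //; move: h1 h2 => /=; lia.
Qed.

(** A through strand separates the diagram, so the points to its left at the bottom and at the top
    are matched with each other and equal in number. *)
Lemma through_left d a b : partner d (inl a) = inr b ->
    (forall a' : 'I_m, a' < a -> exists b', partner d (inl a') = inr b') ->
    (forall b' : 'I_n, b' < b -> exists a', partner d (inr b') = inl a') ->
  a = b :> nat.
Proof.
move=> e ha hb; have e' : partner d (inr b) = inl a by rewrite -e partnerK.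
have am := ltnW (ltn_ord a); have bn := ltnW (ltn_ord b).
apply/eqP; rewrite eqn_leq; apply/andP; split.
  apply: (@leq_partner d a b (fun i => inl (widen_ord am i)) (fun i => inr (widen_ord bn
    i))).
    by move=> i i' [/val_inj].
  move=> i; have [b' e2] := ha (widen_ord am i) (ltn_ord i).
  have := partner_planar d (inl (widen_ord am i)) (inl a); rewrite e e2 /=.
  rewrite ltn_ord /= => h.
  have nb : b' <> b.
    by move=> h2; move: e2;
      rewrite h2 -e => /(inv_inj (partnerK d)) [] /(congr1 val) /=; have := ltn_ord i;
        lia.
  have lt : b' < b.
    have : (b' : nat) <> b by move/val_inj.
    by have := ltn_ord b; have := ltn_ord b'; have := ltn_ord a; move: h; lia.
  by exists (Ordinal lt); congr inr; apply: val_inj.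
apply: (@leq_partner d b a (fun i => inr (widen_ord bn i)) (fun i => inl (widen_ord am
  i))).
  by move=> i i' [/val_inj].
move=> i; have [a' e2] := hb (widen_ord bn i) (ltn_ord i).
have e3 : partner d (inl a') = inr (widen_ord bn i) by rewrite -e2 partnerK.
have := partner_planar d (inl a) (inl a'); rewrite e e3 /= => h.
have na : a' <> a.
  by move=> h2; move: e3; rewrite h2 e => -[] /(congr1 val) /=; have := ltn_ord i; lia.
have lt : a' < a.
  have : (a' : nat) <> a by move/val_inj.
  by have := ltn_ord i; have := ltn_ord b; have := ltn_ord a'; move: h; lia.
by exists (Ordinal lt); apply: etrans e2 _; congr inl; apply: val_inj.
Qed.

Lemma through_eq d :
    (forall a, exists b, partner d (inl a) = inr b) ->
    (forall b, exists a, partner d (inr b) = inl a) ->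
  m = n /\ forall a b, partner d (inl a) = inr b -> a = b :> nat.
Proof.
move=> ha hb; split=> [|a b e]; last by apply: (through_left e).
apply/eqP; rewrite eqn_leq; apply/andP; split.
  by apply: (@leq_partner d m n inl inr) => // i i' [].
by apply: (@leq_partner d n m inr inl) => // i i' [].
Qed.

End ArcCounting.

Definition bot_arc m n (d : diag m n) := exists a a', partner d (inl a) = inl a'.
Definition top_arc m n (d : diag m n) := exists b b', partner d (inr b) = inr b'.

Lemma top_arc_dstar m n (d : diag m n) : top_arc (dstar d) <-> bot_arc d.
Proof.
split=> -[a [a' e]]; exists a, a'; move: e; rewrite dstar_partner /=.
  by case: (partner d _) => //= b [->].
by move=> ->.
Qed.

Lemma bot_arc_dstar m n (d : diag m n) : bot_arc (dstar d) <-> top_arc d.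
Proof. by rewrite -{2}(dstarK d) top_arc_dstar. Qed.

Lemma did_no_bot_arc n : ~ bot_arc (did n).
Proof. by move=> [a [a']]; rewrite did_partner. Qed.

Lemma did_no_top_arc n : ~ top_arc (did n).
Proof. by move=> [a [a']]; rewrite did_partner. Qed.

Lemma not_bot_arc m n (d : diag m n) : ~ bot_arc d -> forall a, exists b, partner d (inl
  a) = inr b.
Proof. by move=> h a; case e: (partner d (inl a)) => [a'|b]; [case: h;
  exists a, a'|exists b]. Qed.

Lemma not_top_arc m n (d : diag m n) : ~ top_arc d -> forall b, exists a, partner d (inr
  b) = inl a.
Proof. by move=> h a; case e: (partner d (inr a)) => [b|a']; [exists b|case: h;
  exists a, a']. Qed.

Lemma diag_arcs m n (d : diag m n) : m <> n -> bot_arc d \/ top_arc d.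
Proof.
move=> mn; have [|nb] := pselect (bot_arc d); first by left.
have [|nt] := pselect (top_arc d); first by right.
by have [] := through_eq (not_bot_arc nb) (not_top_arc nt).
Qed.

(** Without a bottom arc the n bottom points inject into the n top points, hence fill them, and
    [through_eq] makes every strand vertical. *)
Lemma bot_arc_nonid n (d : diag n n) : d <> did n -> bot_arc d.
Proof.
move=> nd; apply: contrapT => nb; have h := not_bot_arc nb; apply: nd.
have [f fP] := fin_all_exists h.
have fI : injective f.
  by move=> i i' e; have := fP i; rewrite e -fP => /(inv_inj (partnerK d)) [].
have ht b : exists a, partner d (inr b) = inl a.
  by exists (invF fI b); rewrite -{1}(f_invF fI b) -fP partnerK.
have [_ e] := through_eq h ht; apply: diag_ext => -[a|b]; rewrite did_partner /=.
  by rewrite fP; congr inr; apply: val_inj; rewrite /= (e _ _ (fP a)).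
have [a ea] := ht b; rewrite ea; congr inl; apply: val_inj => /=.
by apply: e; rewrite -ea partnerK.
Qed.

Lemma top_arc_nonid n (d : diag n n) : d <> did n -> top_arc d.
Proof.
move=> nd; apply/bot_arc_dstar/bot_arc_nonid => e; apply: nd.
by rewrite -(dstarK d) e dstar_did.
Qed.

Lemma dcomp_bot m n p (x : diag n p) (y : diag m n) a a' :
  partner y (inl a) = inl a' -> partner (dcomp x y) (inl a) = inl a'.
Proof.
move=> e; have := dcomp_connect x y (inl a) (inl a').
rewrite -[outer n (inl a')]/(lower p (inl a')) -e connect_lower connect0.
case/esym/orP => /eqP h; last by rewrite -h.
by case: h => h; case/eqP: (partnerN y (inl a)); rewrite e h.
Qed.

Lemma dcomp_top m n p (x : diag n p) (y : diag m n) b b' :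
  partner x (inr b) = inr b' -> partner (dcomp x y) (inr b) = inr b'.
Proof.
move=> e; have := dcomp_connect x y (inr b) (inr b').
rewrite -[outer n (inr b')]/(upper m (inr b')) -e connect_upper connect0.
case/esym/orP => /eqP h; last by rewrite -h.
by case: h => h; case/eqP: (partnerN x (inr b)); rewrite e h.
Qed.

Lemma bot_arc_comp m n p (x : diag n p) (y : diag m n) : bot_arc y -> bot_arc (dcomp x y).
Proof. by move=> [a [a' e]]; exists a, a'; apply: dcomp_bot. Qed.

Lemma top_arc_comp m n p (x : diag n p) (y : diag m n) : top_arc x -> top_arc (dcomp x y).
Proof. by move=> [a [a' e]]; exists a, a'; apply: dcomp_top. Qed.

(** * The generators e_j as diagrams *)

Section CupCap.

Variables (n : nat) (i0 i1 : 'I_n).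
Hypothesis i01 : i1 = i0.+1 :> nat.

Let i01N : i0 != i1.
Proof. by apply/eqP => /(congr1 val) /=; lia. Qed.

Lemma dcupcap_exists : exists d : diag n n, frel (partner d) =2 e_arcs i1.
Proof.
pose sw (a : 'I_n) : option 'I_n := if a == i0 then Some i1 else if a == i1 then Some i0
  else None.
pose g (u : pt n n) : pt n n :=
  match u with
  | inl a => if sw a is Some a' then inl a' else inr a
  | inr a => if sw a is Some a' then inr a' else inl a
  end.
have sw0 : sw i0 = Some i1 by rewrite /sw eqxx.
have sw1 : sw i1 = Some i0 by rewrite /sw eqxx eq_sym (negPf i01N).
have swP a : [\/ a = i0 /\ sw a = Some i1, a = i1 /\ sw a = Some i0 |
    [/\ (a : nat) <> i0, (a : nat) <> i1 & sw a = None]].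
  have [->|n0] := eqVneq a i0; first by constructor 1.
  have [->|n1] := eqVneq a i1; first by constructor 2.
  constructor 3; split; try by move/val_inj/eqP; apply/negP.
  by rewrite /sw (negPf n0) (negPf n1).
have [u|u|u v|d dP] := @diag_exists n n g.
- case: u => a /=; case: (swP a) => [[-> ->]|[-> ->]|[_ _ ->]] //=; apply/eqP => -[] /eqP;
  by rewrite 1?eq_sym (negPf i01N).
- by case: u => a /=; case: (swP a) => [[-> ->]|[-> ->]|[_ _ h]] /=;
  rewrite ?sw0 ?sw1 // h /= h.
- have b0 := ltn_ord i0; have b1 := ltn_ord i1.
  by case: u v => a [] b /=; have := ltn_ord a; have := ltn_ord b;
    case: (swP a) => [[-> ->]|[-> ->]|[? ? ->]];
    case: (swP b) => [[-> ->]|[-> ->]|[? ? ->]] /=; lia.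
exists d => u v; rewrite /= dP /e_arcs.
have sumE (S T : eqType) (x y : S) : (inl x == inl y :> S + T) = (x == y) by [].
have sumE' (S T : eqType) (x y : T) : (inr x == inr y :> S + T) = (x == y) by [].
have sumF (S T : eqType) (x : S) (y : T) : (inl x == inr y :> S + T) = false by [].
have sumF' (S T : eqType) (x : S) (y : T) : (inr y == inl x :> S + T) = false by [].
by case: u v => a [] b; case: (swP a) => [[ea e]|[ea e]|[? ? e]];
  rewrite /= e ?sumE ?sumE' ?sumF ?sumF' ?ea -?val_eqE /=; apply/idP/idP; lia.
Qed.

Definition dcupcap : diag n n := projT1 (cid dcupcap_exists).

Lemma tle_dcupcap : tle n i1 = bv dcupcap.
Proof. by apply: diagvec_ext => u v; rewrite -(projT2 (cid dcupcap_exists)). Qed.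

End CupCap.

Section Absorb.

Variables (m n : nat) (i0 i1 : 'I_n).
Hypothesis i01 : i1 = i0.+1 :> nat.

Lemma dcupcap_arcs u v : (partner (dcupcap i01) u == v) = e_arcs i1 u v.
Proof. exact: (projT2 (cid (dcupcap_exists i01)) u v). Qed.

Lemma chi_dcupcap a c : chi (dcupcap i01) a c =
  [&& a i0 == a i1, c i0 == c i1 & [forall i, (i != i0) && (i != i1) ==> (a i == c i)]].
Proof.
have p0 : partner (dcupcap i01) (inl i0) = inl i1 by apply/eqP;
  rewrite dcupcap_arcs /= i01 !eqxx.
have p1 : partner (dcupcap i01) (inl i1) = inl i0 by rewrite -p0 partnerK.
have q0 : partner (dcupcap i01) (inr i0) = inr i1 by apply/eqP;
  rewrite dcupcap_arcs /= i01 !eqxx.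
have q1 : partner (dcupcap i01) (inr i1) = inr i0 by rewrite -q0 partnerK.
have off i : (i != i0) && (i != i1) -> partner (dcupcap i01) (inl i) = inr i.
  move=> /andP[h0 h1]; apply/eqP; rewrite dcupcap_arcs /= eqxx /=; move: h0 h1.
  by rewrite -!val_eqE /=; lia.
have off' i : (i != i0) && (i != i1) -> partner (dcupcap i01) (inr i) = inl i.
  by move=> h; rewrite -(off i h) partnerK.
apply/forallP/and3P => [h|[h0 h1 /forallP h] u].
  split; [have := h (inl i1)|have := h (inr i1)|]; rewrite ?p1 ?q1 //.
  by apply/forallP => i; apply/implyP => hi; have := h (inr i); rewrite off'.
case: u => i; have [->|n0] := eqVneq i i0; rewrite ?p0 ?q0 //= 1?eq_sym //;
  have [->|n1] := eqVneq i i1; rewrite ?p1 ?q1 //= 1?eq_sym //;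
  have /implyP := h i; rewrite n0 n1 => /(_ isT) /eqP e.
  by rewrite off ?n0 ?n1 //= e.
by rewrite off' ?n0 ?n1 //= e.
Qed.

(** The cap of e_j closes with the cup of d into one loop. If the outer colors agree on the new cup,
    the middle colorings compatible with e_j are [b true] and [b false], which differ exactly on
    that loop. *)
Lemma dcomp_dcupcap (d : diag m n) : partner d (inr i0) = inr i1 ->
  dcomp (dcupcap i01) d = d /\ comp_loops (dcupcap i01) d = 1.
Proof.
move=> e; have e' : partner d (inr i1) = inr i0 by rewrite -e partnerK.
apply: dcomp_unique => a c; rewrite expn1.
have i01N : i0 != i1 by apply/eqP => /(congr1 val) /=; lia.
pose b t : coloring n := [ffun i => if (i == i0) || (i == i1) then t else c i].
have bN : b true != b false.
  by apply/eqP => /ffunP/(_ i0); rewrite !ffunE eqxx.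
have flip (b1 b2 : coloring n) : b1 i0 = b1 i1 -> b2 i0 = b2 i1 ->
    (forall i, i != i0 -> i != i1 -> b1 i = b2 i) -> chi d a b1 -> chi d a b2.
  move=> h1 h2 h /forallP hc; apply/forallP => u; have := hc u.
  have E w : w != inr i0 -> w != inr i1 -> bdcolor a b1 w = bdcolor a b2 w.
    by case: w => // i w0 w1; apply: h.
  have [->|u0] := eqVneq u (inr i0); first by rewrite e /= h2 eqxx.
  have [->|u1] := eqVneq u (inr i1); first by rewrite e' /= h2 eqxx.
  by rewrite !E // ?(can2_eq (partnerK d) (partnerK d)) ?e ?e'.
have bE t i : i != i0 -> i != i1 -> b t i = c i.
  by move=> h0 h1; rewrite ffunE (negPf h0) (negPf h1).
have b0 t : b t i0 = t by rewrite ffunE eqxx.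
have b1 t : b t i1 = t by rewrite ffunE eqxx orbT.
have [ec|nc] := eqVneq (c i0) (c i1); last first.
  rewrite big1 => [|b' _]; last by rewrite chi_dcupcap (negPf nc) andbF muln0.
  case: (boolP (chi d a c)) => // /forallP/(_ (inr i0)).
  by rewrite e /= eq_sym (negPf nc).
have chib t : chi d a (b t) = chi d a c.
  apply/idP/idP; apply: flip; rewrite ?b0 ?b1 // => i h0 h1; by rewrite bE.
have dcupcapE (b' : coloring n) : (chi (dcupcap i01) b' c : nat) = (b' == b true) + (b'
  == b false).
  have -> : chi (dcupcap i01) b' c = (b' == b true) || (b' == b false).
    rewrite chi_dcupcap ec eqxx /=; apply/andP/orP => [[/eqP h /forallP hi]|[]/eqP->].
    - case t: (b' i0); [left|right]; apply/eqP/ffunP => i; rewrite ffunE;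
      have [->|n0] := eqVneq i i0; rewrite ?t //;
      have [->|n1] := eqVneq i i1; rewrite -?h ?t //=;
      by have := hi i; rewrite n0 n1 => /eqP.
    - rewrite b0 b1; split=> //; apply/forallP => i; apply/implyP => /andP[h0 h1].
      by rewrite bE.
    rewrite b0 b1; split=> //; apply/forallP => i; apply/implyP => /andP[h0 h1].
    by rewrite bE.
  by have [->|] := eqVneq b' (b true); rewrite ?(negPf bN) //; case: (_ == _).
under eq_bigr => b' _ do rewrite dcupcapE mulnDr.
have one t : \sum_(b' : coloring n) chi d a b' * (b' == b t) = chi d a c.
  rewrite (bigD1 (b t)) //= big1 ?addn0 => [|b' /negPf ->]; last by rewrite muln0.
  by rewrite eqxx muln1 chib.
by rewrite big_split /= !one; lia.
Qed.

Lemma dstar_dcupcap : dstar (dcupcap i01) = dcupcap i01.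
Proof.
apply: chi_inj => a c; rewrite chi_dstar !chi_dcupcap andbCA; do 2 congr (_ && _).
by apply: eq_forallb => i; rewrite [a i == _]eq_sym.
Qed.

End Absorb.

Local Open Scope ring_scope.

(** The one by one case of [delta_dominant]: a zero delta would annihilate the vector 1. *)
Lemma delta_neq0 : delta != 0.
Proof.
apply/eqP => d0; suff /eqP : (1 : QA) = 0 by rewrite oner_eq0.
apply: (@delta_dominant unit (fun _ _ => 1%N) (fun _ => 1) _ _ tt) => [[] []//|i _].
by rewrite big1 // => j _; rewrite d0 expr1 mul0r.
Qed.

Lemma tle_comp m n (i0 i1 : 'I_n) (d : diag m n) : i1 = i0.+1 :> nat ->
  partner d (inr i0) = inr i1 -> tlcomp (tle n i1) (bv d) = delta *: bv d.
Proof.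
move=> i01 e; rewrite (tle_dcupcap i01) tlcomp_bv.
by have [-> ->] := dcomp_dcupcap i01 e; rewrite expr1.
Qed.

Lemma tlstar_tle n (i0 i1 : 'I_n) : i1 = i0.+1 :> nat -> tlstar (tle n i1) = tle n i1.
Proof. by move=> i01; rewrite (tle_dcupcap i01) tlstar_bv dstar_dcupcap. Qed.

Lemma tlcomp_tle m n (i0 i1 : 'I_m) (d : diag m n) : i1 = i0.+1 :> nat ->
  partner d (inl i0) = inl i1 -> tlcomp (bv d) (tle m i1) = delta *: bv d.
Proof.
move=> i01 e; rewrite -[LHS]tlstarK tlstar_comp (tlstar_tle i01) tlstar_bv (tle_comp i01).
  by rewrite -[_ *: _]addr0 tlstar_lin tlstar0 addr0 tlstar_bv dstarK.
by rewrite dstar_partner /= e.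
Qed.

Lemma tlstarZ m n a (X : TL m n) : tlstar (a *: X) = a *: tlstar X.
Proof. by rewrite -[a *: X]addr0 tlstar_lin tlstar0 addr0. Qed.

Lemma bot_arc_innermost m n (d : diag m n) : bot_arc d ->
  exists i0 i1 : 'I_m, i1 = i0.+1 :> nat /\ partner d (inl i0) = inl i1.
Proof.
case=> a [a' e]; case: (ltngtP a a') => lt.
- by have [c [c' [_ _ h1 h2]]] := innermost_bot e lt; exists c, c'.
- have e' : partner d (inl a') = inl a by rewrite -e partnerK.
  by have [c [c' [_ _ h1 h2]]] := innermost_bot e' lt; exists c, c'.
by have := partnerN d (inl a); rewrite e (val_inj lt) eqxx.
Qed.

Lemma top_arc_innermost m n (d : diag m n) : top_arc d ->
  exists i0 i1 : 'I_n, i1 = i0.+1 :> nat /\ partner d (inr i0) = inr i1.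
Proof.
move/bot_arc_dstar/bot_arc_innermost => [i0 [i1 [h e]]]; exists i0, i1; split=> //.
by have := dstar_partner (dstar d) (inr i0); rewrite dstarK => ->; rewrite /= e.
Qed.

(** An innermost top arc of d gives delta d = e_j d, and f e_j = 0; then delta is cancelled. *)
Lemma jw_kills_top m n (f : TL n n) (d : diag m n) :
  is_jones_wenzl f -> top_arc d -> tlcomp f (bv d) = 0.
Proof.
move=> [_ _ fe] /top_arc_innermost[i0 [i1 [i01 e]]].
apply: (scalerI delta_neq0); rewrite scaler0 -tlcompZr -(tle_comp i01 e) tlcompA.
by have [|_ ->] := fe i1; rewrite ?tlcomp0l // ltn_ord i01.
Qed.

Lemma jw_kills_bot m n (f : TL m m) (d : diag m n) :
  is_jones_wenzl f -> bot_arc d -> tlcomp (bv d) f = 0.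
Proof.
move=> [_ _ fe] /bot_arc_innermost[i0 [i1 [i01 e]]].
apply: (scalerI delta_neq0); rewrite scaler0 -tlcompZl -(tlcomp_tle i01 e) -tlcompA.
by have [|-> _] := fe i1; rewrite ?tlcomp0r // ltn_ord i01.
Qed.

Lemma comp_jw n (f X : TL n n) : is_jones_wenzl f -> tlcomp f X = coef X (did n) *: f.
Proof.
move=> fJ; rewrite {1}(TL_expand X) tlcomp_sumr (bigD1 (did n)) //= big1 => [|d /eqP nd].
  by rewrite addr0 tlcompZr -tlidE tlcomp_id_r.
by rewrite tlcompZr (jw_kills_top fJ) ?scaler0 //; exact: top_arc_nonid.
Qed.

Lemma jw_comp n (f X : TL n n) : is_jones_wenzl f -> tlcomp X f = coef X (did n) *: f.
Proof.
move=> fJ; rewrite {1}(TL_expand X) tlcomp_suml (bigD1 (did n)) //= big1 => [|d /eqP nd].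
  by rewrite addr0 tlcompZl -tlidE tlcomp_id_l.
by rewrite tlcompZl (jw_kills_bot fJ) ?scaler0 //; exact: bot_arc_nonid.
Qed.

Lemma jw_coef_did n (f : TL n n) : is_jones_wenzl f -> coef f (did n) = 1.
Proof.
move=> fJ; have [f0 ff _] := fJ; have := comp_jw f fJ; rewrite ff => e.
apply/eqP; rewrite -subr_eq0; have : (coef f (did n) - 1) *: f = 0.
  by rewrite scalerBl -e scale1r subrr.
by move/eqP; rewrite scaler_eq0 => /orP[//|/eqP].
Qed.

Lemma jw_unique n (f g : TL n n) : is_jones_wenzl f -> is_jones_wenzl g -> f = g.
Proof.
move=> fJ gJ; have := comp_jw g fJ; rewrite (jw_comp f gJ).
by rewrite !jw_coef_did // !scale1r.
Qed.

(* Up to a scalar, f_n is the functional dual to the identity for the trace form. *)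
Lemma jw_exists n : exists f : TL n n, is_jones_wenzl f /\ tltr f <> 0.
Proof.
have [g gP] := trace_dual (fun x : diag n n => (x == did n)%:R).
(* The trace of x^* d g is nonzero only if x^* d is the identity diagram up to loops, but the bottom
   arc of d persists in the product. *)
have gtop (d : diag n n) : d <> did n -> tlcomp (bv d) g = 0.
  move=> nd; apply: trace_nondegenerate => x _; rewrite tlcompA tlcomp_bv tlcompZl tltrZ.
  rewrite -(dstarK (dcomp _ _)) gP; case: eqP; rewrite ?mulr0 // => e.
  have : bot_arc (dcomp (dstar x) d) by apply/bot_arc_comp/bot_arc_nonid.
  by rewrite -(dstarK (dcomp _ _)) e dstar_did => /did_no_bot_arc.
have gbot (d : diag n n) : d <> did n -> tlcomp g (bv d) = 0.
  move=> nd; apply: trace_nondegenerate => x _.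
  rewrite tltrC -tlcompA tltrC tlcomp_bv tlcompZl tltrZ -(dstarK (dcomp _ _)) gP.
  case: eqP; rewrite ?mulr0 // => e.
  have : top_arc (dcomp d (dstar x)) by apply/top_arc_comp/top_arc_nonid.
  by rewrite -(dstarK (dcomp _ _)) e dstar_did => /did_no_top_arc.
have trg : tltr g = 1.
  by have := gP (did n); rewrite dstar_did -tlidE tlcomp_id_l eqxx.
(* Otherwise g would pair to 0 with every diagram of its own support. *)
have c0 : coef g (did n) != 0.
  apply/eqP => c0; have g0 : g = 0.
    apply: trace_nondegenerate => x; rewrite gP.
    by case: eqP => // -> /(_ c0).
  by have /eqP := trg; rewrite g0 tltr0 eq_sym oner_eq0.
have gg : tlcomp g g = coef g (did n) *: g.
  rewrite {2}(TL_expand g) tlcomp_sumr (bigD1 (did n)) //= big1 => [|d /eqP nd].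
    by rewrite addr0 tlcompZr -tlidE tlcomp_id_r.
  by rewrite tlcompZr gbot ?scaler0.
have trf : tltr ((coef g (did n))^-1 *: g) <> 0.
  by rewrite tltrZ trg mulr1; apply/eqP; rewrite invr_eq0.
exists ((coef g (did n))^-1 *: g); split; last exact: trf.
split.
- by move=> f0; apply: trf; rewrite f0 tltr0.
- rewrite tlcompZl tlcompZr gg [in X in _ *: X]scalerA (mulVf c0).
  by congr (_ *: _); exact: scale1r.
move=> j /andP[j0 jn]; have jn' : (j.-1 < n)%N by lia.
pose i0 := Ordinal jn'; pose i1 := Ordinal jn.
have i01 : i1 = i0.+1 :> nat by rewrite /=; lia.
have nd : dcupcap i01 <> did n.
  move=> e; apply: (@did_no_bot_arc n); rewrite -e; exists i0, i1; apply/eqP.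
  by rewrite dcupcap_arcs /= prednK // !eqxx.
by rewrite (tle_dcupcap i01) tlcompZl tlcompZr gtop // gbot // scaler0.
Qed.

Lemma jwP n : is_jones_wenzl (jw n).
Proof. by have [f [fJ _]] := jw_exists n;
  apply: (xgetPex 0 (P := is_jones_wenzl (n := n))); exists f. Qed.

Lemma Delta_neq0 n : Delta n != 0.
Proof.
have [f [fJ f0]] := jw_exists n; rewrite /Delta (jw_unique (jwP n) fJ).
exact/eqP.
Qed.

Lemma jw_idem n : tlcomp (jw n) (jw n) = jw n.
Proof. by have [] := jwP n. Qed.

Lemma tlstar_jw n : tlstar (jw n) = jw n.
Proof.
apply: jw_unique (jwP n); have [f0 ff fe] := jwP n; split.
- by move=> e; apply: f0; rewrite -(tlstarK (jw n)) e tlstar0.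
- by rewrite -tlstar_comp ff.
move=> j jn; have [e1 e2] := fe j jn; case/andP: jn => j0 jn.
have jn' : (j.-1 < n)%N by lia.
have i01 : Ordinal jn = (Ordinal jn').+1 :> nat by rewrite /=; lia.
have := tlstar_tle i01; rewrite /= => es.
by rewrite -es -!tlstar_comp e1 e2; split; exact: tlstar0.
Qed.

(** * Factoring through fewer strands *)

Local Open Scope nat_scope.

Lemma bpos_surj m n t : t < m + n -> exists u : pt m n, bpos u = t.
Proof.
move=> tmn; case: (ltnP t m) => tm; first by exists (inl (Ordinal tm)).
have h : m + n - t.+1 < n by lia.
by exists (inr (Ordinal h)) => /=; lia.
Qed.

Lemma bpos_lt m n (u : pt m n) : bpos u < m + n.
Proof. by case: u => a /=; have := ltn_ord a; lia. Qed.

(* The involution of the N boundary points made of three nests of arcs: around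
   the corner [0, r) u [N - r, N), on [r, r + 2p), and on [r + 2p, N - r). *)
Definition nests N r p t :=
  if (t < r) || (N - r <= t) then N - t.+1
  else if t < r + 2 * p then 2 * r + 2 * p - t.+1
  else N + 2 * p - t.+1.

Variant nests_spec N r p t : nat -> Prop :=
  | NestsLeft of t < r : nests_spec N r p t (N - t.+1)
  | NestsRight of N - r <= t : nests_spec N r p t (N - t.+1)
  | NestsCap of r <= t & t < N - r & t < r + 2 * p :
      nests_spec N r p t (2 * r + 2 * p - t.+1)
  | NestsInner of r <= t & t < N - r & r + 2 * p <= t :
      nests_spec N r p t (N + 2 * p - t.+1).

Lemma nestsP N r p t : nests_spec N r p t (nests N r p t).
Proof.
rewrite /nests; case: (ltnP t r) => tr /=; first exact: NestsLeft.
case: (leqP (N - r) t) => tN; first exact: NestsRight.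
by case: (ltnP t (r + 2 * p)) => tp; [exact: NestsCap|exact: NestsInner].
Qed.

Section Nests.

Variables N r p : nat.
Hypothesis le : 2 * r + 2 * p <= N.

Lemma nests_lt t : t < N -> nests N r p t < N.
Proof. by case: nestsP => *; lia. Qed.

Lemma nestsK t : t < N -> nests N r p (nests N r p t) = t.
Proof. by case: (nestsP N r p t) => *; case: nestsP => *; lia. Qed.

Lemma nests_neq t : ~~ odd N -> t < N -> nests N r p t != t.
Proof. by case: nestsP => *; lia. Qed.

Lemma nests_planar t u : t < N -> u < N ->
  ~~ [&& t < u, u < nests N r p t & nests N r p t < nests N r p u].
Proof.
move=> tN uN; apply/negP => /and3P[].
case: (nestsP N r p t) => [h1|h1|h1 h2 h3|h1 h2 h3];
  case: (nestsP N r p u) => [g1|g1|g1 g2 g3|g1 g2 g3] l1 l2 l3; lia.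
Qed.

End Nests.

Lemma nests_exists m n r p : ~~ odd (m + n) -> 2 * r + 2 * p <= m + n ->
  exists d : diag m n, forall u, bpos (partner d u) = nests (m + n) r p (bpos u).
Proof.
move=> ev le.
have ex (u : pt m n) : exists v : pt m n, bpos v = nests (m + n) r p (bpos u).
  by apply: bpos_surj; exact: nests_lt (bpos_lt u).
have [g gP] := fin_all_exists ex.
have [u|u|u v|d dP] := @diag_exists m n g.
- by apply: contraNneq (nests_neq le ev (bpos_lt u)) => e; rewrite -gP e.
- by apply: bpos_inj; rewrite !gP nestsK // bpos_lt.
- by rewrite !gP; exact: nests_planar (bpos_lt u) (bpos_lt v).
by exists d => u; rewrite dP gP.
Qed.

Section Cap.

Variables (n r : nat).
Hypothesis rn : r <= n.

Let r0 : 'I_n.+2 := inord r.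
Let r1 : 'I_n.+2 := inord r.+1.

Let r0E : r0 = r :> nat. Proof. by rewrite inordK; lia. Qed.
Let r1E : r1 = r.+1 :> nat. Proof. by rewrite inordK; lia. Qed.

Let skip (i : 'I_n) : 'I_n.+2 := inord (if i < r then i : nat else i.+2).

Let skipE (i : 'I_n) : skip i = (if i < r then i : nat else i.+2) :> nat.
Proof. by rewrite inordK //; case: ifP; have := ltn_ord i; lia. Qed.

Let skip_onto (l : 'I_n.+2) : (l != r0) && (l != r1) -> exists i, l = skip i.
Proof.
rewrite -!val_eqE /= r0E r1E => h; have := ltn_ord l => lt.
have hi : (if l < r then l : nat else l - 2) < n by case: ifP; lia.
exists (Ordinal hi); apply: ord_inj; rewrite skipE /=.
by case: (ltnP l r) hi => *; case: ifP; lia.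
Qed.

Let skip_off i : (skip i != r0) && (skip i != r1).
Proof.
have := skipE i; have := r0E; have := r1E => e1 e0 es; apply/andP.
split; apply/eqP => /(congr1 (@nat_of_ord _)); rewrite es ?e0 ?e1; case: ifP; lia.
Qed.

(** e_(r+1) is a cap below its mirror image, with no loop closed in between. This lowers the number
    of middle strands by two in [jw_sandwich_span]. *)
Lemma cap_factors : exists C : TL n.+2 n, tlcomp (tlstar C) C = tle n.+2 r.+1.
Proof.
have [||d dP] := @nests_exists n.+2 n r 1; try lia.
have d0 : partner d (inl r0) = inl r1.
  by apply: bpos_inj; rewrite dP /= r0E r1E; case: nestsP => *; lia.
have dk i : partner d (inr i) = inl (skip i).
  apply: bpos_inj; rewrite dP /= skipE; have := ltn_ord i.
  by case: nestsP => *; case: ifP => *; lia.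
have d1 : partner d (inl r1) = inl r0 by rewrite -d0 partnerK.
have ds i : partner d (inl (skip i)) = inr i by rewrite -dk partnerK.
have chid a b : chi d a b = (a r0 == a r1) && [forall i, b i == a (skip i)].
  apply/forallP/andP => [h|[h0 /forallP h] u].
    split; first by have := h (inl r1); rewrite d1.
    by apply/forallP => i; have := h (inr i); rewrite dk /= eq_sym.
  case: u => i; last by rewrite dk /= eq_sym.
  have [->|n0] := eqVneq i r0; first by rewrite d0 /= eq_sym.
  have [->|n1] := eqVneq i r1; first by rewrite d1.
  have [|j ->] := @skip_onto i; first by rewrite n0 n1.
  by rewrite ds /= h.
have r01 : r1 = r0.+1 :> nat by rewrite r0E r1E.
have h : dcomp (dstar d) d = dcupcap r01 /\ comp_loops (dstar d) d = 0.
  apply: dcomp_unique => a c; rewrite mul1n chi_dcupcap.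
  under eq_bigr => b _ do rewrite chi_dstar !chid.
  pose b0 : coloring n := [ffun i => a (skip i)].
  rewrite (bigD1 b0) //= big1 => [|b nb]; last first.
    case: forallP => [h|]; rewrite ?andbF //; case/eqP: nb; apply/ffunP => i.
    by rewrite ffunE; apply/eqP.
  rewrite addn0 mulnb; congr nat_of_bool.
  rewrite (introT forallP) => [|i]; last by rewrite ffunE.
  rewrite andbT; congr [&& _, _ & _]; apply/forallP/forallP => h i.
    by apply/implyP => /skip_onto[j ->]; have := h j; rewrite ffunE.
  by rewrite ffunE; have := h (skip i); rewrite skip_off.
exists (bv d); rewrite tlstar_bv tlcomp_bv; case: h => -> ->.
by rewrite expr0 scale1r -tle_dcupcap r1E.
Qed.

End Cap.

Local Open Scope ring_scope.

(** Write 1 = f_n + (1 - f_n) between B and A. Each diagram d of 1 - f_n has a top arc, so d =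
    delta^-1 e_j d = delta^-1 C^* (C d) passes through n - 2 strands, and strong induction on n
    applies. *)
Lemma jw_sandwich_span n m p (B : TL n p) (A : TL m n) (P : TL m p -> Prop) :
    linear_closed_pred P ->
    (forall z (B' : TL z p) (A' : TL m z), P (tlcomp B' (tlcomp (jw z) A'))) ->
  P (tlcomp B A).
Proof.
elim/ltn_ind: n B A => n IH B A [P0 PD] Pz.
have -> : tlcomp B A = 1 *: tlcomp B (tlcomp (jw n) A) + tlcomp B (tlcomp (tlid n - jw
  n) A).
  by rewrite scale1r -tlcompDr -tlcompDl addrC subrK tlcomp_id_l.
apply: (PD); first exact: Pz.
have -> : tlid n - jw n = \sum_(d | d != did n) (- coef (jw n) d) *: bv d.
  rewrite {1}(TL_expand (jw n)) (bigD1 (did n) isT) /= (jw_coef_did (jwP n)) scale1r.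
  by rewrite tlidE opprD addrA subrr add0r -sumrN; apply: eq_bigr => d _; rewrite scaleNr.
rewrite tlcomp_suml tlcomp_sumr.
under eq_bigr => d _ do rewrite tlcompZl tlcompZr.
apply: closed_pred_sum => // d /eqP/top_arc_nonid/top_arc_innermost[i0 [i1 [i01 e]]] _.
have := tle_comp i01 e; have := ltn_ord i0; have := ltn_ord i1.
move: (i0 : nat) (i1 : nat) i01 => k0 k1 ->; clear i0 i1 e => h1 h2 e.
move: n h1 h2 d e IH B A => [|[|n]] // h1 h2 d e IH B A.
have [|C CC] := @cap_factors n k0; first by lia.
have -> : bv d = delta^-1 *: tlcomp (tlstar C) (tlcomp C (bv d)).
  by rewrite tlcompA CC e scalerA mulVf ?scale1r // delta_neq0.
rewrite tlcompZl tlcompZr -[_ *: _]addr0; apply: (PD) => //.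
by rewrite -tlcompA tlcompA; apply: IH.
Qed.

(** * Trivalent vertices *)

Local Open Scope nat_scope.

Section VertexDiagram.

Variables x y z : nat.

Lemma vertex_exists : admissible x y z ->
  exists d : diag (x + y) z, frel (partner d) =2 @vertex_arcs x y z.
Proof.
case/and4P=> ev h1 h2 h3.
pose p := (x + y - z) %/ 2; pose r := (x + z - y) %/ 2; pose q := (y + z - x) %/ 2.
have xE : x = r + p by rewrite /r /p; lia.
have yE : y = p + q by rewrite /q /p; lia.
have zE : z = r + q by rewrite /q /r; lia.
(* The nest on [r, r + 2p) is the cap, the outer nest carries the r left strands, and the last one
   the q right strands. *)
have [||d dP] := @nests_exists (x + y) z r p; try lia.
exists d => u v; rewrite /= -(inj_eq (@bpos_inj _ _)) dP.
rewrite /vertex_arcs /vertex_cap /vertex_through -/p -/r.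
clear dP; move: p r q xE yE zE => p r q xE yE zE.
clear ev h1 h2 h3; case: u v => a [] b /=; have al := ltn_ord a; have bl := ltn_ord b;
  case: nestsP => *; lia.
Qed.

(** Planarity leaves no choice: the strands going up from the x points form an initial segment, the
    remaining x points are capped symmetrically with the first y points, and the other y points go
    up. Counting the top points then gives z. *)
Lemma vertex_unique (d : diag (x + y) z) : ~ top_arc d ->
    (forall a a', partner d (inl a) = inl a' -> (a < x) != (a' < x)) ->
  admissible x y z /\ frel (partner d) =2 @vertex_arcs x y z.
Proof.
move=> /not_top_arc nt nx.
have inj_l a a' b : partner d (inl a) = b -> partner d (inl a') = b -> a = a'.
  by move=> <- /esym/(inv_inj (partnerK d)) [].
have tx0 (a : 'I_(x + y)) c : a < x -> partner d (inl a) = inr c ->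
    forall a' : 'I_(x + y), a' < a -> exists c', partner d (inl a') = inr c'.
  move=> ax e a' lt; case e': (partner d (inl a')) => [b|c']; last by exists c'.
  have := nx _ _ e'; have := partner_planar d (inl a') (inl a); rewrite e e' /=.
  have := ltn_ord b; have := ltn_ord c.
  have : b <> a by move=> h; move: e'; rewrite h => h'; have := partnerK d (inl a');
    rewrite h' e.
  move=> h; have : (b : nat) <> a by move/val_inj.
  by lia.
have tx (a : 'I_(x + y)) c : a < x -> partner d (inl a) = inr c -> a = c :> nat.
  move=> ax e; apply: (through_left e); first exact: tx0 e.
  by move=> b' _; apply: nt.
(* The partner map exchanges the x points and the y points under the arc. *)
have cap (a b : 'I_(x + y)) : a < x -> partner d (inl a) = inl b -> a + b + 1 = x + x.
  move=> ax e; have e' : partner d (inl b) = inl a by rewrite -e partnerK.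
  have xb : x <= b by have := nx _ _ e; rewrite ax; case: ltnP.
  have inner (c : 'I_(x + y)) : a < c < b -> exists2 c', partner d (inl c) = inl c' & a
    < c' < b.
    move=> /andP[h1 h2]; have := partner_planar d (inl a) (inl c); rewrite e /= h1 h2 /=.
    case ec: (partner d (inl c)) => [c'|t] /=; last by have := ltn_ord b;
      have := ltn_ord t; lia.
    have ec' : partner d (inl c') = inl c by rewrite -ec partnerK.
    have := partner_planar d (inl c') (inl a); rewrite e ec' /= => h3 h4.
    have n1 : (c' : nat) <> a.
      by move/val_inj => h; move: ec'; rewrite h e => -[/(congr1 val)] /=; lia.
    have n2 : (c' : nat) <> b.
      by move/val_inj => h; move: ec'; rewrite h e' => -[/(congr1 val)] /=; lia.
    by exists c'; first by []; lia.
  have l1 : x - a.+1 <= b - x.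
    have bd (i : 'I_(x - a.+1)) : a.+1 + i < x + y by have := ltn_ord i; lia.
    have bd' (i : 'I_(b - x)) : x + i < x + y by have := ltn_ord i; have := ltn_ord b;
      lia.
    apply: (@leq_partner _ _ d _ _ (fun i => inl (Ordinal (bd i))) (fun i => inl
      (Ordinal (bd' i)))).
      by move=> i i' [] h; apply: val_inj => /=; lia.
    move=> i; have [|c' ec hc] := inner (Ordinal (bd i)).
      by rewrite /=; have := ltn_ord i; lia.
    have := nx _ _ ec; rewrite /= (_ : a.+1 + i < x); last by have := ltn_ord i; lia.
    move=> xc; have hi : c' - x < b - x by move: xc; case: ltnP; lia.
    exists (Ordinal hi); rewrite ec; congr inl; apply: val_inj => /=.
    by move: xc; case: ltnP; lia.
  have l2 : b - x <= x - a.+1.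
    have bd (i : 'I_(x - a.+1)) : a.+1 + i < x + y by have := ltn_ord i; lia.
    have bd' (i : 'I_(b - x)) : x + i < x + y by have := ltn_ord i; have := ltn_ord b;
      lia.
    apply: (@leq_partner _ _ d _ _ (fun i => inl (Ordinal (bd' i))) (fun i => inl
      (Ordinal (bd i)))).
      by move=> i i' [] h; apply: val_inj => /=; lia.
    move=> i; have [|c' ec hc] := inner (Ordinal (bd' i)).
      by rewrite /=; have := ltn_ord i; lia.
    have := nx _ _ ec; rewrite /= (_ : x + i < x = false); last by lia.
    move=> xc; have hi : c' - a.+1 < x - a.+1 by move: xc; case: ltnP; lia.
    by exists (Ordinal hi); rewrite ec; congr inl; apply: val_inj => /=; lia.
  by lia.
(* The mirror image of [tx]: here strands are counted from the right end. *)
have ty (b : 'I_(x + y)) c : x <= b -> partner d (inl b) = inr c -> x + y - b = z - c.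
  move=> xb e; have e' : partner d (inr c) = inl b by rewrite -e partnerK.
  have outb (b' : 'I_(x + y)) : b < b' -> exists2 c' : 'I_z, partner d (inl b') = inr c'
    & c < c'.
    move=> lt; have := partner_planar d (inl b) (inl b'); rewrite e /= lt.
    have -> : b' < x + y + (z - c.+1) by have := ltn_ord b'; lia.
    case eb: (partner d (inl b')) => [a|c'] /=.
      have ea : partner d (inl a) = inl b' by rewrite -eb partnerK.
      have ax : a < x by have := nx _ _ eb; rewrite (_ : b' < x = false) //; lia.
      have := partner_planar d (inl a) (inl b); rewrite ea e /=.
      have := ltn_ord c; have := ltn_ord b'; lia.
    move=> h; exists c' => //.
    have : (c' : nat) <> c.
      by move/val_inj => h'; have := inj_l _ _ _ e; rewrite -h' => /(_ _ eb) h2;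
        move: lt; rewrite h2 ltnn.
    by have := ltn_ord c'; have := ltn_ord c; lia.
  have outc (c' : 'I_z) : c < c' -> exists2 b' : 'I_(x + y), partner d (inr c') = inl b'
    & b < b'.
    move=> lt; have [b' eb] := nt c'; exists b' => //.
    have eb' : partner d (inl b') = inr c' by rewrite -eb partnerK.
    have := partner_planar d (inl b') (inl b); rewrite eb' e /=.
    have : (b' : nat) <> b by move/val_inj => h; move: eb'; rewrite h e => -[h2];
      move: lt; rewrite h2 ltnn.
    by have := ltn_ord b; have := ltn_ord c'; lia.
  have l1 : x + y - b.+1 <= z - c.+1.
    have bd (i : 'I_(x + y - b.+1)) : b.+1 + i < x + y by have := ltn_ord i; lia.
    have bd' (i : 'I_(z - c.+1)) : c.+1 + i < z by have := ltn_ord i; lia.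
    apply: (@leq_partner _ _ d _ _ (fun i => inl (Ordinal (bd i))) (fun i => inr
      (Ordinal (bd' i)))).
      by move=> i i' [] h; apply: val_inj => /=; lia.
    move=> i; have [|c' ec hc] := outb (Ordinal (bd i)); first by rewrite /=; lia.
    have hi : c' - c.+1 < z - c.+1 by have := ltn_ord c'; lia.
    by exists (Ordinal hi); rewrite ec; congr inr; apply: val_inj => /=; lia.
  have l2 : z - c.+1 <= x + y - b.+1.
    have bd (i : 'I_(x + y - b.+1)) : b.+1 + i < x + y by have := ltn_ord i; lia.
    have bd' (i : 'I_(z - c.+1)) : c.+1 + i < z by have := ltn_ord i; lia.
    apply: (@leq_partner _ _ d _ _ (fun i => inr (Ordinal (bd' i))) (fun i => inl
      (Ordinal (bd i)))).
      by move=> i i' [] h; apply: val_inj => /=; lia.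
    move=> i; have [|b' eb hb] := outc (Ordinal (bd' i)); first by rewrite /=; lia.
    have hi : b' - b.+1 < x + y - b.+1 by have := ltn_ord b'; lia.
    by exists (Ordinal hi); rewrite eb; congr inl; apply: val_inj => /=; lia.
  by have := ltn_ord b; have := ltn_ord c; lia.
(* [r] below is the first x point that does not go up, or x if all of them do. *)
pose through (a : nat) := [exists a' : 'I_(x + y), exists c, (a' == a :> nat) &&
  (partner d (inl a') == inr c)].
have exr : exists a, (x <= a) || ~~ through a by exists x; rewrite leqnn.
pose r := ex_minn exr.
have rx : r <= x by rewrite /r; case: ex_minnP => k _ /(_ x); apply; rewrite leqnn.
have thr (a : 'I_(x + y)) : a < r -> exists c, partner d (inl a) = inr c.
  rewrite /r; case: ex_minnP => k _ km lt; have := contraNN (km a).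
  rewrite -ltnNge => /(_ lt); rewrite negb_or negbK => /andP[_] /existsP[a' /existsP[c]].
  by case/andP=> /eqP/val_inj-> /eqP e; exists c.
have nthr (a : 'I_(x + y)) : r <= a -> a < x -> exists2 b : 'I_(x + y), partner d (inl
  a) = inl b & a + b + 1 = x + x.
  move=> ra ax; case e: (partner d (inl a)) => [b|c]; first by exists b => //; apply: cap.
  have tr : through a by apply/existsP; exists a; apply/existsP; exists c;
    rewrite e !eqxx.
  have xr : r < x by lia.
  have rxy : r < x + y by lia.
  have : through r.
    have [->//|ne] := eqVneq r a.
    have [|c' e'] := tx0 a c ax e (Ordinal rxy); first by rewrite /=; lia.
    by apply/existsP; exists (Ordinal rxy); apply/existsP; exists c'; rewrite e' !eqxx.
  have : (x <= r) || ~~ through r by rewrite /r; case: ex_minnP.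
  by rewrite leqNgt xr /= => /negPf->.
pose p := x - r.
have py : p <= y.
  have [->//|p0] := posnP p; have rxy : r < x + y by lia.
  have rx' : r < x by lia.
  by have [b _ /= h] := nthr (Ordinal rxy) (leqnn r) rx'; have := ltn_ord b; lia.
have ycap (b : 'I_(x + y)) : x <= b -> b < x + p -> exists2 a : 'I_(x + y), partner d
  (inl b) = inl a & a + b + 1 = x + x.
  move=> xb bx; have ha : x + x - b.+1 < x + y by lia.
  have [b' e' /= h] : exists2 b' : 'I_(x + y), partner d (inl (Ordinal ha)) = inl b' &
      Ordinal ha + b' + 1 = x + x by apply: nthr => /=; lia.
  exists (Ordinal ha); last by rewrite /=; lia.
  by rewrite -(partnerK d (inl (Ordinal ha))) e'; congr (partner d (inl _));
    apply: val_inj => /=; lia.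
have ythr (b : 'I_(x + y)) : x + p <= b -> exists2 c : 'I_z, partner d (inl b) = inr c &
  x + y - b = z - c.
  move=> xb; case e: (partner d (inl b)) => [a|c]; last first.
    by exists c => //; apply: ty => //; lia.
  have e' : partner d (inl a) = inl b by rewrite -e partnerK.
  have ax : a < x by have := nx _ _ e; rewrite (_ : b < x = false) //; lia.
  have := cap _ _ ax e'; case: (ltnP a r) => ar; last by lia.
  by have [c] := thr a ar; rewrite e'.
have rz : r <= z.
  have [->//|r0] := posnP r; have h : r.-1 < x + y by lia.
  have [|c e] := thr (Ordinal h); first by rewrite /=; lia.
  have rx' : Ordinal h < x by rewrite /=; lia.
  by have := tx _ _ rx' e => /= ?; have := ltn_ord c; lia.
(* The strand at the top point r, if there is one, comes from the y points beyond the cap and bounds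
   z from above. The strand at the bottom point x + p, if there is one, ends at or to the right of
   the top point r and bounds z from below. *)
have zE : z = r + (y - p).
  apply/eqP; rewrite eqn_leq; apply/andP; split.
    have [/eqP->|zr] := boolP (z == r); first by lia.
    have hz : r < z by lia.
    have [b eb] := nt (Ordinal hz);
      have eb' : partner d (inl b) = inr (Ordinal hz) by rewrite -eb partnerK.
    case: (ltnP b x) => bx.
      have := tx _ _ bx eb' => /= h; have [||b' e'] := nthr b; try lia.
      by rewrite eb' in e'.
    have := ty _ _ bx eb'; case: (ltnP b (x + p)) => bxp.
      by have [a e'] := ycap b bx bxp; rewrite eb' in e'.
    by rewrite /=; lia.
  have [->|q0] := posnP (y - p); first by rewrite addn0.
  have h : x + p < x + y by lia.
  have [|c e hc] := ythr (Ordinal h); first by [].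
  have cr : r <= c.
    rewrite leqNgt; apply/negP => cr; have hc' : c < x + y by lia.
    have [|c' e'] := thr (Ordinal hc'); first by [].
    have cx : c < x by lia.
    have := tx (Ordinal hc') c' cx e' => /= /val_inj h2; move: e'; rewrite -h2 -e.
    by move/(inv_inj (partnerK d)) => -[]; lia.
  by move: hc; rewrite /=; have := ltn_ord c; lia.
have adm : admissible x y z by apply/and4P; split; lia.
split=> //.
have hr : (x + z - y) %/ 2 = r by lia.
have hp : (x + y - z) %/ 2 = p by lia.
have main (a : 'I_(x + y)) v : partner d (inl a) = v -> vertex_arcs (inl a) v.
  rewrite /vertex_arcs /vertex_cap /vertex_through hr hp.
  case: (ltnP a r) => ar.
    have [c e] := thr a ar; rewrite e => <-.
    have ax : a < x by lia.
    by rewrite /= (tx _ _ ax e) eqxx.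
  case: (ltnP a x) => ax.
    have [b e h] := nthr a ar ax; rewrite e => <-; apply/orP; left.
    by apply/and4P; split=> //; lia.
  case: (ltnP a (x + p)) => axp.
    have [b e h] := ycap a ax axp; rewrite e => <-; apply/orP; right.
    by apply/and4P; split; lia.
  have [c e h] := ythr a axp; rewrite e => <-; apply/orP; right.
  rewrite /=; have := ltn_ord a; have := ltn_ord c; lia.
have [d' d'P] := vertex_exists adm.
suff -> : d = d' by exact: d'P.
have md (a : 'I_(x + y)) : partner d (inl a) = partner d' (inl a).
  by apply/esym/eqP; have := main a _ erefl; rewrite -d'P.
apply: diag_ext => -[a|c]; first exact: md.
have [b e] := nt c; rewrite e; apply: (inv_inj (partnerK d')).
by rewrite partnerK -md -e partnerK.
Qed.

End VertexDiagram.

Local Open Scope ring_scope.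

Lemma tltens_sumE m n m' n' (X : TL m n) (Y : TL m' n') :
  tltens X Y = \sum_(p : diag m n * diag m' n') (coef X p.1 * coef Y p.2) *: bv (dtens
    p.1 p.2).
Proof.
rewrite /tltens pair_big; apply: eq_bigr => -[d d'] _ /=; congr (_ *: _).
by apply: diagvec_ext => u v; rewrite -dtens_arcs.
Qed.

(** * Schur's lemma and fusion *)

Lemma jw_schur_neq m n (X : TL m n) : m <> n -> tlcomp (jw n) (tlcomp X (jw m)) = 0.
Proof.
move=> mn; move: X; apply: TL_ind => [|d].
  by apply: (linear_pred_eq (g := fun _ => 0)) => *;
    rewrite ?tlcomp_linl ?tlcomp_linr // scaler0 addr0.
have [/(jw_kills_bot (jwP m)) ->|/(jw_kills_top (jwP n)) e] := diag_arcs d mn.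
  by rewrite tlcomp0r.
by rewrite tlcompA e tlcomp0l.
Qed.

Lemma jw_schur_eq n (X : TL n n) :
  tlcomp (jw n) (tlcomp X (jw n)) = coef X (did n) *: jw n.
Proof. by rewrite (jw_comp X (jwP n)) tlcompZr jw_idem. Qed.

Section TensorOfCupCap.

Variables x y : nat.

Lemma tltens_tle_l (i0 i1 : 'I_x) : i1 = i0.+1 :> nat ->
  tltens (tle x i1) (tlid y) = tle (x + y) i1.
Proof.
move=> i01; have i01' : lshift y i1 = (lshift y i0).+1 :> nat by [].
rewrite (tle_dcupcap i01) tlidE tltens_bv -[tle _ _]/(tle (x + y) (lshift y i1))
  (tle_dcupcap i01').
congr bv; apply: chi_inj => a b; rewrite chi_dtens !chi_dcupcap chi_did -!andbA;
  do 2 congr (_ && _).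
apply/andP/forallP => [[/forallP h1 /forallP h2] i|h].
  by case: (split_ordP i) => j ->; rewrite ?(inj_eq (@lshift_inj _ _)) ?h1 // h2 implybT.
split; apply/forallP => i.
  by have := h (lshift y i); rewrite !(inj_eq (@lshift_inj _ _)).
by have := h (rshift x i); rewrite !eq_rlshift.
Qed.

Lemma tltens_tle_r (i0 i1 : 'I_y) : i1 = i0.+1 :> nat ->
  tltens (tlid x) (tle y i1) = tle (x + y) (x + i1).
Proof.
move=> i01; have i01' : rshift x i1 = (rshift x i0).+1 :> nat by rewrite /= i01 addnS.
rewrite (tle_dcupcap i01) tlidE tltens_bv -[tle _ _]/(tle (x + y) (rshift x i1))
  (tle_dcupcap i01').
congr bv; apply: chi_inj => a b; rewrite chi_dtens !chi_dcupcap chi_did andbCA;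
  congr (_ && _).
rewrite andbCA; congr (_ && _).
apply/andP/forallP => [[/forallP h1 /forallP h2] i|h].
  by case: (split_ordP i) => j ->; rewrite ?(inj_eq (@rshift_inj _ _)) ?h2 // h1 implybT.
split; apply/forallP => i; last first.
  by have := h (rshift x i); rewrite !(inj_eq (@rshift_inj _ _)).
by have := h (lshift y i); rewrite !eq_lrshift.
Qed.

(** The arcs that f_x (x) f_y kills, in contrast to the cap of the vertex, which joins x points to y
    points. *)
Definition side_arc z (d : diag (x + y) z) :=
  exists a a' : 'I_(x + y), partner d (inl a) = inl a' /\ (a < x)%N = (a' < x)%N.

Definition jw2 := tltens (jw x) (jw y).

Lemma jw2_kills z (d : diag (x + y) z) : side_arc d -> tlcomp (bv d) jw2 = 0.
Proof.
case=> a [a' [e s]]; wlog lt : a a' e s / (a < a')%N.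
  move=> h; case: (ltngtP a a') => lt; first exact: h lt.
    by apply: (h a' a) => //; rewrite -e partnerK.
  by have := partnerN d (inl a); rewrite e (val_inj lt) eqxx.
(* An innermost arc below a side arc lies on the same side, so it comes from an e_j of one tensor
   factor. *)
have [c [c' [h1 h2 cc e']]] := innermost_bot e lt.
suff ef : tlcomp (tle (x + y) c') jw2 = 0.
  apply: (scalerI delta_neq0); rewrite scaler0 -tlcompZl -(tlcomp_tle cc e') -tlcompA.
  by rewrite ef tlcomp0r.
case: (ltnP a x) s => ax /esym a'x.
  have hc : (c < x)%N by lia.
  have hc' : (c' < x)%N by lia.
  rewrite -[c' : nat]/(Ordinal hc' : nat) -(@tltens_tle_l (Ordinal hc) (Ordinal hc')) //.
  rewrite tlcomp_tens; have [_ _ /(_ c')[|-> _]] := jwP x; last by rewrite tltens0l.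
  by rewrite hc' cc.
have hc : (c - x < y)%N by have := ltn_ord c; lia.
have hc' : (c' - x < y)%N by have := ltn_ord c'; lia.
have -> : (c' = x + Ordinal hc' :> nat)%N by rewrite /= subnKC //; lia.
rewrite -(@tltens_tle_r (Ordinal hc) (Ordinal hc')) /=; last by lia.
rewrite tlcomp_tens; have [_ _ /(_ (c' - x)%N)[|-> _]] := jwP y; last by rewrite tltens0r.
by rewrite hc'; lia.
Qed.

Lemma jw2_idem : tlcomp jw2 jw2 = jw2.
Proof. by rewrite /jw2 tlcomp_tens !jw_idem. Qed.

Lemma tlstar_jw2 : tlstar jw2 = jw2.
Proof. by rewrite /jw2 tlstar_tens !tlstar_jw. Qed.

Variable z : nat.

Lemma diag_vertex_cases (d : diag (x + y) z) :
  [\/ top_arc d, side_arc d | admissible x y z /\ bv d = diagvec (@vertex_arcs x y z)].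
Proof.
have [|nt] := pselect (top_arc d); first by constructor 1.
have [|ns] := pselect (side_arc d); first by constructor 2.
constructor 3; have [|adm h] := vertex_unique nt; last by split=> //; apply: diagvec_ext.
by move=> a a' e; apply/negP => /eqP s; apply: ns; exists a, a'.
Qed.

Lemma vertexE : vertex x y z = tlcomp (jw z) (tlcomp (diagvec (@vertex_arcs x y z)) jw2).
Proof. by []. Qed.

Lemma jw_vertex : tlcomp (jw z) (vertex x y z) = vertex x y z.
Proof. by rewrite vertexE tlcompA jw_idem. Qed.

Lemma vertex_jw2 : tlcomp (vertex x y z) jw2 = vertex x y z.
Proof. by rewrite vertexE -!tlcompA jw2_idem. Qed.

(** Multiplicity one: of all diagrams, only that of the vertex survives between f_z and f_x (x) f_y.
    Admissibility is recorded with the scalar so that [fusion] can discard the other z. *)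
Lemma vertex_space (X : TL (x + y) z) :
  exists c, (c <> 0 -> admissible x y z) /\
    tlcomp (jw z) (tlcomp X jw2) = c *: vertex x y z.
Proof.
move: X; apply: TL_ind => [|d].
  split=> [|a X Y [c [hc ec]] [c' [hc' ec']]].
    by exists 0; rewrite tlcomp0l tlcomp0r scale0r.
  exists (a * c + c'); split; last first.
    transitivity (tlcomp (jw z) (a *: tlcomp X jw2 + tlcomp Y jw2)).
    by congr tlcomp; exact: tlcomp_linl.
  by rewrite tlcomp_linr ec ec' scalerA; exact: esym (scalerDl _ _ _).
  have [->|/eqP/hc //] := eqVneq c 0.
  by rewrite mulr0 add0r.
case: (diag_vertex_cases d) => [/(jw_kills_top (jwP z)) e|/jw2_kills ->|[adm ->]].
- by exists 0; rewrite tlcompA e tlcomp0l scale0r.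
- by exists 0; rewrite tlcomp0r scale0r.
by exists 1; rewrite scale1r.
Qed.

Hypothesis adm : admissible x y z.

Lemma vertex_neq0 : vertex x y z <> 0.
Proof.
have [d dP] := vertex_exists adm.
have ed : diagvec (@vertex_arcs x y z) = bv d by apply: diagvec_ext => u v; rewrite dP.
have nt : ~ top_arc d.
  move=> [c [c' e]]; have := dP (inr c) (inr c'); by rewrite /= e eqxx.
have ns : ~ side_arc d.
  move=> [a [a' [e s]]]; have := dP (inl a) (inl a'); rewrite /= e eqxx.
  by rewrite /vertex_cap; move: s; do 2 case: ltnP; rewrite ?andbF //=; lia.
suff : coef (vertex x y z) d = 1.
  by move=> h h0; move: h; rewrite h0 coef_zero => /eqP; rewrite eq_sym oner_eq0.
(* A nonidentity diagram of f_z leaves a top arc in the product, and d has none. *)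
have cjw (Y : TL (x + y) z) : coef (tlcomp (jw z) Y) d = coef Y d.
  rewrite {1}(TL_expand (jw z)) tlcomp_suml coef_bigsum (bigD1 (did z)) //= big1.
    by rewrite addr0 tlcompZl coef_scale jw_coef_did ?mul1r -?tlidE ?tlcomp_id_l //;
      exact: jwP.
  move=> d1 /eqP/top_arc_nonid t; rewrite tlcompZl (TL_expand Y) tlcomp_sumr.
  rewrite coef_scale coef_bigsum big1 ?mulr0 // => d2 _.
  rewrite tlcompZr tlcomp_bv !coef_scale coef_bv; case: eqP => [e|]; rewrite ?mulr0 //.
  by case: nt; rewrite e; apply: top_arc_comp.
(* Likewise a nonidentity diagram of f_x or f_y leaves a side arc, and d has none. *)
have cjw2 (Y : TL (x + y) z) : coef (tlcomp Y jw2) d = coef Y d.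
  rewrite {1}/jw2 tltens_sumE tlcomp_sumr coef_bigsum (bigD1 (did x, did y)) //= big1.
    rewrite addr0 tlcompZr coef_scale !jw_coef_did ?mul1r; try exact: jwP.
    by rewrite dtens_did -tlidE tlcomp_id_r.
  case=> d1 d2 /= ne; rewrite tlcompZr (TL_expand Y) tlcomp_suml.
  rewrite coef_scale coef_bigsum big1 ?mulr0 // => d3 _.
  rewrite tlcompZl tlcomp_bv !coef_scale coef_bv; case: eqP => [e|]; rewrite ?mulr0 //.
  case: ns; rewrite e; move: ne; rewrite xpair_eqE negb_and => /orP[] /eqP.
    case/bot_arc_nonid=> a [a' ea]; exists (lshift y a), (lshift y a').
    split; last by rewrite /= !ltn_ord.
    by apply: dcomp_bot; rewrite (dtens_partnerl _ _ (inl a)) ea.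
  case/bot_arc_nonid=> a [a' ea]; exists (rshift x a), (rshift x a').
  split; last by rewrite /= !(ltnNge _ x) !leq_addr.
  by apply: dcomp_bot; rewrite (dtens_partnerr _ _ (inl a)) ea.
by rewrite vertexE cjw cjw2 ed coef_bv eqxx.
Qed.

End TensorOfCupCap.

(* The identity of x + y strands factors through the f_z, and every
   f_z X (f_x (x) f_y) is a multiple of the vertex. *)
Lemma fusion x y (P : TL (x + y) (x + y) -> Prop) :
    linear_closed_pred P ->
    (forall z, admissible x y z -> P (tlcomp (tlstar (vertex x y z)) (vertex x y z))) ->
  P (jw2 x y).
Proof.
move=> PL PV; rewrite -jw2_idem.
pose P' X := P (tlcomp (jw2 x y) (tlcomp X (jw2 x y))).
suff : P' (tlcomp (jw2 x y) (jw2 x y)) by rewrite /P' !jw2_idem.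
have [P0 PD] := PL.
apply: jw_sandwich_span => [|z B A].
  split=> [|a X Y hX hY]; rewrite /P'; first by rewrite tlcomp0l tlcomp0r; exact: P0.
  rewrite (tlcomp_linl a X Y).
  rewrite tlcomp_linr.
  exact: (PD _ _ _ hX hY).
have [c [hc ec]] := vertex_space A; have [c' [hc' ec']] := vertex_space (tlstar B).
have eB : tlcomp (jw2 x y) (tlcomp B (jw z)) = c' *: tlstar (vertex x y z).
  by rewrite -tlstarZ -ec' !tlstar_comp tlstarK tlstar_jw tlstar_jw2 tlcompA.
rewrite /P' -(jw_idem z) -!tlcompA ec !tlcompA -[tlcomp (tlcomp _ B) _]tlcompA eB.
rewrite tlcompZl tlcompZr scalerA.
have [->|/eqP/hc adm] := eqVneq c 0; first by rewrite mulr0 scale0r.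
by rewrite -[_ *: _]addr0; apply: PD => //; apply: PV.
Qed.

Lemma vertex_orth x y z z' : z <> z' ->
  tlcomp (vertex x y z) (tlstar (vertex x y z')) = 0.
Proof.
move=> /nesym zz; rewrite -jw_vertex -[vertex x y z']jw_vertex tlstar_comp tlstar_jw.
by rewrite -tlcompA [tlcomp (vertex _ _ _) _]tlcompA jw_schur_neq.
Qed.

Lemma vertex_norm x y z : admissible x y z ->
  exists2 c, c != 0 & tlcomp (vertex x y z) (tlstar (vertex x y z)) = c *: jw z.
Proof.
move=> adm; pose X := tlcomp (vertex x y z) (tlstar (vertex x y z)).
have eX : X = coef X (did z) *: jw z.
  have e1 : tlcomp (jw z) X = X by rewrite /X tlcompA jw_vertex.
  have e2 : tlcomp X (jw z) = X by rewrite /X -tlcompA -{1}tlstar_jw -tlstar_comp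
    jw_vertex.
  by have := jw_schur_eq X; rewrite e2 e1.
exists (coef X (did z)) => //; apply/eqP => c0; apply: (vertex_neq0 adm).
rewrite -vertex_jw2.
(* Fusion reduces V (f_x (x) f_y) = 0 to the products V V'^* V', where V' is the vertex to z': they
   vanish by orthogonality if z' <> z and by [c0] if z' = z. *)
apply: (@fusion x y (fun Y => tlcomp (vertex x y z) Y = 0)) => [|z' adm'].
  split=> [|a Y Y' h h']; first exact: tlcomp0r.
  by rewrite (tlcomp_linr a _ Y Y') h h' scaler0 addr0.
rewrite tlcompA; have [<-|/eqP ne] := eqVneq z z'.
  by rewrite -/X eX c0 scale0r tlcomp0l.
by rewrite vertex_orth // tlcomp0l.
Qed.

Lemma theta_neq0 x y z : admissible x y z -> theta x y z != 0.
Proof.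
move=> /vertex_norm[c c0 e]; rewrite /theta e tltrZ.
exact: mulf_neq0 c0 (Delta_neq0 z).
Qed.

(** * Scaled matrix units *)

Section ScaledMatrixUnits.

Variables (R : comPzRingType) (V : lmodType R).
Variables (B : set V) (mul : V -> V -> V) (one : V).
Variables (disp : Order.disp_t) (L : finPOrderType disp) (T : L -> finType).
Variables (C : forall l : L, T l -> T l -> V) (w : forall l : L, T l -> R).
Variable coord : cell_index T -> V -> R.

Hypothesis R1 : (1 : R) <> 0.
Hypothesis algB : unital_algebra B mul one.
Hypothesis CB : forall l (s t : T l), B (C s t).
Hypothesis CC_eq : forall l (s t u v : T l),
  mul (C s t) (C u v) = ((t == u)%:R * w t) *: C s v.
Hypothesis CC_neq : forall l l' (s t : T l) (u v : T l'),
  l != l' -> mul (C s t) (C u v) = 0.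
Hypothesis coord_lin : forall p a x y, coord p (a *: x + y) = a * coord p x + coord p y.
Hypothesis coordC : forall p q, coord p (cell_elt C q) = (p == q)%:R.
Hypothesis spanC : forall P : V -> Prop, linear_closed_pred P ->
  (forall p, P (cell_elt C p)) -> forall x, B x -> P x.

Let coord_sum p (I : finType) (c : I -> R) (F : I -> V) :
  coord p (\sum_i c i *: F i) = \sum_i c i * coord p (F i).
Proof.
have c0 : coord p 0 = 0.
  by have := coord_lin p (-1) 0 0; rewrite scaler0 addr0 mulN1r addNr.
elim/big_rec2: _ => [//|i y1 y2 _ <-]; first by rewrite coord_lin.
Qed.

Let closed_B : linear_closed_pred B.
Proof. by split=> [|a x y]; [exact: (ualg_zero algB)|exact: (ualg_lin algB)]. Qed.

Let cell_elt_B p : B (cell_elt C p).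
Proof. exact: CB. Qed.

Let expand x : B x -> x = \sum_p coord p x *: cell_elt C p.
Proof.
move: x; apply: spanC => [|q]; last first.
  rewrite (bigD1 q) //= big1 ?addr0 => [|p pq]; first by rewrite coordC eqxx scale1r.
  by rewrite coordC (negPf pq) scale0r.
split=> [|a x y ex ey].
  rewrite big1 // => p _; have := coord_lin p (-1) 0 0.
  by rewrite scaler0 addr0 mulN1r addNr => ->; rewrite scale0r.
rewrite {1}ex {1}ey scaler_sumr -big_split; apply: eq_bigr => p _ /=.
by rewrite coord_lin scalerDl scalerA.
Qed.

Let flip (p : cell_index T) : cell_index T :=
  existT _ (tag p) ((tagged p).2, (tagged p).1).

Let phi x := \sum_p coord p x *: cell_elt C (flip p).

Let phi_lin a x y : phi (a *: x + y) = a *: phi x + phi y.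
Proof.
rewrite /phi scaler_sumr -big_split; apply: eq_bigr => p _ /=.
by rewrite coord_lin scalerDl scalerA.
Qed.

Let phiC p : phi (cell_elt C p) = cell_elt C (flip p).
Proof.
rewrite /phi (bigD1 p) //= big1 ?addr0 => [|q qp]; first by rewrite coordC eqxx scale1r.
by rewrite coordC (negPf qp) scale0r.
Qed.

Let phi0 : phi 0 = 0.
Proof. by have := phi_lin (-1) 0 0; rewrite scaler0 addr0 scaleN1r addNr. Qed.

Let phiB x : B x -> B (phi x).
Proof.
move: x; apply: spanC => [|p]; last by rewrite phiC; apply: cell_elt_B.
by split=> [|a x y hx hy]; rewrite ?phi0 ?phi_lin; case: closed_B => // _; apply.
Qed.

Let phiK x : B x -> phi (phi x) = x.
Proof.
move: x; apply: spanC => [|[l [s t]]]; last by rewrite !phiC.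
by split=> [|a x y hx hy]; rewrite ?phi0 // !phi_lin hx hy.
Qed.

Let mul0x x : B x -> mul 0 x = 0.
Proof.
move=> Bx; have := ualg_linl algB (-1) (ualg_zero algB) (ualg_zero algB) Bx.
by rewrite scaler0 addr0 scaleN1r addNr.
Qed.

Let mulx0 x : B x -> mul x 0 = 0.
Proof.
move=> Bx; have := ualg_linr algB (-1) (ualg_zero algB) (ualg_zero algB) Bx.
by rewrite scaler0 addr0 scaleN1r addNr.
Qed.

(** A product is nonzero only if its two inner indices agree, and its scalar depends on them alone;
    so exchanging rows and columns keeps it. *)
Let phi_mulC p q :
  phi (mul (cell_elt C p) (cell_elt C q)) = mul (phi (cell_elt C q)) (phi (cell_elt C p)).
Proof.
rewrite !phiC; case: p q => [l [s t]] [l' [u v]]; rewrite /cell_elt /=.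
have [e|ne] := eqVneq l l'; last by rewrite !CC_neq ?phi0 // eq_sym.
subst l'; rewrite !CC_eq -[_ *: C s v]addr0 phi_lin phi0 addr0.
rewrite (phiC (existT _ l (s, v))) /cell_elt /= [u == t]eq_sym.
by case: eqP => [->|]; rewrite ?mul0r ?scale0r.
Qed.

Let phi_mul x y : B x -> B y -> phi (mul x y) = mul (phi y) (phi x).
Proof.
move=> Bx By; move: x Bx.
suff h x : B x -> B x /\ phi (mul x y) = mul (phi y) (phi x) by move=> x /h[].
move: x; apply: spanC => [|p].
  split=> [|a x x' [Bx hx] [Bx' hx']].
    by split; [exact: (ualg_zero algB)|rewrite mul0x // phi0 mulx0 //; exact: phiB].
  split; first exact: (ualg_lin algB).
  rewrite (ualg_linl algB) // !phi_lin hx hx' (ualg_linr algB) //; exact: phiB.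
split; first exact: cell_elt_B.
move: y By; suff h y : B y -> B y /\ phi (mul (cell_elt C p) y) = mul (phi y) (phi
  (cell_elt C p)).
  by move=> y /h[].
move: y; apply: spanC => [|q]; last by split; [exact: cell_elt_B|exact: phi_mulC].
have Bp := cell_elt_B p; split=> [|a x x' [Bx hx] [Bx' hx']].
  by split; [exact: (ualg_zero algB)|rewrite mulx0 // phi0 mul0x //; exact: phiB].
split; first exact: (ualg_lin algB).
rewrite (ualg_linr algB) // !phi_lin hx hx' (ualg_linl algB) //; exact: phiB.
Qed.

Lemma scaled_matrix_units_cell_datum : cell_datum B mul one C.
Proof.
split=> //.
- move=> p q e; have := coordC p q; rewrite -e coordC eqxx.
  by case: eqP => // _ /R1.
- move=> c c0 p; have := coord_sum p c (cell_elt C); rewrite c0.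
  have -> : coord p 0 = 0.
    by have := coord_lin p (-1) 0 0; rewrite scaler0 addr0 mulN1r addNr.
  rewrite (bigD1 p) //= coordC eqxx mulr1 big1 ?addr0 // => q qp.
  by rewrite coordC eq_sym (negPf qp) mulr0.
- by move=> x /expand e; exists (coord^~ x).
(* The congruence is in fact an equality, so the error term is the zero element of the ideal. *)
- move=> x Bx l t; suff [r hr] : exists r : T l -> R, forall s, mul (C s t) x = \sum_v r
  v *: C s v.
    exists r => s; rewrite hr subrr; exists (fun _ => 0).
    by rewrite big1 // => p _; rewrite scale0r.
  suff [] : B x /\ exists r : T l -> R, forall s, mul (C s t) x = \sum_v r v *: C s v by
    [].
  move: x Bx; apply: spanC => [|[l' [u v]]].
    split=> [|a x y [Bx [r hr]] [By [r' hr']]].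
      split; first exact: (ualg_zero algB).
      by exists (fun _ => 0) => s; rewrite mulx0 // big1 // => v _; rewrite scale0r.
    split; first exact: (ualg_lin algB).
    exists (fun v => a * r v + r' v) => s; rewrite (ualg_linr algB) // hr hr'.
    rewrite scaler_sumr -big_split; apply: eq_bigr => v _ /=.
    by rewrite scalerDl scalerA.
  split; first exact: CB.
  have [e|ne] := eqVneq l l'; last first.
    exists (fun _ => 0) => s; rewrite CC_neq // big1 // => v' _; by rewrite scale0r.
  subst l'; exists (fun v' => (v' == v)%:R * ((t == u)%:R * w t)) => s.
  rewrite CC_eq (bigD1 v) //= eqxx mul1r big1 ?addr0 // => v' /negPf->.
  by rewrite mul0r scale0r.
exists phi; split=> //.
- by move=> l s t; exact: (phiC (existT _ l (s, t))).
- split=> [x /phiB //|x y /set_mem Bx /set_mem By e|x Bx].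
    by rewrite -(phiK Bx) e phiK.
  by exists (phi x); [exact: phiB|exact: phiK].
(* Apply [phi] to 1 phi(1): since [phi] is an involution, the result is 1 on one side and phi(1) on
   the other. *)
have B1 := ualg_one algB; have := phi_mul B1 (phiB B1).
by rewrite (ualg_mul1l algB) ?phiK // ?(ualg_mul1l algB) //; exact: phiB.
Qed.

End ScaledMatrixUnits.

(** * The vectors attached to admissible sequences *)

Lemma recast_id m n (X : TL m n) : recast n X = X.
Proof. by rewrite /recast; case: eqP => // e; rewrite (eq_axiomK e). Qed.

Section Paths.

Variable i : nat.
Implicit Types s t : nat -> nat.

(** Keeping the target z apart from [s k] puts the vectors of all sequences of the same weight into
    one space. *)
Definition path_vec s k z : TL (width i k) z := recast z (vvec i s k).

Definition ivalid s k :=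
  s 1%N = i /\ forall j, (1 <= j < k)%N -> admissible (s j) (s j.+1) i.

Lemma path_vec1 s : s 1%N = i -> path_vec s 1 i = jw i.
Proof.
by rewrite /path_vec /=; move: (s 1%N) => w ->; rewrite (recast_id (jw i)) recast_id.
Qed.

Lemma path_vecS s k w z : s k.+1 = w -> s k.+2 = z ->
  path_vec s k.+2 z = tlcomp (vertex w i z) (tltens (path_vec s k.+1 w) (tlid i)).
Proof. by move=> <- <-; rewrite /path_vec !recast_id. Qed.

Lemma ivalidW s k : ivalid s k.+1 -> ivalid s k.
Proof. by case=> s1 sa; split=> // j jk; apply: sa; lia. Qed.

Lemma ivalid_last s k : ivalid s k.+2 -> admissible (s k.+1) i (s k.+2).
Proof. by case=> _ /(_ k.+1); rewrite /admissible => h; have := h _; lia. Qed.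

Lemma path_vec_ext s t k z : (forall j, (0 < j <= k.+1)%N -> s j = t j) -> s k.+1 = z ->
  s 1%N = i -> path_vec s k.+1 z = path_vec t k.+1 z.
Proof.
elim: k z => [|k IH] z st sz s1.
  have t1 : t 1%N = i by rewrite -st.
  by move: sz; rewrite s1 => <-; rewrite (path_vec1 s1) (path_vec1 t1).
have tw : t k.+1 = s k.+1 by rewrite st //; lia.
have tz : t k.+2 = z by rewrite -st //; lia.
have st' j : (0 < j <= k.+1)%N -> s j = t j by move=> jk; apply: st; lia.
by rewrite (path_vecS erefl sz) (path_vecS tw tz) (IH _ st' erefl s1).
Qed.

Lemma jw_path_vec s k z : ivalid s k.+1 -> s k.+1 = z ->
  tlcomp (jw z) (path_vec s k.+1 z) = path_vec s k.+1 z.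
Proof.
case: k => [|k] [s1 _] sz.
  by move: sz; rewrite s1 => <-; rewrite (path_vec1 s1) jw_idem.
by rewrite (path_vecS erefl sz) tlcompA jw_vertex.
Qed.

Lemma tltens_jw_r w k (v : TL k w) : tlcomp (jw w) v = v ->
  tltens v (jw i) = tlcomp (jw2 w i) (tltens v (tlid i)).
Proof. by move=> e; rewrite /jw2 tlcomp_tens e tlcomp_id_r. Qed.

Lemma path_vec_pow s k z : ivalid s k.+1 -> s k.+1 = z ->
  tlcomp (path_vec s k.+1 z) (jwpow i k.+1) = path_vec s k.+1 z.
Proof.
elim: k z => [|k IH] z sv sz.
  have s1 : s 1%N = i by case: sv.
  move: sz; rewrite s1 => <-; rewrite (path_vec1 s1).
  have -> : jwpow i 1 = jw i by exact: tltens_0id.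
  exact: jw_idem.
have sv' := ivalidW sv.
rewrite (path_vecS erefl sz) -[jwpow i k.+2]/(tltens (jwpow i k.+1) (jw i)) -tlcompA.
rewrite tlcomp_tens (IH _ sv' erefl) tlcomp_id_l.
by rewrite (tltens_jw_r (jw_path_vec sv' erefl)) tlcompA vertex_jw2.
Qed.

(** Peel off the last vertex. Unless s and t agree just before it, the inner product vanishes by
    Schur's lemma; if they do, it is c f_w, which the vertex absorbs, leaving c V V^* with V V^* a
    nonzero multiple of f_z. *)
Lemma path_vec_orth s t k z : ivalid s k.+1 -> ivalid t k.+1 -> s k.+1 = z -> t k.+1 = z
  ->
  exists c, tlcomp (path_vec s k.+1 z) (tlstar (path_vec t k.+1 z)) = c *: jw z /\
    (c <> 0 <-> forall j, (0 < j <= k.+1)%N -> s j = t j).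
Proof.
elim: k z => [|k IH] z sv tv sz tz.
  have [[s1 _] [t1 _]] := (sv, tv); exists 1; split; last first.
    split=> [_ j jk|_ ]; last by apply/eqP; exact: oner_neq0.
    by have -> : j = 1%N by [lia]; rewrite s1 t1.
  by move: sz; rewrite s1 => <-;
    rewrite (path_vec1 s1) (path_vec1 t1) tlstar_jw jw_idem scale1r.
have sv' := ivalidW sv; have tv' := ivalidW tv.
rewrite (path_vecS erefl sz) (path_vecS erefl tz) tlstar_comp tlstar_tens tlstar_id.
rewrite -tlcompA [tlcomp (tltens _ _) _]tlcompA tlcomp_tens tlcomp_id_l.
have [e|/eqP ne] := eqVneq (s k.+1) (t k.+1); last first.
  exists 0; split; last by split=> // /(_ k.+1) h; case: ne; apply: h; lia.
  have -> : tlcomp (path_vec s k.+1 (s k.+1)) (tlstar (path_vec t k.+1 (t k.+1))) = 0.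
    rewrite -(jw_path_vec sv' erefl) -(jw_path_vec tv' erefl) tlstar_comp tlstar_jw.
    by rewrite -tlcompA [tlcomp (path_vec _ _ _) _]tlcompA jw_schur_neq //; exact: nesym.
  by rewrite tltens0l tlcomp0l tlcomp0r scale0r.
rewrite -e; have [c [-> cP]] := IH _ sv' tv' erefl (esym e).
have [c' c'0 ev] := vertex_norm (ivalid_last sv); rewrite sz in ev.
exists (c * c'); split.
  rewrite tltensZl tlcompZl tlcompZr tlcompA -[X in tlcomp X (tltens _ _)]vertex_jw2.
  rewrite -[tlcomp (tlcomp _ _) (tltens _ _)]tlcompA /jw2 tlcomp_tens jw_idem tlcomp_id_r.
  rewrite -/(jw2 _ _) [tlcomp (vertex _ _ _) (jw2 _ _)]vertex_jw2 ev.
  exact: scalerA.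
split=> [cc j jk|h].
  have [->|jk'] := eqVneq j k.+2; first by rewrite sz tz.
  apply: (cP.1 _); last by lia.
  by move=> c0; apply: cc; rewrite c0 mul0r.
have cN : c <> 0 by apply/cP.2 => j jk; apply: h; lia.
by apply/eqP; apply: mulf_neq0 c'0; apply/eqP.
Qed.

(** Inductively, v^* v (x) f_i = (v (x) 1)^* (f_w (x) f_i) (v (x) 1), and fusion resolves the middle
    into terms V^* V. Each gives the vector of s prolonged by z, below its own reflection. *)
Lemma jwpow_span k (P : TL (width i k.+1) (width i k.+1) -> Prop) :
    linear_closed_pred P ->
    (forall s z, ivalid s k.+1 -> s k.+1 = z ->
      P (tlcomp (tlstar (path_vec s k.+1 z)) (path_vec s k.+1 z))) ->
  P (jwpow i k.+1).
Proof.
elim: k P => [|k IH] P [P0 PD] Pv.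
  have -> : jwpow i 1 = jw i by exact: tltens_0id.
  have sv : ivalid (fun _ => i) 1 by split=> // j; lia.
  by have := Pv _ i sv erefl; rewrite (@path_vec1 (fun _ => i) erefl) tlstar_jw jw_idem.
apply: (IH (fun X => P (tltens X (jw i)))) => [|s w sv sw].
  split=> [|a X Y hX hY]; first by rewrite tltens0l.
  by rewrite (tltens_linl a X Y); exact: (PD _ _ _ hX hY).
set v := path_vec s k.+1 w; have jv : tlcomp (jw w) v = v by exact: jw_path_vec.
have -> : tltens (tlcomp (tlstar v) v) (jw i) =
    tlcomp (tlstar (tltens v (tlid i))) (tlcomp (jw2 w i) (tltens v (tlid i))).
  by rewrite -(tltens_jw_r jv) tlstar_tens tlstar_id tlcomp_tens tlcomp_id_l.
apply: (@fusion w i (fun Y => P (tlcomp (tlstar (tltens v (tlid i)))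
  (tlcomp Y (tltens v (tlid i)))))) => [|z adm].
  split=> [|a X Y hX hY]; first by rewrite tlcomp0l tlcomp0r.
  by rewrite (tlcomp_linl a X Y) tlcomp_linr; exact: (PD _ _ _ hX hY).
pose s' j := if j == k.+2 then z else s j.
have s'k : s' k.+2 = z by rewrite /s' eqxx.
have s's j : (j <= k.+1)%N -> s' j = s j by rewrite /s'; case: eqP => // ->; lia.
have sv' : ivalid s' k.+2.
  have [s1 sa] := sv; split=> [|j jk]; first by rewrite s's.
  have [->|jk'] := eqVneq j k.+1; last by rewrite !s's ?sa //; lia.
  by rewrite s'k s's // sw; move: adm; rewrite /admissible; lia.
have s'w : s' k.+1 = w by rewrite s's.
have s'1 : s' 1%N = i by case: sv'.
have s's' j : (0 < j <= k.+1)%N -> s' j = s j by move=> jk; rewrite s's //; lia.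
have := Pv s' z sv' s'k; rewrite (path_vecS s'w s'k) (path_vec_ext s's' s'w s'1) -/v.
by rewrite tlstar_comp -!tlcompA [tlcomp (tlstar (vertex _ _ _)) _]tlcompA.
Qed.

Lemma jwpow_idem k : tlcomp (jwpow i k) (jwpow i k) = jwpow i k.
Proof.
elim: k => [|k IH]; first exact: tlcomp_id_l.
by rewrite [jwpow i k.+1]/= tlcomp_tens IH jw_idem.
Qed.

Lemma tlstar_jwpow k : tlstar (jwpow i k) = jwpow i k.
Proof.
elim: k => [|k IH]; first exact: tlstar_id.
by rewrite [jwpow i k.+1]/= tlstar_tens IH tlstar_jw.
Qed.

Lemma eta_neq0 s k : ivalid s k -> eta i s k != 0.
Proof.
case=> _ sa; rewrite /eta big_nat_cond.
elim/big_ind: _ => [|a b|j /andP[jk _]]; first exact: oner_neq0.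
  exact: mulf_neq0.
apply: mulf_neq0; last by rewrite invr_eq0; exact: Delta_neq0.
by apply: theta_neq0; have := sa j jk; rewrite /admissible; lia.
Qed.

End Paths.

Lemma TLcol_algebra k i :
  unital_algebra (TLcol k i) (@tlcomp (width i k) (width i k) (width i k)) (jwpow i k).
Proof.
set F := jwpow i k; have FF : tlcomp F F = F := jwpow_idem i k.
have BE X : TLcol k i X -> tlcomp F X = X /\ tlcomp X F = X.
  case=> Y ->; split; first by apply: etrans (tlcompA _ _ _) _; rewrite FF.
  by rewrite -tlcompA -[tlcomp (tlcomp Y F) F]tlcompA FF.
have BI X : tlcomp F X = X -> tlcomp X F = X -> TLcol k i X.
  by move=> e1 e2; exists X; rewrite -/F e2 e1.
split.
- by apply: BI; rewrite ?tlcomp0l ?tlcomp0r.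
- move=> a X Y /BE[e1 e2] /BE[e3 e4]; apply: BI.
    by rewrite (tlcomp_linr a F X Y) e1 e3.
  by rewrite (tlcomp_linl a X Y) e2 e4.
- move=> X Y /BE[e1 e2] /BE[e3 e4]; apply: BI; first by rewrite tlcompA e1.
  by rewrite -tlcompA e4.
- exact: BI.
- by move=> a X Y Z _ _ _; exact: tlcomp_linl.
- by move=> a X Y Z _ _ _; exact: tlcomp_linr.
- by move=> X Y Z _ _ _; exact: tlcompA.
- by move=> X /BE[e _]; exact: e.
- by move=> X /BE[_ e]; exact: e.
Qed.

Lemma entry_ivalid k i (l : weights k.+1 i) (s : cellT l) :
  ivalid i (entry s) k.+1 /\ entry s k.+1 = weight_val l.
Proof.
have /andP[sa sl] := valP s; rewrite /entry; split; last first.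
  by apply: etrans _ (eqP sl); rewrite -nth_last size_map size_tuple.
have szs : size (map val (val s)) = k.+1 by rewrite size_map size_tuple.
move: sa szs; rewrite /ivalid;
  case: (map val (val s)) => [//|a r] /= /andP[/eqP -> pr] [sr].
split=> // -[//|j] jk /=; have /(pathP 0%N)/(_ j) := pr; rewrite sr.
by apply; lia.
Qed.

Lemma ivalid_cell k i s z : ivalid i s k.+1 -> s k.+1 = z ->
  exists (l : weights k.+1 i) (t : cellT l), weight_val l = z /\
    forall j, (0 < j <= k.+1)%N -> s j = entry t j.
Proof.
case=> s1 sa sz; pose q := mkseq (fun j => s j.+1) k.+1.
have szq : size q = k.+1 by rewrite size_mkseq.
have qa : iadmissible i q.
  have qE : q = i :: mkseq (fun j => s j.+2) k.
    by rewrite /q /mkseq /= s1 (iotaDl 1 0 k) -map_comp.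
  rewrite qE /= eqxx /=; apply/(pathP 0%N) => j; rewrite -qE size_mkseq => jk.
  by rewrite !nth_mkseq //; [apply: sa; lia|lia].
have bq j : (j <= k)%N -> (s j.+1 < (width i k.+1).+1)%N.
  move=> jk; have /allP := iadmissible_bound qa; rewrite szq ltnS; apply.
  by rewrite -(nth_mkseq 0%N (fun j => s j.+1) (jk : j < k.+1)%N) mem_nth // szq.
(* Admissibility forces s_j to have the parity of j i; together with s_k <= k i this makes s_k a
   weight k i - 2j. *)
have par j : (j <= k)%N -> ~~ odd (s j.+1 + j.+1 * i).
  elim: j => [|j IH] jk; first by rewrite s1 mul1n addnn odd_double.
  have := IH (ltnW jk); have /and4P[] := sa j.+1 jk; rewrite [(j.+2 * i)%N]mulSn; lia.
have lz : in_weights (inord z : 'I_(width i k.+1).+1).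
  have zb := bq k (leqnn k); rewrite sz in zb.
  have hj : ((width i k.+1 - z) %/ 2 < ((width i k.+1) %/ 2).+1)%N by lia.
  apply/existsP; exists (Ordinal hj); rewrite inordK //=; apply/eqP.
  have := par k (leqnn k); rewrite sz -widthE; move: zb => /=; move: (width i k) => N;
    lia.
pose l : weights k.+1 i := exist _ (inord z) lz.
have lv : weight_val l = z.
  by rewrite /weight_val /= inordK // -sz; apply: bq.
pose r : seq 'I_(width i k.+1).+1 := map inord q.
have rq : map val r = q.
  rewrite -map_comp -[RHS]map_id; apply/eq_in_map => a /(nthP 0%N)[j];
    rewrite szq => jk <-.
  by rewrite /= inordK // nth_mkseq //; apply: bq.
have szr : size r == k.+1 by rewrite size_map szq.
have tP : iadmissible i (map val (Tuple szr)) && (last 0%N (map val (Tuple szr)) ==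
  weight_val l).
  have -> : map val (Tuple szr) = q by exact: rq.
  by rewrite qa lv -sz -nth_last szq nth_mkseq ?eqxx.
exists l, (exist _ (Tuple szr) tP); split=> // -[//|j] jk.
rewrite /entry; set u := map val _; have -> : u = q by exact: rq.
by rewrite nth_mkseq.
Qed.

Lemma entry_inj k i (l : weights k i) (s t : cellT l) :
  (forall j, (0 < j <= k)%N -> entry s j = entry t j) -> s = t.
Proof.
move=> e; apply/val_inj/val_inj/(inj_map val_inj); apply: (@eq_from_nth _ 0%N).
  by rewrite !size_map !size_tuple.
by move=> j; rewrite size_map size_tuple => jk; apply: (e j.+1).
Qed.

Lemma coord_scalar (K : fieldType) (b c d : K) : b != 0 -> d != 0 -> c != 0 ->
  c^-1 * (true%:R * b * (true%:R * d * 1)) * (c / (b * d)) = (true && true)%:R.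
Proof.
by move=> b0 d0 c0; rewrite !mul1r mulr1 mulrACA mulVf // mul1r mulfV // mulf_neq0.
Qed.

(** * The G_{s,t} as scaled matrix units *)

Section Cells.

Variables k i : nat.
Implicit Types l : weights k.+1 i.

Let F := jwpow i k.+1.

Lemma jw_cellv l (s : cellT l) : tlcomp (jw (weight_val l)) (cellv s) = cellv s.
Proof. by have [sv sl] := entry_ivalid s; exact: jw_path_vec sv sl. Qed.

Lemma cellv_jwpow l (s : cellT l) : tlcomp (cellv s) F = cellv s.
Proof. by have [sv sl] := entry_ivalid s; exact: path_vec_pow sv sl. Qed.

Definition cell_norm l (s : cellT l) : QA :=
  coef (tlcomp (cellv s) (tlstar (cellv s))) (did (weight_val l)).

Lemma cellv_orth l (s t : cellT l) :
  tlcomp (cellv s) (tlstar (cellv t)) = ((s == t)%:R * cell_norm s) *: jw (weight_val l).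
Proof.
have [sv sl] := entry_ivalid s; have [tv tl] := entry_ivalid t.
have [c [e cP]] := path_vec_orth sv tv sl tl.
have [->|ne] := eqVneq s t.
  rewrite mul1r /cell_norm.
  have [c' [e' _]] := path_vec_orth tv tv tl tl.
  rewrite /cellv -/(path_vec _ _ _ _) e' coef_scale (jw_coef_did (jwP _)).
  by congr (_ *: _); exact: esym (mulr1 _).
rewrite mul0r; rewrite /cellv -/(path_vec _ _ _ _) e.
have [->|/eqP/cP.1/entry_inj st] := eqVneq c 0; first reflexivity.
by case/eqP: ne; exact: st.
Qed.

Lemma cell_norm_neq0 l (s : cellT l) : cell_norm s != 0.
Proof.
have [sv sl] := entry_ivalid s; have [c [e cP]] := path_vec_orth sv sv sl sl.
rewrite /cell_norm /cellv -/(path_vec _ _ _ _) e coef_scale (jw_coef_did (jwP _)) mulr1.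
by apply/eqP/cP.2.
Qed.

Lemma cellv_orth_neq l l' (s : cellT l) (t : cellT l') X : l != l' ->
  tlcomp (cellv s) (tlcomp X (tlstar (cellv t))) = 0.
Proof.
move=> ne; rewrite -(jw_cellv s) -(jw_cellv t) tlstar_comp tlstar_jw.
rewrite -tlcompA [tlcomp X _]tlcompA [tlcomp (cellv s) _]tlcompA jw_schur_neq //.
by move=> e; case/eqP: ne; apply/esym/val_inj/val_inj.
Qed.

Lemma cellv_schur l (s t : cellT l) X :
  exists c, tlcomp (cellv s) (tlcomp X (tlstar (cellv t))) = c *: jw (weight_val l).
Proof.
rewrite -(jw_cellv s) -(jw_cellv t) tlstar_comp tlstar_jw.
rewrite -tlcompA [tlcomp X _]tlcompA [tlcomp (cellv s) _]tlcompA jw_schur_eq.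
by eexists.
Qed.

Definition cell_eta l (s : cellT l) := eta i (entry s) k.+1.

Lemma cell_eta_neq0 l (s : cellT l) : cell_eta s != 0.
Proof. by apply: eta_neq0; case: (entry_ivalid s). Qed.

Lemma cellGE l (s t : cellT l) :
  cellG s t = (cell_eta s)^-1 *: tlcomp (tlstar (cellv s)) (cellv t).
Proof. by []. Qed.

Lemma cellG_in l (s t : cellT l) : TLcol k.+1 i (cellG s t).
Proof.
exists (cellG s t); rewrite cellGE tlcompZl tlcompZr -tlcompA cellv_jwpow tlcompA.
by rewrite -[jwpow i k.+1]tlstar_jwpow -tlstar_comp cellv_jwpow.
Qed.

Lemma cellG_mul l (s t u v : cellT l) :
  tlcomp (cellG s t) (cellG u v) =
  ((t == u)%:R * (cell_norm t / cell_eta t)) *: cellG s v.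
Proof.
rewrite !cellGE tlcompZl tlcompZr -tlcompA [tlcomp (cellv t) _]tlcompA cellv_orth.
rewrite tlcompZl tlcompZr jw_cellv !scalerA; congr (_ *: _).
case: eqP => [->|_]; last by rewrite !mul0r mulr0.
rewrite !mul1r; move: (cell_eta s)^-1 (cell_eta u)^-1 (cell_norm u) => a b c.
by rewrite -mulrA mulrC [b * c]mulrC.
Qed.

Lemma cellG_mul_neq l l' (s t : cellT l) (u v : cellT l') : l != l' ->
  tlcomp (cellG s t) (cellG u v) = 0.
Proof.
move=> ne; rewrite !cellGE tlcompZl tlcompZr -tlcompA.
have h := cellv_orth_neq t u (tlid _) ne; rewrite tlcomp_id_l in h.
by rewrite [tlcomp (cellv t) _]tlcompA h tlcomp0l tlcomp0r !scaler0.
Qed.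

(** For X = G_{s,t} the element v_s X v_t^* is n_s n_t / eta_s times f_l, whence the
    normalization. *)
Definition cell_coord (p : cell_index (@cellT k.+1 i)) X : QA :=
  let s := (tagged p).1 in let t := (tagged p).2 in
  coef (tlcomp (cellv s) (tlcomp X (tlstar (cellv t)))) (did _)
  * (cell_eta s / (cell_norm s * cell_norm t)).

Lemma cell_coord_lin p a X Y :
  cell_coord p (a *: X + Y) = a * cell_coord p X + cell_coord p Y.
Proof.
rewrite /cell_coord (tlcomp_linl a X Y) tlcomp_linr coef_lin mulrDl -mulrA.
by [].
Qed.

Lemma cell_coordG p q : cell_coord p (cell_elt (@cellG k.+1 i) q) = (p == q)%:R.
Proof.
case: p q => l [s t] [l' [u v]]; rewrite /cell_coord /cell_elt /= cellGE.
rewrite tlcompZl tlcompZr coef_scale.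
have [e|ne] := eqVneq l l'; last first.
  have h := cellv_orth_neq s u (tlid _) ne; rewrite tlcomp_id_l in h.
  rewrite -tlcompA tlcompA h tlcomp0l coef_zero mulr0 mul0r.
  by case: eqP => // /(congr1 (@projT1 _ _)) /= e; rewrite e eqxx in ne.
subst l'; rewrite -tlcompA tlcompA !cellv_orth tlcompZl tlcompZr jw_idem !coef_scale.
rewrite (jw_coef_did (jwP _)).
have -> : (existT _ l (s, t) == existT (fun l => (cellT l * cellT l)%type) l (u, v)
    :> cell_index (@cellT k.+1 i)) = (s == u) && (v == t).
  by rewrite -tag_eqE /tag_eq eqxx tagged_asE xpair_eqE [t == v]eq_sym.
move: (cell_norm_neq0 s) (cell_norm_neq0 t) (cell_eta_neq0 s).
case: (eqVneq s u) => [<-|_]; case: (eqVneq v t) => [->|_];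
  move: (cell_norm s) (cell_norm _) (cell_eta _) => a b c.
- by move: (cell_norm t) => d b0 d0 c0; exact: (coord_scalar b0 d0 c0).
- by move: (cell_norm t) (cell_norm v) => d e _ _ _; rewrite !(mul0r, mulr0).
- by move: (cell_norm _) (cell_eta _) => d e _ _ _; rewrite !(mul0r, mulr0).
by move: (cell_norm t) (cell_norm v) (cell_eta _) => d e f _ _ _; rewrite !(mul0r, mulr0).
Qed.

Lemma cellG_span (P : TL (width i k.+1) (width i k.+1) -> Prop) :
    linear_closed_pred P -> (forall p, P (cell_elt (@cellG k.+1 i) p)) ->
  forall X, TLcol k.+1 i X -> P X.
Proof.
move=> [P0 PD] PG _ [X ->].
apply: (@jwpow_span i k (fun Y => P (tlcomp Y (tlcomp X (jwpow i k.+1))))).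
  split=> [|a Y Y' hY hY']; first by rewrite tlcomp0l.
  by rewrite (tlcomp_linl a Y Y'); exact: (PD _ _ _ hY hY').
move=> s z sv sz.
apply: (@jwpow_span i k (fun Y => P (tlcomp _ (tlcomp X Y)))).
  split=> [|a Y Y' hY hY']; first by rewrite !tlcomp0r.
  by rewrite (tlcomp_linr a X Y Y') tlcomp_linr; exact: (PD _ _ _ hY hY').
move=> t z' tv tz'.
have [l [s' [lz es]]] := ivalid_cell sv sz.
have [l' [t' [lz' et]]] := ivalid_cell tv tz'.
have s1 : s 1%N = i by case: sv.
have t1 : t 1%N = i by case: tv.
rewrite (path_vec_ext es sz s1) (path_vec_ext et tz' t1) -lz -lz'.
rewrite -!/(cellv _).
rewrite -tlcompA [tlcomp X _]tlcompA [tlcomp (cellv s') _]tlcompA.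
have [e|ne] := eqVneq l l'; last by rewrite cellv_orth_neq // tlcomp0l tlcomp0r.
subst l'; have [c ->] := cellv_schur s' t' X.
rewrite tlcompZl tlcompZr jw_cellv.
have -> : tlcomp (tlstar (cellv s')) (cellv t') = cell_eta s' *: cellG s' t'.
  by rewrite cellGE scalerA mulfV ?scale1r // cell_eta_neq0.
rewrite scalerA -[_ *: _]addr0; exact: (PD _ _ _ (PG (existT _ l (s', t'))) P0).
Qed.

End Cells.

Theorem theorem4p10 (k i : nat) (hk : (1 <= k)%N) (hi : (1 <= i)%N) :
  cellular_with_datum QA (TL (width i k) (width i k))
    (TLcol k i) (@tlcomp (width i k) (width i k) (width i k)) (jwpow i k)
    (weights k i) (@cellT k i) (@cellG k i).
Proof.
case: k hk => [//|k] _; have alg := TLcol_algebra k.+1 i.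
split=> //; apply: (@scaled_matrix_units_cell_datum _ _ _ _ _ _ _ _ _
  (fun l s => cell_norm s / cell_eta s) (@cell_coord k i)) => //.
- by apply/eqP; exact: oner_neq0.
- exact: cellG_in.
- exact: cellG_mul.
- exact: cellG_mul_neq.
- exact: cell_coord_lin.
- exact: cell_coordG.
exact: cellG_span.
Qed.
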